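(* Let $0<p<\infty$, $w\in A_{q,r}$ with $0<q<p$ and $1<r<\infty$, and $\max\{p/q,\,rp/(r-1)\}<s<\infty$. Let $b\in BMO$. Suppose that an operator $T$ is defined for every $(p,s,w)$-block $h$ and satisfies the size condition: for every $(p,s,w)$-block $h$ with $\operatorname{supp} h\subset Q$, $Q$ a cube with center $x_0$, $$|Th(x)|\le C\frac{\|h\|_{L^1}}{|x-x_0|^n}\quad\text{for } x\in(2n^{1/2}Q)^c,$$ where $C$ is independent of $h$. Suppose that $\|T_bh\|_{L^s}\le C\|b\|_{BMO}\|h\|_{L^s}$ for every $(p,s,w)$-block $h$. (i) If $T$ is a linear operator, then $T_b$ has a unique bounded extension (still denoted by $T_b$) from $BH^{p,s}_w$ to itself that satisfies $$T_b\Big(\sum_{j=1}^\infty\lambda_ja_j\Big)(x)=\sum_{j=1}^\infty\lambda_jT_ba_j(x)$$ in $BH^{p,s}_w$ and $w$-a.e., and $$\|T_bf\|_{BH^{p,s}_w}\le C\|b\|_{BMO}\|f\|_{BH^{p,s}_w},$$ for all $f=\sum_{j=1}^\infty\lambda_ja_j\in BH^{p,s}_w$. (ii) If $T$ is a sublinear operator whose commutator satisfies $$\Big|T_b\Big(\sum_j\lambda_ja_j\Big)(x)\Big|\le\sum_j|\lambda_j||T_ba_j(x)|\quad w\text{-a.e.}$$ for $f=\sum_j\lambda_ja_j\in BH^{p,s}_w$, and $w\in P$, then $T_b$ has a bounded extension from $BH^{p,s}_w$ to itself that satisfies $\|T_bf\|_{BH^{p,s}_w}\le C\|b\|_{BMO}\|f\|_{BH^{p,s}_w}$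 for all $f\in BH^{p,s}_w$.
   Context: Work on $\mathbb{R}^n$. For a cube $Q$ and $\lambda>0$, $\lambda Q$ is the cube concentric with $Q$ whose edges are $\lambda$ times as long. A weight is a nonnegative locally integrable function $w$; $w(Q)=\int_Qw$. ''$w$-a.e.'' means for all $x$ outside a set $E$ with $w(E)=0$. $\bar p=\min\{p,1\}$. $w\in D_q$ ($0<q<\infty$) if $w(\lambda Q)\le C\lambda^{nq}w(Q)$ for every cube $Q$ and $\lambda>1$, $C$ independent of $Q,\lambda$. $w\in RH_r$ ($1<r<\infty$) if $\left(\frac1{|Q|}\int_Qw^r\right)^{1/r}\le\frac{C}{|Q|}\int_Qw$ for every cube $Q$, $C$ independent of $Q$. $A_{q,r}=D_q\cap RH_r$. $w\in P$ if there is a sequence $\{Q_i\}$ of cubes with $w(Q_i)>0$ for each $i$, with pairwise disjoint interiors, such that $\mathbb{R}^n=\bigcup_{i=1}^\infty Q_i$. $h$ is a $(p,s,w)$-block if there is a cube $Q$ with $\operatorname{supp}h\subseteq Q$ and $\|h\|_{L^s}\le|Q|^{1/s}w(Q)^{-1/p}$. $BH^{p,s}_w$ is the set of functions $f=\sum_{k=1}^\infty\lambda_kh_k$ with $h_k$ $(p,s,w)$-blocks and $\lambda_k$ real numbers with $\sum_k|\lambda_k|^{\bar p}<\infty$, with quasi-norm $\|f\|_{BH^{p,s}_w}=\inf\left(\sum_k|\lambda_k|^{\bar p}\right)^{1/\bar p}$ over all such decompositions. Writing $f=\sum_j\lambda_ja_j\in BH^{p,s}_w$ means each $a_j$ is a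 $(p,s,w)$-block and $\sum_j|\lambda_j|^{\bar p}<\infty$. $b\in BMO$ if $b$ is locally integrable and $\|b\|_{BMO}=\sup_Q\frac1{|Q|}\int_Q|b-b_Q|<\infty$, $b_Q=\frac1{|Q|}\int_Qb$. The commutator of $T$ with $b$ is defined formally by $T_bf(x)=T\big((b(x)-b(\cdot))f(\cdot)\big)(x)$; this is understood to be meaningful for blocks $f$. $C$ denotes a positive constant, not necessarily the same at each occurrence, independent of $h$, $f$ and $b$. *)

(* Defs.v *)
From HB Require Import structures.
From mathcomp Require Import all_boot all_order all_algebra.
From mathcomp Require Import all_classical all_reals all_analysis.
From mathcomp Require Import ring lra.
Set Implicit Arguments. Unset Strict Implicit. Unset Printing Implicit Defensive.
Import Order.TTheory GRing.Theory Num.Theory.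
Import numFieldNormedType.Exports.
Local Open Scope classical_set_scope.
Local Open Scope ring_scope.

Section lebesgue_tuple.
Context {R : realType}.
Local Notation leb1 := (@lebesgue_measure R).
Local Notation X1 := (measurableTypeR R).

Definition tcons n (xy : X1 * n.-tuple X1) : n.+1.-tuple X1 :=
  cons_tuple xy.1 xy.2.

Definition tuncons n (x : n.+1.-tuple X1) : X1 * n.-tuple X1 :=
  (tnth x ord0, [tuple of behead x]).

Lemma tconsK n : cancel (@tcons n) (@tuncons n).
Proof. by move=> [x y]; congr (_, _); exact/val_inj. Qed.

Lemma tunconsK n : cancel (@tuncons n) (@tcons n).
Proof. by move=> x; apply/val_inj; case: x => -[]. Qed.

Lemma measurable_tcons n : measurable_fun setT (@tcons n).
Proof. exact: (@measurable_cons _ _ _ _ fst n snd). Qed.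

Lemma measurable_tuncons n : measurable_fun setT (@tuncons n).
Proof.
apply: (@measurable_fun_pair _ _ _ _ _ _ (fun x : n.+1.-tuple X1 => tnth x ord0)
  (fun x : n.+1.-tuple X1 => [tuple of behead x])).
- exact: measurable_tnth.
- exact: measurable_behead.
Qed.

Section step.
Context (n : nat) (mu : {sigma_finite_measure set (n.-tuple X1) -> \bar R}).

Let mtcons : {mfun (X1 * n.-tuple X1)%type >-> (n.+1.-tuple X1)} :=
  mfun_Sub (mem_set (@measurable_tcons n)).

Definition leb_step : set (n.+1.-tuple X1) -> \bar R :=
  pushforward (leb1 \x mu)%E (@tcons n).

Let leb_step0 : leb_step set0 = 0%E.
Proof. exact: (measure0 (pushforward (leb1 \x mu)%E mtcons)). Qed.

Let leb_step_ge0 A : (0 <= leb_step A)%E.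
Proof. exact: (measure_ge0 (pushforward (leb1 \x mu)%E mtcons)). Qed.

Let leb_step_sigma_additive : semi_sigma_additive leb_step.
Proof.
exact: (@measure_semi_sigma_additive _ _ _ (pushforward (leb1 \x mu)%E mtcons)).
Qed.

HB.instance Definition _ := isMeasure.Build _ _ _ leb_step
  leb_step0 leb_step_ge0 leb_step_sigma_additive.

Let leb_step_sigma_finite : sigma_finite setT leb_step.
Proof.
have /sigma_finiteP[F [TF ndF Foo]] := @sigma_finiteT _ _ R leb1.
have /sigma_finiteP[G [TG ndG Goo]] := sigma_finiteT mu.
exists (fun k => @tuncons n @^-1` (F k `*` G k)).
  apply/seteqP; split => // x _.
  have : setT (tuncons x).1 by []. rewrite TF => -[i _ Fi].
  have : setT (tuncons x).2 by []. rewrite TG => -[j _ Gj].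
  exists (maxn i j) => //; split.
  - by apply: (subsetPset _ _ (ndF _ _ (leq_maxl i j))) Fi.
  - by apply: (subsetPset _ _ (ndG _ _ (leq_maxr i j))) Gj.
move=> k; have [mF Fk] := Foo k; have [mG Gk] := Goo k; split.
  rewrite -[X in measurable X]setTI; apply: measurable_tuncons => //.
  exact: measurableX.
rewrite /leb_step /pushforward -comp_preimage (_ : _ \o _ = id); last first.
  by apply/funext => x; exact: tconsK.
by rewrite [ltLHS]product_measure1E// lte_mul_pinfty// ge0_fin_numE.
Qed.

HB.instance Definition _ := Measure_isSigmaFinite.Build _ _ _
  leb_step leb_step_sigma_finite.

End step.

Fixpoint lebesgue_tuple n : {sigma_finite_measure set (n.-tuple X1) -> \bar R} :=
  if n is m.+1 then leb_step (lebesgue_tuple m) else dirac [tuple].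

Lemma measurable_tbox n (A : 'I_n -> set X1) : (forall i, measurable (A i)) ->
  measurable [set x : n.-tuple X1 | forall i, A i (tnth x i)].
Proof.
move=> mA; rewrite (_ : [set _ | _] = \bigcap_(i in [set: 'I_n])
    (setT `&` (@tnth n X1 ^~ i) @^-1` A i)).
  apply: (@fin_bigcap_measurable _ (n.-tuple X1)) => [|i _]; first exact: finite_finset.
  exact: (@measurable_tnth _ X1 n i measurableT _ (mA i)).
by apply/seteqP; split => x /= h i; [split => //; exact: h|have [] := h i I].
Qed.

Lemma lebesgue_tuple_box n (A : 'I_n -> set X1) :
    (forall i, measurable (A i)) ->
  lebesgue_tuple n [set x | forall i, A i (tnth x i)] =
  (\prod_(i < n) leb1 (A i))%E.
Proof.
elim: n A => [|n IH] A mA.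
  by rewrite big_ord0 /= diracE mem_set//= => -[].
rewrite big_ord_recl -IH; last by move=> i; exact: mA.
have mB := measurable_tbox (fun i => mA (lift ord0 i)).
rewrite -(product_measure1E leb1 (lebesgue_tuple n) (mA ord0) mB).
rewrite /= /leb_step /pushforward.
congr (product_measure1 _ _ _); apply/seteqP; split => -[x y] /= h.
  split=> [|i]; first exact: (h ord0).
  by have := h (lift ord0 i); rewrite tnthS.
move=> i; case: h => h0 h; have [j ->|->] := unliftP ord0 i; last exact: h0.
by have := h j; rewrite tnthS.
Qed.
End lebesgue_tuple.

Section euclidean_space.
Context {R : realType}.

(* R^n with the sigma-algebra of Lebesgue measurable sets, i.e. the completion
   of the product Borel structure on n-tuples. *)
Definition Rn (n : nat) : measurableType ((lebesgue_tuple n)^*)%mu.-cara :=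
  caratheodory_type ((lebesgue_tuple (R := R) n)^*)%mu.

Definition leb (n : nat) : {measure set (Rn n) -> \bar R} :=
  @completed_measure_extension _ _ R (lebesgue_tuple n).

Definition coord n (x : Rn n) (i : 'I_n) : R := tnth (x : n.-tuple R) i.

Definition edist n (x y : Rn n) : R :=
  Num.sqrt (\sum_(i < n) (coord x i - coord y i) ^+ 2).

(* A cube is given by its center c and its edge length l > 0; it is closed and
   its edges are parallel to the axes, so lam Q is cube c (lam * l). *)
Definition cube n (c : Rn n) (l : R) : set (Rn n) :=
  [set x | forall i, `|coord x i - coord c i| <= l / 2].

Definition open_cube n (c : Rn n) (l : R) : set (Rn n) :=
  [set x | forall i, `|coord x i - coord c i| < l / 2].

Lemma cubeE n (c : Rn n) l : cube c l =
  [set x : n.-tuple R | forall i,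
    `[coord c i - l / 2, coord c i + l / 2]%classic (tnth x i)].
Proof.
by apply/seteqP; split=> x /= h i; have := h i;
  rewrite /coord /= in_itv/= ler_distl.
Qed.

Lemma measurable_cube n (c : Rn n) l : measurable (cube c l).
Proof.
apply: sub_caratheodory; apply: sub_sigma_algebra; rewrite cubeE.
exact: (@measurable_tbox R n (fun i => `[coord c i - l / 2, coord c i + l / 2]%classic)).
Qed.

Lemma leb_cube n (c : Rn n) l : 0 <= l -> leb n (cube c l) = (l ^+ n)%:E.
Proof.
move=> l0.
transitivity (lebesgue_tuple n [set x : n.-tuple R | forall i,
    `[coord c i - l / 2, coord c i + l / 2]%classic (tnth x i)]).
  rewrite cubeE; apply: measurable_mu_extE.
  exact: (@measurable_tbox R n (fun i => `[coord c i - l / 2, coord c i + l / 2]%classic)).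
rewrite (@lebesgue_tuple_box R n (fun i => `[coord c i - l / 2, coord c i + l / 2]%classic))//.
rewrite (eq_bigr (fun=> l%:E)); last first.
  move=> i _; rewrite lebesgue_measure_itv/= lte_fin; case: ifPn => [_|].
    by rewrite -EFinB; congr EFin; field.
  by rewrite -leNgt => h; congr EFin; lra.
by rewrite prodEFin prodr_const card_ord.
Qed.

End euclidean_space.
Arguments Rn : clear implicits.
Arguments leb : clear implicits.

Section weights.
Context {R : realType} {n : nat}.
Implicit Types (w b f h : Rn R n -> R) (p q r s : R).
Local Notation mu := (leb R n).

(* Integrability on every cube is the same as on every compact set. *)
Definition loc_integrable f :=
  forall c l, 0 < l -> mu.-integrable (cube c l) (EFin \o f).

Definition weight w := (forall x, 0 <= w x) /\ loc_integrable w.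

Definition wmeas w (A : set (Rn R n)) : \bar R := \int[mu]_(x in A) (w x)%:E.

Definition wae w (P : Rn R n -> Prop) :=
  exists E, [/\ measurable E, wmeas w E = 0%E & forall x, ~ E x -> P x].

Definition class_D q w := exists C : R, forall c l lam, 0 < l -> 1 < lam ->
  (wmeas w (cube c (lam * l)) <=
   (C * lam `^ (n%:R * q))%:E * wmeas w (cube c l))%E.

Definition class_RH r w := exists C : R, forall c l, 0 < l ->
  (((mu (cube c l))^-1 * \int[mu]_(x in cube c l) (w x `^ r)%:E) `^ r^-1%R <=
   C%:E * ((mu (cube c l))^-1 * \int[mu]_(x in cube c l) (w x)%:E))%E.

Definition class_A q r w := class_D q w /\ class_RH r w.

Definition class_P w := exists (c : nat -> Rn R n) (l : nat -> R),
  [/\ forall i, 0 < l i,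
      forall i, (0 < wmeas w (cube (c i) (l i)))%E,
      forall i j, i <> j ->
        open_cube (c i) (l i) `&` open_cube (c j) (l j) = set0 &
      \bigcup_i cube (c i) (l i) = setT].

Definition mean b c l : R :=
  (fine (mu (cube c l)))^-1 * \int[mu]_(x in cube c l) b x.

Definition BMOnorm b : \bar R := ereal_sup [set y | exists c l, 0 < l /\
  y = ((mu (cube c l))^-1 *
       \int[mu]_(x in cube c l) `|b x - mean b c l|%:E)%E].

Definition BMO b := loc_integrable b /\ (BMOnorm b < +oo)%E.

(* As the cube is closed, this says that the support of h is contained in it. *)
Definition supported_in h c l := forall x, h x != 0 -> cube c l x.

(* w(Q)^(-1/p) is written as an inverse in \bar R, hence is +oo if w(Q) = 0;
   powR would give 0 instead. *)
Definition block p s w h := measurable_fun setT h /\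
  exists c l, [/\ 0 < l, supported_in h c l &
    ('N[mu]_s%:E[EFin \o h] <=
     mu (cube c l) `^ s^-1%R * (wmeas w (cube c l) `^ p^-1%R)^-1)%E].

Definition pbar p := Num.min p 1.

Definition coef_sum p (lam : nat -> R) : \bar R :=
  (\sum_(0 <= k <oo) (`|lam k| `^ pbar p)%:E)%E.

(* Functions are identified when they agree w-a.e., which is the sense of the
   equality f = \sum_k lam_k a_k. *)
Definition block_decomp p s w f (lam : nat -> R) (a : nat -> Rn R n -> R) :=
  [/\ forall k, block p s w (a k), (coef_sum p lam < +oo)%E &
      wae w (fun x => series (fun k => lam k * a k x) @ \oo --> f x)].

Definition BH p s w f := exists lam a, block_decomp p s w f lam a.

Definition BHnorm p s w f : \bar R := ereal_inf [set y | exists lam a,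
  block_decomp p s w f lam a /\ y = (coef_sum p lam `^ (pbar p)^-1%R)%E].

End weights.

Section operators.
Context {R : realType} {n : nat}.
Local Notation fct := (Rn R n -> R).
Local Notation mu := (leb R n).
Implicit Types (w b f g h : fct) (p s : R) (T Tb S : fct -> fct).

Definition commutator T b : fct -> fct :=
  fun f x => T (fun y => (b x - b y) * f y) x.

Definition linear_domain (D : set fct) := forall f g (al be : R),
  D f -> D g -> D (fun y => al * f y + be * g y).

(* T acts on functions determined up to null sets, so its properties are only
   required a.e.; the exceptional set may depend on f and g but not on the
   scalars, which the commutator formula takes to depend on x. *)
Definition linear_op (D : set fct) T := linear_domain D /\
  forall f g, D f -> D g -> {ae mu, forall x, forall al be : R,
    T (fun y => al * f y + be * g y) x = al * T f x + be * T g x}.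

Definition sublinear_op (D : set fct) T := linear_domain D /\
  forall f g, D f -> D g -> {ae mu, forall x, forall al be : R,
    `|T (fun y => al * f y + be * g y) x| <= `|al| * `|T f x| + `|be| * `|T g x|}.

Definition size_condition p s w T (C : R) :=
  forall h c l, block p s w h -> 0 < l -> supported_in h c l ->
  {ae mu, forall x, ~ cube c (2 * Num.sqrt n%:R * l) x ->
    (`|T h x|%:E <= C%:E * 'N[mu]_1[EFin \o h] * (edist x c ^- n)%:E)%E}.

Definition commutator_bound p s w T b (C : R) :=
  forall h, block p s w h -> measurable_fun setT (commutator T b h) /\
  ('N[mu]_s%:E[EFin \o commutator T b h] <=
   C%:E * BMOnorm b * 'N[mu]_s%:E[EFin \o h])%E.

Definition bounded_on_BH p s w S :=
  (forall f, BH p s w f -> BH p s w (S f)) /\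
  exists M : R, forall f, BH p s w f ->
    (BHnorm p s w (S f) <= M%:E * BHnorm p s w f)%E.

Definition series_formula p s w Tb S :=
  forall f lam a, block_decomp p s w f lam a ->
  (fun N => BHnorm p s w
     (fun x => S f x - \sum_(0 <= j < N) lam j * Tb (a j) x)) @ \oo --> 0%E /\
  wae w (fun x => series (fun j => lam j * Tb (a j) x) @ \oo --> S f x).

Definition series_extension p s w Tb S :=
  [/\ forall h, block p s w h -> wae w (fun x => S h x = Tb h x),
      bounded_on_BH p s w S & series_formula p s w Tb S].

Definition series_domination p s w Tb :=
  forall f lam a, block_decomp p s w f lam a ->
  wae w (fun x =>
    (`|Tb f x|%:E <= \sum_(0 <= j <oo) (`|lam j| * `|Tb (a j) x|)%:E)%E).

End operators.

(* Main.v *)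
Require Import Defs.
From mathcomp Require Import all_boot all_order all_algebra.
From mathcomp Require Import all_classical all_reals all_analysis.
From mathcomp Require Import measurable_realfun ring lra.
Import Order.TTheory GRing.Theory Num.Theory.
Import numFieldNormedType.Exports.
Set Implicit Arguments. Unset Strict Implicit. Unset Printing Implicit Defensive.
Local Open Scope classical_set_scope.
Local Open Scope ring_scope.

(** Outline of the argument.

    Single blocks.  The oscillation of b on the dilated cube 2^k Q grows only
    linearly in k (John-Nirenberg and telescoping), while the kernel bound of
    the size condition decays like 2^(-kn).  Hence the image of a block h on Q
    under the commutator is, on the shell between 2^k Q and 2^(k+1) Q and in the
    mean with exponent s, of the size w(Q)^(-1/p) of h times k 2^(-kn) and the
    BMO norm of b.  A block on 2^k Q has the size w(2^k Q)^(-1/p), which by D_q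
    is smaller than w(Q)^(-1/p) by at most a factor 2^(-knq/p).  Since q < p a geometric factor remains, so
    that the image of h is a series of blocks cut off to the shells, with
    coefficients whose powers with exponent min(p, 1) have a finite sum, of the
    order of the same power of the BMO norm of b (comm_dom).

    Domination.  A function belongs to the block space as soon as its absolute
    value is bounded by a series of absolute values of blocks with finite
    coefficient sum: multiply the blocks by the quotient of the two sides
    (dom_decomp).  So all estimates are phrased with the predicate dom, which is
    stable under countable sums; this settles the sublinear case at once, and
    in the linear case it gives the convergence of the series of the images of
    the blocks, almost everywhere and in the quasi-norm.

    Independence of the decomposition, which makes the extension well defined,
    is the delicate point, because no continuity of the operator on the block
    space is known beforehand.  It follows from dom_op_local: if g is a multiple
    of a block and is dominated by a block series of coefficient sum k, then on
    every cube the image of g is dominated with a multiple of k.  To see this,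
    truncate g to the set where it is bounded by a partial sum.  The truncation
    is a finite combination of blocks, to which linearity applies, and the rest
    is small in L^s, so its image is small in L^s by the commutator bound.
    Applied to the difference of the partial sums of two decompositions of the
    same function, which is dominated by the tails, this shows that the two
    image series agree (op_series_unique).

    Almost everywhere statements with respect to w and to Lebesgue measure
    coincide because a reverse Hoelder weight of positive mass on cubes is
    positive almost everywhere (weight_gt0_ae): on a cube almost filled by the
    zero set of w the reverse Hoelder inequality would fail.  If some cube has
    weight zero, then by D_q the weight vanishes and the claim is trivial.

    All estimates are carried out in an abstract measure space with
    coordinates, described by the record euclidean. *)

Local Notation coef_sum := Defs.coef_sum.

(** * Powers of real numbers *)

Section powR.
Context {R : realType}.
Implicit Types x y v M t r : R.

Lemma powR_le x y t : 0 <= t -> 0 <= x -> x <= y -> x `^ t <= y `^ t.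
Proof.
by move=> t0 x0 xy; apply: ge0_ler_powR; rewrite ?nnegrE//; exact: le_trans xy.
Qed.

Lemma powRD_gt0 x r t : 0 < x -> x `^ (r + t) = x `^ r * x `^ t.
Proof. by move=> x0; rewrite powRD// (gt_eqF x0) implybT. Qed.

Lemma powRV x t : 0 <= x -> x^-1 `^ t = (x `^ t)^-1.
Proof. by move=> x0; rewrite -(powR_inv1 x0) -powRrM mulN1r powRN. Qed.

Lemma powR_ratio_le (a c v V Z : R) t : 0 <= t -> 0 <= a -> 0 <= c -> 0 < v -> 0 < V ->
  V <= Z * v -> a * Z <= c -> a `^ t * (v `^ t)^-1 <= c `^ t * (V `^ t)^-1.
Proof.
move=> t0 a0 c0 v0 V0 VZ aZ.
have iv0 : 0 <= v^-1 by rewrite invr_ge0 ltW.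
have iV0 : 0 <= V^-1 by rewrite invr_ge0 ltW.
rewrite -(powRV _ (ltW v0)) -(powRV _ (ltW V0)) -!powRM//.
apply: powR_le => //; first exact: mulr_ge0.
rewrite ler_pdivrMr// mulrAC ler_pdivlMr//.
apply: (le_trans (ler_wpM2l a0 VZ)).
by rewrite mulrA ler_pM2r.
Qed.

Lemma powR_le_inv x y t : 0 < t -> 0 <= x -> 0 <= y -> x `^ t <= y `^ t -> x <= y.
Proof.
move=> t0 x0 y0 xy; have h z : 0 <= z -> z = (z `^ t) `^ t^-1.
  by move=> z0; rewrite -powRrM mulfV ?gt_eqF// powRr1.
rewrite (h x x0) (h y y0); apply: powR_le; [|exact: powR_ge0|exact: xy].
by rewrite invr_ge0 ltW.
Qed.

Lemma powR_addn_le x y t : 0 <= t -> 0 <= x -> 0 <= y ->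
  (x + y) `^ t <= 2 `^ t * (x `^ t + y `^ t).
Proof.
move=> t0 x0 y0; rewrite mulrDr -!powRM//.
have px := powR_ge0 (2 * x) t; have py := powR_ge0 (2 * y) t.
have [xy|/ltW yx] := leP x y.
  have h : x + y <= 2 * y by lra.
  by have := powR_le t0 (addr_ge0 x0 y0) h; lra.
have h : x + y <= 2 * x by lra.
by have := powR_le t0 (addr_ge0 x0 y0) h; lra.
Qed.

(** Convexity of the t-th power: its graph lies above the tangent at v. *)
Lemma powR_tangent x v t : 1 < t -> 0 <= x -> 0 <= v ->
  t * (v `^ (t - 1) * x) <= x `^ t + (t - 1) * v `^ t.
Proof.
move=> t1 x0 v0; have t0 : 0 < t by lra.
have t10 : 0 < t - 1 by lra.
have := @conjugate_powR _ x (v `^ (t - 1)) t (t / (t - 1)) x0 (powR_ge0 _ _) t0.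
rewrite divr_gt0// invf_div => /(_ isT) H.
have {}H := H ltac:(by field; exact: lt0r_neq0).
move: H; rewrite -powRrM [(t - 1) * _](_ : _ = t); last by field; exact: lt0r_neq0.
move: (x `^ t) (v `^ t) (v `^ (t - 1)) => A B C.
have -> : A / t + B * ((t - 1) / t) = (A + (t - 1) * B) / t.
  by field; exact: lt0r_neq0.
by rewrite ler_pdivlMr// => H; rewrite mulrC [C * x]mulrC.
Qed.

(** The preceding inequality perturbed from x to a nearby y; M bounds the
    Lipschitz constant of the powers involved. *)
Lemma powR_tangent_dist x y M t : 1 < t -> 0 <= x <= M -> 0 <= y <= M ->
  x `^ t + t * y `^ t <=
  y `^ t + t * (y `^ (t - 1) * x) + 2 * t * M `^ (t - 1) * `|x - y|.
Proof.
move=> t1 /andP[x0 xM] /andP[y0 yM].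
have t10 : 0 <= t - 1 by lra.
have := @powR_tangent y x t t1 y0 x0.
have e z : 0 <= z -> z `^ t = z `^ (t - 1) * z.
  by move=> z0; rewrite mulrC mulr_powRB1//; lra.
have xs := powR_le t10 x0 xM; have ys := powR_le t10 y0 yM.
have px := powR_ge0 x (t - 1); have py := powR_ge0 y (t - 1).
rewrite !e//.
move: (x `^ (t - 1)) (y `^ (t - 1)) (M `^ (t - 1)) xs ys px py => A B D AD BD A0 B0 H.
have h1 : A * (x - y) <= D * `|x - y|.
  by rewrite (le_trans (ler_wpM2l A0 (ler_norm _)))// ler_wpM2r.
have h2 : B * (y - x) <= D * `|x - y|.
  by rewrite distrC (le_trans (ler_wpM2l B0 (ler_norm _)))// ler_wpM2r.
have h3 : t * (A * (x - y)) <= t * (D * `|x - y|) by rewrite ler_wpM2l//; lra.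
have h4 : t * (B * (y - x)) <= t * (D * `|x - y|) by rewrite ler_wpM2l//; lra.
by move: H h3 h4; move: `|_| => W; nra.
Qed.

Lemma powR_subadd x y r : 0 < r -> r <= 1 -> 0 <= x -> 0 <= y ->
  (x + y) `^ r <= x `^ r + y `^ r.
Proof.
move=> r0 r1 x0 y0.
have [xy0|xy0] := eqVneq (x + y) 0.
  by rewrite xy0 powR0 ?gt_eqF// addr_ge0// powR_ge0.
have s0 : 0 < x + y by rewrite lt_def xy0 addr_ge0.
have h z : 0 <= z -> z <= x + y -> z / (x + y) * (x + y) `^ r <= z `^ r.
  move=> z0 zs; have [->|zn0] := eqVneq z 0; first by rewrite !mul0r powR_ge0.
  have zp : 0 < z by rewrite lt_def zn0.
  have q0 : 0 < z / (x + y) by rewrite divr_gt0.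
  have -> : z `^ r = (z / (x + y)) `^ r * (x + y) `^ r.
    by rewrite -powRM ?divfK//; exact: ltW.
  by rewrite ler_wpM2r ?powR_ge0// ger1_powR// q0/= ler_pdivrMr// mul1r.
have := lerD (h x x0 ltac:(lra)) (h y y0 ltac:(lra)).
by rewrite -mulrDl -mulrDl divff// mul1r.
Qed.

Lemma powR_subadd_sum (I : Type) (s : seq I) (F : I -> R) r : 0 < r -> r <= 1 ->
  (forall i, 0 <= F i) -> (\sum_(i <- s) F i) `^ r <= \sum_(i <- s) F i `^ r.
Proof.
move=> r0 r1 F0; elim: s => [|i s IH]; first by rewrite !big_nil powR0 ?gt_eqF.
rewrite !big_cons; apply: (le_trans (powR_subadd _ _ _ _)) => //.
  exact: sumr_ge0.
by rewrite lerD2l.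
Qed.

(** Young's inequality with both constants estimated by 1. *)
Lemma mulr_le_powRD x y t : 1 < t -> 0 <= x -> 0 <= y ->
  x * y <= x `^ t + y `^ (t / (t - 1)).
Proof.
move=> t1 x0 y0; have t0 : 0 < t by lra.
have t10 : 0 < t - 1 by lra.
have h := @conjugate_powR _ x y t (t / (t - 1)) x0 y0 t0.
have {}h := h (divr_gt0 t0 t10) ltac:(rewrite invf_div; field; exact: lt0r_neq0).
apply: (le_trans h); apply: lerD.
  by rewrite ler_pdivrMr// ler_peMr ?powR_ge0// ltW.
rewrite ler_pdivrMr ?divr_gt0// ler_peMr ?powR_ge0//.
by rewrite ler_pdivlMr//; lra.
Qed.

End powR.

(** * Series of nonnegative terms *)

Section series.
Context {R : realType}.
Implicit Types (u : nat -> \bar R) (a b : nat -> R).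

Lemma nneseries_le_bound u (M : \bar R) : (forall i, (0 <= u i)%E) ->
  (forall N, (\sum_(0 <= i < N) u i <= M)%E) -> (\sum_(0 <= i <oo) u i <= M)%E.
Proof.
move=> u0 h; apply: lime_le; first exact: is_cvg_nneseries.
exact: nearW.
Qed.

Lemma nneseries_trunc u N : (forall i, (0 <= u i)%E) ->
  (forall i, (N <= i)%N -> u i = 0%E) ->
  (\sum_(0 <= i <oo) u i = \sum_(0 <= i < N) u i)%E.
Proof.
move=> u0 h; rewrite (nneseries_split 0 N)// add0n [X in (_ + X)%E]eseries0 ?adde0//.
by move=> i Ni _; exact: h.
Qed.

Lemma nneseries_cvg_fine a : (forall i, 0 <= a i) ->
  (\sum_(0 <= i <oo) (a i)%:E < +oo)%E ->
  series a @ \oo --> fine (\sum_(0 <= i <oo) (a i)%:E)%E.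
Proof.
move=> a0 fin; set S := (X in fine X); have S0 : (0 <= S)%E by apply: nneseries_ge0 => i _ _; rewrite lee_fin.
have cv : (fun N => \sum_(0 <= i < N) (a i)%:E)%E @ \oo --> (fine S)%:E.
  rewrite fineK ?ge0_fin_numE//; apply: is_cvg_nneseries => // i _ _.
  by rewrite lee_fin.
have [_ +] := (fine_cvgP _ _).1 cv; apply: cvg_trans.
rewrite (_ : series a = fine \o (fun N => \sum_(0 <= i < N) (a i)%:E)%E)//.
by apply/funext => N /=; rewrite /series/= sumEFin.
Qed.

(** For exponents at most 1 the power of a sum is at most the sum of the powers. *)
Lemma nneseries_powR_le a (t y : R) : 0 < t -> t <= 1 -> (forall i, 0 <= a i) ->
  0 <= y -> (y%:E <= \sum_(0 <= i <oo) (a i)%:E)%E ->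
  ((y `^ t)%:E <= \sum_(0 <= i <oo) (a i `^ t)%:E)%E.
Proof.
move=> t0 t1 a0 y0 ya; set S := (X in (_ <= X)%E).
have S0 : (0 <= S)%E by apply: nneseries_ge0 => i _ _; rewrite lee_fin powR_ge0.
have [Soo|] := eqVneq S +oo%E; first by rewrite Soo leey.
rewrite -ltey => Sfin; have Sf : S \is a fin_num by rewrite ge0_fin_numE.
have part N : \sum_(0 <= i < N) a i `^ t <= fine S.
  rewrite -lee_fin fineK// -sumEFin; apply: nneseries_lim_ge => i _ _.
  by rewrite lee_fin powR_ge0.
have h : (\sum_(0 <= i <oo) (a i)%:E <= (fine S `^ t^-1)%:E)%E.
  apply: nneseries_le_bound => [i|N]; first by rewrite lee_fin.
  rewrite sumEFin lee_fin -[leLHS]powRr1 ?sumr_ge0// -(mulfV (lt0r_neq0 t0)) powRrM.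
  apply: powR_le; [by rewrite invr_ge0 ltW|exact: powR_ge0|].
  by apply: le_trans (part N); exact: powR_subadd_sum.
rewrite -[S]fineK// lee_fin.
have := le_trans ya h; rewrite lee_fin => /(powR_le (ltW t0) y0).
by rewrite -powRrM mulVf ?gt_eqF// powRr1// fine_ge0.
Qed.

Lemma nneseries_powR_lty a (t : R) : 0 < t -> t <= 1 -> (forall i, 0 <= a i) ->
  (\sum_(0 <= i <oo) (a i `^ t)%:E < +oo)%E -> (\sum_(0 <= i <oo) (a i)%:E < +oo)%E.
Proof.
move=> t0 t1 a0; set S := (X in (X < _)%E -> _) => Sfin.
have S0 : (0 <= S)%E by apply: nneseries_ge0 => i _ _; rewrite lee_fin powR_ge0.
have Sf : S \is a fin_num by rewrite ge0_fin_numE.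
apply: (@le_lt_trans _ _ (fine S `^ t^-1)%:E); last exact: ltry.
apply: nneseries_le_bound => [i|N]; first by rewrite lee_fin.
rewrite sumEFin lee_fin -[leLHS]powRr1 ?sumr_ge0// -(mulfV (lt0r_neq0 t0)) powRrM.
apply: powR_le; [by rewrite invr_ge0 ltW|exact: powR_ge0|].
apply: (le_trans (powR_subadd_sum _ _ _ _)) => //.
rewrite -lee_fin fineK// -sumEFin; apply: nneseries_lim_ge => i _ _.
by rewrite lee_fin powR_ge0.
Qed.

(** A double series is a single one; e enumerates the pairs once and for all, so
    that the same rearrangement serves several series at a time. *)
Lemma nat_pairing : exists e : nat -> nat * nat, forall (v : nat -> nat -> \bar R),
  (forall j k, (0 <= v j k)%E) ->
  (\sum_(0 <= i <oo) v (e i).1 (e i).2 =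
   \sum_(0 <= j <oo) \sum_(0 <= k <oo) v j k)%E.
Proof.
have /card_set_bijP[e be] : ([set: nat] #= [set: nat * nat])%card.
  by rewrite card_eq_sym; exact: card_nat2.
exists e => v v0; rewrite nneseries_esumT//.
rewrite (eq_eseriesr (g := fun j => \esum_(k in [set: nat]) v j k)); last first.
  by move=> j _; rewrite nneseries_esumT.
rewrite nneseries_esumT; last by move=> j; apply: esum_ge0.
rewrite esum_esum//; rewrite -(reindex_esum _ _ e (fun jk => v jk.1 jk.2) be).
by congr esum; apply/seteqP; split.
Qed.

Lemma geometric_sum_le (t : R) N : 0 <= t -> t < 1 ->
  \sum_(0 <= i < N) t ^+ i <= (1 - t)^-1.
Proof.
move=> t0 t1; have t10 : 0 < 1 - t by rewrite subr_gt0.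
rewrite -[leRHS]mul1r ler_pdivlMr// mulrC big_mkord.
by rewrite -opprB mulNr -subrX1 opprB lerBlDr lerDl exprn_ge0.
Qed.

Lemma nneseries_geometric_le (k t : R) : 0 <= k -> 0 <= t -> t < 1 ->
  (\sum_(0 <= i <oo) (k * t ^+ i)%:E <= (k / (1 - t))%:E)%E.
Proof.
move=> k0 t0 t1; apply: nneseries_le_bound => [i|N].
  by rewrite lee_fin mulr_ge0 ?exprn_ge0.
by rewrite sumEFin lee_fin -mulr_sumr ler_wpM2l// geometric_sum_le.
Qed.

(** Each of the j + 1 terms t^i with i <= j is at least t^j, and they sum to at most
    1 / (1 - t). *)
Lemma natr_geometric_le (t : R) j : 0 <= t -> t < 1 -> j.+1%:R * t ^+ j <= (1 - t)^-1.
Proof.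
move=> t0 t1; apply: le_trans (geometric_sum_le j.+1 t0 t1).
rewrite mulr_natl -[X in _ *+ X](subn0 j.+1) -sumr_const_nat.
apply: ler_sum_nat => i /andP[_ ij]; apply: ler_wiXn2l => //; exact: ltW.
Qed.

End series.

(** * Cubes, dyadic halving and step functions *)

(** What the estimates use of Lebesgue measure on R^n.  The last field says that
    a measurable set of finite measure is, up to small measure, a member of the
    sigma-algebra generated by the coordinate rays; it transports properties of
    Borel sets to all measurable sets. *)
Record euclidean {R : realType} {n : nat} {d : measure_display}
    {X : measurableType d} (mu : {measure set X -> \bar R})
    (coord : X -> 'I_n -> R) : Prop := Euclidean {
  euclidean_measurable : forall A : 'I_n -> set R, (forall i, measurable (A i)) ->
    measurable [set x | forall i, A i (coord x i)] ;
  euclidean_measure : forall A : 'I_n -> set R, (forall i, measurable (A i)) ->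
    mu [set x | forall i, A i (coord x i)] = (\prod_(i < n) lebesgue_measure (A i))%E ;
  euclidean_surj : forall u : 'I_n -> R, exists x, forall i, coord x i = u i ;
  euclidean_regular : forall (E : set X) (e : R), measurable E ->
    (mu E < +oo)%E -> 0 < e ->
    exists G, [/\ <<s [set A | exists i a, A = [set x | a < coord x i]] >> G, E `<=` G &
      (mu (G `\` E) <= e%:E)%E] }.

Section dyadic.
Context {R : realType} {n : nat} {d : measure_display} {X : measurableType d}
  {mu : {measure set X -> \bar R}} {coord : X -> 'I_n -> R}.
Context (euc : euclidean mu coord).
Implicit Types (u : 'I_n -> R) (l : R) (c : X).

(** Half-open, so that the 2^n halves of dcube u l form a partition of it. *)
Definition dcube u l : set (X) :=
  [set x : X | forall i, u i <= coord x i < u i + l].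

Let measurable_box (A : 'I_n -> set R) : (forall i, measurable (A i)) ->
  measurable [set x | forall i, A i (coord x i)].
Proof. by case: euc => + _ _ _; exact. Qed.

Let leb_box (A : 'I_n -> set R) : (forall i, measurable (A i)) ->
  mu [set x | forall i, A i (coord x i)] = (\prod_(i < n) lebesgue_measure (A i))%E.
Proof. by case: euc => _ + _ _; exact. Qed.

Definition ccube c l : set X := [set x | forall i, `|coord x i - coord c i| <= l / 2].

Lemma ccubeE c l : ccube c l =
  [set x | forall i, `[coord c i - l / 2, coord c i + l / 2]%classic (coord x i)].
Proof.
by apply/seteqP; split=> x /= h i; have := h i; rewrite /= in_itv/= ler_distl.
Qed.

Lemma measurable_ccube c l : measurable (ccube c l).
Proof.
by rewrite ccubeE; exact: (@measurable_box (fun i => `[coord c i - l / 2, coord c i + l / 2]%classic)).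
Qed.

Lemma leb_ccube c l : 0 <= l -> mu (ccube c l) = (l ^+ n)%:E.
Proof.
move=> l0; rewrite ccubeE (@leb_box (fun i => `[coord c i - l / 2, coord c i + l / 2]%classic))//.
rewrite (eq_bigr (fun=> l%:E)) ?prodEFin ?prodr_const ?card_ord//.
move=> i _; rewrite lebesgue_measure_itv/= lte_fin; case: ifPn => [_|].
  by rewrite -EFinB; congr EFin; lra.
by rewrite -leNgt => h; congr EFin; lra.
Qed.

Lemma dcubeE u l : dcube u l = [set x : X | forall i, `[u i, u i + l[%classic (coord x i)].
Proof. by apply/seteqP; split=> x /= h i; have := h i; rewrite /= in_itv. Qed.

Lemma measurable_dcube u l : measurable (dcube u l).
Proof. by rewrite dcubeE; exact: (@measurable_box (fun i => `[u i, u i + l[%classic)). Qed.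

Lemma leb_dcube u l : 0 <= l -> mu (dcube u l) = (l ^+ n)%:E.
Proof.
move=> l0; rewrite dcubeE (@leb_box (fun i => `[u i, u i + l[%classic))//.
rewrite (eq_bigr (fun=> l%:E)) ?prodEFin ?prodr_const ?card_ord//.
move=> i _; rewrite lebesgue_measure_itv/= lte_fin; case: ifPn => [_|].
  by rewrite -EFinB; congr EFin; lra.
by rewrite -leNgt => h; congr EFin; lra.
Qed.

Definition corner (c : X) l := fun i => coord c i - l / 2.

Lemma dcube_ccube c l : dcube (corner c l) l `<=` ccube c l.
Proof.
move=> x /= h i; have := h i; rewrite /corner ler_distl.
by move=> /andP[h1 h2]; apply/andP; split; lra.
Qed.

Lemma corner_surj u l : exists c, corner c l = u.
Proof.
have [c hc] := euclidean_surj euc (fun i => u i + l / 2).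
by exists c; apply/funext => i; rewrite /corner hc addrK.
Qed.

Lemma leb_ccube_setD_dcube c l : 0 <= l -> mu (ccube c l `\` dcube (corner c l) l) = 0%E.
Proof.
move=> l0; rewrite measureD//=; [|exact: measurable_ccube|exact: measurable_dcube|].
- by rewrite (setIidr (@dcube_ccube c l)) leb_ccube// leb_dcube// subee.
- by rewrite leb_ccube// ltry.
Qed.

(** The boundary of a cube is a null set, hence statements may pass between closed
    cubes, on which the hypotheses are given, and half-open ones, which are cut up. *)
Lemma ge0_integral_ccube_dcube c l (f : X -> \bar R) : 0 <= l ->
  measurable_fun setT f -> (forall x, (0 <= f x)%E) ->
  (\int[mu]_(x in ccube c l) f x = \int[mu]_(x in dcube (corner c l) l) f x)%E.
Proof.
move=> l0 mf f0; rewrite -(setDUK (@dcube_ccube c l)).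
have mD : measurable (ccube c l `\` dcube (corner c l) l).
  by apply: measurableD; [exact: measurable_ccube|exact: measurable_dcube].
rewrite ge0_integral_setU//; [|exact: measurable_dcube|exact: measurable_funTS|].
- rewrite [X in (_ + X)%E](_ : _ = 0%E) ?adde0//.
  have := @integral_abs_eq0 _ _ _ mu _ f mD (measurable_funTS mf) (leb_ccube_setD_dcube c l0).
  by under eq_integral do rewrite gee0_abs//.
- by rewrite disj_set2E; apply/eqP; rewrite setDIK.
Qed.

(** The choice s i selects the upper half in direction i. *)
Definition child u l (s : {ffun 'I_n -> bool}) := fun i => u i + (if s i then l / 2 else 0).

Lemma dcube_child u l s : dcube (child u l s) (l / 2) `<=` dcube u l.
Proof.
move=> x h i; have := h i; have := h i; rewrite /child; case: (s i) => /andP[h1 h2] _; apply/andP; split; lra.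
Qed.

Lemma dcube_children u l :
  dcube u l = \big[setU/set0]_(s : {ffun 'I_n -> bool}) dcube (child u l s) (l / 2).
Proof.
rewrite -bigcup_seq; apply/seteqP; split=> [x h|x [s _]]; last exact: dcube_child.
exists [ffun i => u i + l / 2 <= coord x i]; first by rewrite /= mem_index_enum.
move=> i; have /andP[h1 h2] := h i; rewrite /child ffunE.
by case: ifPn => [h3|]; [|rewrite -ltNge => h3]; apply/andP; split; lra.
Qed.

Lemma trivIset_children u l (D : set {ffun 'I_n -> bool}) :
  trivIset D (fun s => dcube (child u l s) (l / 2)).
Proof.
move=> s t _ _ [x [hs ht]]; apply/ffunP => i.
have := hs i; have := ht i; rewrite /child.
by case: (s i); case: (t i) => // /andP[? ?] /andP[? ?]; lra.
Qed.

Lemma ge0_integral_children u l (f : X -> \bar R) :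
  measurable_fun setT f -> (forall x, (0 <= f x)%E) ->
  (\int[mu]_(x in dcube u l) f x =
   \sum_(s : {ffun 'I_n -> bool}) \int[mu]_(x in dcube (child u l s) (l / 2)) f x)%E.
Proof.
move=> mf f0; rewrite [in LHS]dcube_children ge0_integral_bigsetU//.
- by move=> s; exact: measurable_dcube.
- exact: index_enum_uniq.
- exact: trivIset_children.
- exact: measurable_funTS.
Qed.

(** g is constant on the dyadic subcubes of dcube u l of generation m.  Equality of
    floors avoids naming these subcubes, and makes refinement and combination of step
    functions one-line facts. *)
Definition step_fun (V : Type) m u l (g : X -> V) :=
  forall x y, dcube u l x -> dcube u l y ->
  (forall i, Num.floor ((coord x i - u i) * 2 ^+ m / l) =
             Num.floor ((coord y i - u i) * 2 ^+ m / l)) -> g x = g y.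

Lemma step_fun0 (V : Type) u l (g : X -> V) : 0 < l -> step_fun 0 u l g ->
  forall x y, dcube u l x -> dcube u l y -> g x = g y.
Proof.
move=> l0 h x y hx hy; apply: h => // i; rewrite !expr0 !mulr1.
have flo0 z : dcube u l z -> Num.floor ((coord z i - u i) / l) = 0.
  move=> /(_ i)/andP[h1 h2]; apply/eqP; rewrite floor_eq//; apply/andP; split.
    by rewrite divr_ge0 ?subr_ge0// ltW.
  by rewrite ltr_pdivrMr//; lra.
by rewrite !flo0.
Qed.

Lemma step_funS (V : Type) m u l s (g : X -> V) : 0 < l ->
  step_fun m.+1 u l g -> step_fun m (child u l s) (l / 2) g.
Proof.
move=> l0 h x y hx hy xy; apply: h; [exact: dcube_child hx|exact: dcube_child hy|].
move=> i; have := xy i; rewrite /child.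
have E z : (coord z i - u i) * 2 ^+ m.+1 / l =
   (coord z i - (u i + (if s i then l / 2 else 0))) * 2 ^+ m / (l / 2) +
   (if s i then 2 ^+ m else 0).
  rewrite exprS; case: (s i); field; exact: lt0r_neq0.
rewrite !E; case: (s i); last by rewrite !addr0.
have -> : 2 ^+ m = ((2 ^+ m)%:~R : R) by rewrite rmorphXn.
by rewrite !floorDrz ?intr_int// => ->.
Qed.

Lemma step_funSm (V : Type) m u l (g : X -> V) :
  step_fun m u l g -> step_fun m.+1 u l g.
Proof.
move=> h x y hx hy xy; apply: h => // i.
have E z : (coord z i - u i) * 2 ^+ m.+1 / l = 2 * ((coord z i - u i) * 2 ^+ m / l).
  by rewrite exprS; lra.
have := xy i; rewrite !E.
set a := _ * _ / l; set b := (coord y i - u i) * _ / l => ab.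
apply/eqP; rewrite floor_eq//.
have /andP[b1 b2] := floor_itv b.
have /andP[a1 a2] := floor_itv (2 * a).
have /andP[c1 c2] := floor_itv (2 * b).
rewrite {}ab in a1 a2.
move: b1 b2 a1 a2 c1 c2; set k := Num.floor b; set j := Num.floor (2 * b).
rewrite !intrD => b1 b2 a1 a2 c1 c2.
have h1 : (2 * k <= j)%R.
  by rewrite -ltzD1 -(ltr_int R) intrD intrM; lra.
have h2 : (j <= 2 * k + 1)%R.
  by rewrite -ltzD1 -(ltr_int R) !intrD intrM; lra.
move: h1 h2; rewrite -!(ler_int R) !intrD !intrM => h1 h2.
by apply/andP; split; lra.
Qed.

Lemma step_fun_le (V : Type) m m' u l (g : X -> V) : (m <= m')%N ->
  step_fun m u l g -> step_fun m' u l g.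
Proof.
move=> /subnK <-; elim: (m' - m)%N => // k IH h; rewrite addSn.
by apply: step_funSm; exact: IH.
Qed.

Lemma step_fun_comp2 (V1 V2 V : Type) m1 m2 u l (g1 : X -> V1)
  (g2 : X -> V2) (op : V1 -> V2 -> V) :
  step_fun m1 u l g1 -> step_fun m2 u l g2 ->
  step_fun (maxn m1 m2) u l (fun x => op (g1 x) (g2 x)).
Proof.
move=> /(step_fun_le (leq_maxl m1 m2)) h1 /(step_fun_le (leq_maxr m1 m2)) h2.
by move=> x y hx hy xy; rewrite (h1 x y)// (h2 x y).
Qed.

End dyadic.

Lemma cvge0_lt (R : realType) (u : nat -> \bar R) (e : R) : 0 < e ->
  u @ \oo --> 0%E -> exists N, forall k, (N <= k)%N -> (u k < e%:E)%E.
Proof.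
move=> e0 u0.
have [|N _ HN] := u0 [set y | (y < e%:E)%E].
  by apply: open_nbhs_nbhs; split; [exact: open_ereal_lt_ereal|rewrite /= lte_fin].
by exists N => k Nk; exact: HN.
Qed.

(** * Approximation of measurable sets by unions of dyadic cubes *)

Section approx.
Context {R : realType} {n : nat} {d : measure_display} {X : measurableType d}
  {mu : {measure set X -> \bar R}} {coord : X -> 'I_n -> R}.
Context (euc : euclidean mu coord).
Local Notation dcube := (@dcube R n d X coord).
Local Notation step_fun := (@step_fun R n d X coord _).
Implicit Types (u : 'I_n -> R) (l : R) (E F : set (X)).

Definition symdiff (T : Type) (E F : set T) := (E `\` F) `|` (F `\` E).

Lemma measurable_symdiff (E F : set (X)) : measurable E -> measurable F -> measurable (symdiff E F).
Proof. by move=> mE mF; apply: measurableU; apply: measurableD. Qed.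

(** Measurable sets that agree with a union of dyadic subcubes up to small measure.
    They form a sigma-algebra containing the rays, hence contain the sets generated by
    the rays, and by regularity all measurable sets. *)
Definition step_approx u l (E : set (X)) := measurable E /\
  forall e : R, 0 < e -> exists m (F : set (X)),
  [/\ measurable F, step_fun m u l F &
      (mu (symdiff E F `&` dcube u l) <= e%:E)%E].

Lemma step_approxC u l E : step_approx u l E -> step_approx u l (~` E).
Proof.
move=> [mE h]; split=> [|e e0]; first exact: measurableC.
have [m [F [mF sF FE]]] := h e e0; exists m, (~` F); split.
- exact: measurableC.
- by move=> x y hx hy xy; rewrite /setC/= (sF x y).
- rewrite (_ : symdiff (~` E) (~` F) = symdiff E F)//.
  by rewrite /symdiff !setDE !setCK setUC (setIC _ E) (setIC _ F).
Qed.

Lemma step_approx0 u l : step_approx u l set0.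
Proof.
split=> // e e0; exists 0%N, set0; split => //.
by rewrite /symdiff setD0 setU0 set0I measure0 lee_fin ltW.
Qed.

Lemma step_approx_trans u l E : measurable E ->
  (forall e : R, 0 < e -> exists2 G, step_approx u l G &
    (mu (symdiff E G `&` dcube u l) <= e%:E)%E) -> step_approx u l E.
Proof.
move=> mE h; split=> // e e0.
have e20 : 0 < e / 2 by rewrite divr_gt0.
have [G [mG aG] EG] := h _ e20; have [m [F [mF sF GF]]] := aG _ e20.
exists m, F; split => //.
apply: (@le_trans _ _ (mu ((symdiff E G `&` dcube u l) `|` (symdiff G F `&` dcube u l)))).
  have mdq := (measurable_dcube euc) u l.
  apply: le_measure; rewrite ?inE.
  - by apply: measurableI => //; exact: measurable_symdiff.
  - by apply: measurableU; apply: measurableI => //; exact: measurable_symdiff.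
  - rewrite -setIUl; apply: setSI => x.
    by have [Gx|nGx] := pselect (G x) => -[[Ex Fx]|[Fx Ex]];
      [right; left|left; right|left; left|right; right].
apply: (le_trans (measureU2 _ _ _)).
- by apply: measurableI; [exact: measurable_symdiff|exact: (measurable_dcube euc)].
- by apply: measurableI; [exact: measurable_symdiff|exact: (measurable_dcube euc)].
- by rewrite [leRHS](_ : _ = (e/2)%:E + (e/2)%:E)%E ?leeD// -EFinD -splitr.
Qed.

Lemma step_approxU u l E1 E2 : step_approx u l E1 -> step_approx u l E2 ->
  step_approx u l (E1 `|` E2).
Proof.
move=> [m1 h1] [m2 h2]; split=> [|e e0]; first exact: measurableU.
have e20 : 0 < e / 2 by rewrite divr_gt0.
have [k1 [F1 [mF1 s1 F1E]]] := h1 _ e20; have [k2 [F2 [mF2 s2 F2E]]] := h2 _ e20.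
exists (maxn k1 k2), (F1 `|` F2); split => //.
- exact: measurableU.
- exact: (step_fun_comp2 or s1 s2).
apply: (@le_trans _ _ (mu ((symdiff E1 F1 `&` dcube u l) `|` (symdiff E2 F2 `&` dcube u l)))).
  have mdq := (measurable_dcube euc) u l.
  apply: le_measure; rewrite ?inE.
  - by apply: measurableI => //; apply: measurable_symdiff; apply: measurableU.
  - by apply: measurableU; apply: measurableI => //; exact: measurable_symdiff.
  - rewrite -setIUl; apply: setSI => x.
    by move=> [[[Ex|Ex] nF]|[[Fx|Fx] nE]]; [left; left|right; left|left; right|right; right];
      split => // H; (apply: nF || apply: nE); by [left|right].
apply: (le_trans (measureU2 _ _ _)).
- by apply: measurableI; [exact: measurable_symdiff|exact: (measurable_dcube euc)].
- by apply: measurableI; [exact: measurable_symdiff|exact: (measurable_dcube euc)].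
- by rewrite [leRHS](_ : _ = (e/2)%:E + (e/2)%:E)%E ?leeD// -EFinD -splitr.
Qed.

Lemma step_approx_bigcup u l (E : (set (X))^nat) : 0 <= l ->
  (forall k, step_approx u l (E k)) -> step_approx u l (\bigcup_k E k).
Proof.
move=> l0 h.
have mE : measurable (\bigcup_k E k) by apply: bigcupT_measurable => k; case: (h k).
pose G N := \big[setU/set0]_(i < N) E i.
have aG N : step_approx u l (G N).
  rewrite /G; elim: N => [|N IH]; first by rewrite big_ord0; exact: step_approx0.
  by rewrite big_ord_recr; exact: step_approxU.
have GE N : G N `<=` \bigcup_k E k by move=> x; rewrite /G -bigcup_mkord => -[k _ ?]; exists k.
apply: step_approx_trans => // e e0.
pose D N := symdiff (\bigcup_k E k) (G N) `&` dcube u l.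
have DE N : D N = (\bigcup_k E k `\` G N) `&` dcube u l.
  by rewrite /D /symdiff (_ : G N `\` _ = set0) ?setU0//; rewrite setD_eq0; exact: GE.
have mD N : measurable (D N).
  by apply: measurableI ((measurable_dcube euc) _ _); apply: measurable_symdiff => //; case: (aG N).
have D0 : \bigcap_N D N = set0.
  rewrite -subset0 => x Dx; have := Dx 0%N I; rewrite DE => -[[[k _ Ekx] _] _].
  have := Dx k.+1 I; rewrite DE => -[[_ +] _]; apply.
  by rewrite /G -bigcup_mkord; exists k => //=.
have dD : {homo D : n m / (n <= m)%N >-> (m <= n)%O}.
  move=> i j ij; apply/subsetPset; rewrite !DE; apply: setSI; apply: setDS.
  rewrite /G -!bigcup_mkord => x [k /= ki Ekx]; exists k => //=.
  exact: (leq_trans ki).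
have := @nonincreasing_cvg_mu _ _ _ mu D.
rewrite D0 measure0; move=> H.
have {}H : (mu \o D) x @[x --> \oo] --> 0%E.
  apply: H => //; apply: (@le_lt_trans _ _ (mu (dcube u l))).
    apply: le_measure; rewrite ?inE; [exact: mD|exact: (measurable_dcube euc)|].
    exact: subIsetr.
  by rewrite (leb_dcube euc)// ltry.
have [N HN] := cvge0_lt e0 H.
by exists (G N) => //; have /= /ltW := HN N (leqnn N).
Qed.

(** Take the subcubes beyond the first grid hyperplane past a: they miss part of one layer
    of subcubes, of volume at most l^n / 2^m. *)
Lemma step_approx_ray u l i a : 0 < l ->
  step_approx u l [set x : X | a < coord x i].
Proof.
move=> l0.
have mray b : measurable [set x : X | b < coord x i].
  rewrite (_ : [set x : X | _] = [set x : X | forall j, (if j == i then `]b, +oo[%classic else setT) (coord x j)]).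
    by apply: (euclidean_measurable euc (A := fun j => if j == i then `]b, +oo[%classic else setT)) => j; case: ifP.
  apply/seteqP; split=> x /=.
    by move=> bx j; case: eqVneq => // ->; rewrite /= in_itv/= bx.
  by move=> /(_ i); rewrite eqxx /= in_itv/= andbT.
split=> // e e0.
have [m Hm] : exists m, l ^+ n / 2 ^+ m < e.
  have := @cvg_geometric R (l ^+ n) (1 / 2).
  have -> : `|1 / 2| < 1 :> R by rewrite ger0_norm; lra.
  move=> /(_ isT)/cvgr_lt - /(_ e e0)[N _ HN]; exists N.
  by have := HN N (leqnn N); rewrite /geometric/= div1r exprVn.
pose al := (a - u i) * 2 ^+ m / l.
pose F := [set x : X | (Num.floor al + 1)%:~R <= (coord x i - u i) * 2 ^+ m / l].
have FE : F = ~` [set x : X | ~ F x] by apply/seteqP; split=> x; rewrite /setC/= notK.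
exists m, F.
have mF : measurable F.
  rewrite (_ : F = [set x : X | forall j, (if j == i then `[u i + (Num.floor al + 1)%:~R * l / 2 ^+ m, +oo[%classic else setT) (coord x j)]).
    by apply: (euclidean_measurable euc (A := fun j => if j == i then `[u i + (Num.floor al + 1)%:~R * l / 2 ^+ m, +oo[%classic else setT)) => j; case: ifP.
  have E (x : X) : (u i + (Num.floor al + 1)%:~R * l / 2 ^+ m <= coord x i) =
      ((Num.floor al + 1)%:~R <= (coord x i - u i) * 2 ^+ m / l).
    by rewrite -lerBrDl ler_pdivrMr ?exprn_gt0// ler_pdivlMr.
  apply/seteqP; split=> x /=.
    by rewrite /F/= -E => h j; case: eqVneq => // ->; rewrite /= in_itv/= h.
  by move=> /(_ i); rewrite eqxx /= in_itv/= andbT E.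
split => //.
  move=> x y hx hy xy; rewrite /F/= -!floor_ge_int.
  by rewrite xy.
pose B j := if j == i then `]a, a + l / 2 ^+ m]%classic else `[u j, u j + l[%classic.
have mB j : measurable (B j) by rewrite /B; case: ifP.
apply: (@le_trans _ _ (mu [set x : X | forall j, B j (coord x j)])).
  apply: le_measure; rewrite ?inE.
  - by apply: measurableI ((measurable_dcube euc) _ _); exact: measurable_symdiff.
  - exact: (euclidean_measurable euc).
  have tE (x : X) : al < (coord x i - u i) * 2 ^+ m / l = (a < coord x i).
    by rewrite /al ltr_pM2r ?invr_gt0// ltr_pM2r ?exprn_gt0// ltrD2r.
  move=> x [[[/= ax nF]|[Fx nax]] dqx] j; last first.
    exfalso; apply: nax => /=; rewrite -tE; apply: lt_le_trans Fx.
    by have /andP[] := floor_itv al.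
  rewrite /B; case: eqVneq => [->|_]; rewrite /= in_itv/=; last exact: dqx.
  rewrite ax/=; move/negP: nF; rewrite -ltNge => h.
  have h2 : (coord x i - u i) * 2 ^+ m / l <= al + 1.
    by rewrite (le_trans (ltW h))// intrD lerD2r; have /andP[] := floor_itv al.
  move: h2; rewrite ler_pdivrMr// -ler_pdivlMr ?exprn_gt0//.
  have -> : (al + 1) * l / 2 ^+ m = a - u i + l / 2 ^+ m.
    by rewrite /al; field; rewrite expf_neq0//= gt_eqF.
  lra.
rewrite (euclidean_measure euc)// (bigD1 i)//= {1}/B eqxx lebesgue_measure_itv/=.
rewrite (eq_bigr (fun=> l%:E)); last first.
  move=> j ji; rewrite /B (negbTE ji) lebesgue_measure_itv/= lte_fin ltrDl l0.
  by rewrite -EFinB; congr EFin; lra.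
rewrite lte_fin ltrDl divr_gt0 ?exprn_gt0// -EFinB prodEFin -EFinM lee_fin.
rewrite prodr_const cardC1 card_ord; apply: ltW; apply: le_lt_trans Hm.
rewrite [a + _]addrC addrK -[n in leRHS](ltn_predK (ltn_ord i)) exprS.
by rewrite mulrAC.
Qed.

Lemma step_approx_measurable u l E : 0 < l -> measurable E -> step_approx u l E.
Proof.
move=> l0 mE.
have aB (B : set X) : <<s [set A | exists i a, A = [set x | a < coord x i]] >> B ->
    step_approx u l B.
  move: B; apply: smallest_sub; last by move=> _ [i [a ->]]; exact: step_approx_ray.
  split; first exact: step_approx0.
  - by move=> A hA; rewrite setTD; exact: step_approxC.
  - by move=> A hA; apply: step_approx_bigcup => //; exact: ltW.
apply: step_approx_trans => // e e0.
pose E' := E `&` dcube u l.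
have mE' : measurable E' by apply: measurableI => //; exact: (measurable_dcube euc).
have fE' : (mu E' < +oo)%E.
  apply: (@le_lt_trans _ _ (mu (dcube u l))); last by rewrite (leb_dcube euc) ?ltW// ltry.
  by apply: le_measure; rewrite ?inE//; [exact: (measurable_dcube euc)|exact: subIsetr].
have [G [sG EG GE]] := euclidean_regular euc mE' fE' e0.
have [mG aG] := aB G sG; exists G; first by split.
apply: le_trans GE.
apply: le_measure; rewrite ?inE.
- by apply: measurableI ((measurable_dcube euc) _ _); exact: measurable_symdiff.
- exact: measurableD.
- move=> x [[[Ex nG]|[Gx nE]] dx]; first by exfalso; apply: nG; apply: EG.
  by split=> // -[].
Qed.

End approx.

Import HBSimple.

(** * Small cubes almost filled by a set of positive measure *)

Section density.
Context {R : realType} {n : nat} {d : measure_display} {X : measurableType d}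
  {mu : {measure set X -> \bar R}} {coord : X -> 'I_n -> R}.
Context (euc : euclidean mu coord).
Local Notation dcube := (@dcube R n d X coord).
Local Notation step_fun := (@step_fun R n d X coord _).
Implicit Types (u : 'I_n -> R) (l : R) (E F : set (X)).

Lemma leb_dcube_fin u l E : 0 <= l -> measurable E -> mu (E `&` dcube u l) \is a fin_num.
Proof.
move=> l0 mE; rewrite ge0_fin_numE//; apply: (@le_lt_trans _ _ (mu (dcube u l))).
  apply: le_measure; rewrite ?inE; [|exact: (measurable_dcube euc)|exact: subIsetr].
  by apply: measurableI => //; exact: (measurable_dcube euc).
by rewrite (leb_dcube euc)// ltry.
Qed.

Lemma leb_children u l E : measurable E ->
  mu (E `&` dcube u l) =
  (\sum_(s : {ffun 'I_n -> bool}) mu (E `&` dcube (child u l s) (l / 2)))%E.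
Proof.
move=> mE; have mdq := (measurable_dcube euc).
rewrite -integral_indic//.
rewrite (ge0_integral_children euc)//; last exact/measurable_EFinP.
by apply: eq_bigr => s _; rewrite integral_indic.
Qed.

(** If a union F of dyadic subcubes carries on the whole only a fraction eta of points
    outside E, then so does one of its subcubes: descend to a child with this property
    until F is constant. *)
Lemma step_density m u l E F (eta : R) : 0 < l -> measurable E -> measurable F ->
  step_fun m u l F ->
  (mu ((F `\` E) `&` dcube u l) < eta%:E * mu (F `&` dcube u l))%E ->
  exists u' l', 0 < l' /\ (mu (dcube u' l' `\` E) < (eta * l' ^+ n)%:E)%E.
Proof.
move=> l0 mE mF; elim: m u l l0 => [|m IH] u l l0 sF h.
  have [[x [Fx dx]]|/forallNP nF] := pselect (exists x, F x /\ dcube u l x).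
    have dF : dcube u l `<=` F by move=> y dy; rewrite (step_fun0 l0 sF dy dx).
    exists u, l; split => //; move: h.
    by rewrite (setIidr dF) (leb_dcube euc) ?ltW// -EFinM setIDAC setIDA (setIidr dF).
  have F0 : F `&` dcube u l = set0 by rewrite -subset0 => x /nF.
  by move: h; rewrite setIDAC setIDA F0 set0D !measure0 mule0 ltxx.
have [[s hs]|/forallNP H] := pselect (exists s : {ffun 'I_n -> bool},
    (mu ((F `\` E) `&` dcube (child u l s) (l / 2)) < eta%:E * mu (F `&` dcube (child u l s) (l / 2)))%E).
  by apply: IH hs => //; [rewrite divr_gt0|exact: step_funS].
exfalso; move: h; apply/negP; rewrite -leNgt !leb_children//; last exact: measurableD.
rewrite ge0_sume_distrr; last by move=> i _; exact: measure_ge0.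
by apply: lee_sum => s _; rewrite leNgt; apply/negP; exact: H.
Qed.

(** A weak form of the Lebesgue density theorem: approximate E by a union of dyadic
    subcubes and apply the averaging argument of step_density. *)
Lemma exists_dense_dcube u l E (eta : R) : 0 < l -> measurable E -> 0 < eta ->
  (0 < mu (E `&` dcube u l))%E ->
  exists u' l', 0 < l' /\ (mu (dcube u' l' `\` E) < (eta * l' ^+ n)%:E)%E.
Proof.
move=> l0 mE eta0.
have mdq := (measurable_dcube euc).
have [dd dE] : exists dd, mu (E `&` dcube u l) = dd%:E.
  by exists (fine (mu (E `&` dcube u l))); rewrite fineK// leb_dcube_fin// ltW.
rewrite dE lte_fin => d0.
pose e := eta * dd / (2 * (1 + eta)).
have e0 : 0 < e by rewrite divr_gt0 ?mulr_gt0// addr_gt0.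
have eE : e < eta * (dd - e).
  have : e * (2 * (1 + eta)) = eta * dd.
    by rewrite /e divfK// gt_eqF// mulr_gt0// addr_gt0.
  have : 0 < eta * e by rewrite mulr_gt0.
  lra.
have [_ /(_ _ e0)[m [F [mF sF EF]]]] := step_approx_measurable euc u l0 mE.
apply: (step_density l0 mE mF sF).
have mS := measurable_symdiff mE mF.
apply: (@le_lt_trans _ _ e%:E).
  apply: le_trans EF; apply: le_measure; rewrite ?inE; [| |].
  - by apply: measurableI => //; exact: measurableD.
  - exact: measurableI.
  - by move=> x [Fx dx]; split=> //; right.
apply: (@lt_le_trans _ _ (eta * (dd - e))%:E); first by rewrite lte_fin.
rewrite EFinM lee_pmul2l// ?lte_fin// EFinB leeBlDr// -dE.
apply: (@le_trans _ _ (mu ((F `&` dcube u l) `|` (symdiff E F `&` dcube u l)))).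
  apply: le_measure; rewrite ?inE; [exact: measurableI| |].
    by apply: measurableU; exact: measurableI.
  move=> x [Ex dx]; have [Fx|nFx] := pselect (F x); first by left.
  by right; split => //; left.
apply: (le_trans (measureU2 _ _ _)); [exact: measurableI|exact: measurableI|].
by rewrite leeD2l.
Qed.

End density.

(** * Approximation of bounded functions by step functions *)

Section L1approx.
Context {R : realType} {n : nat} {d : measure_display} {X : measurableType d}
  {mu : {measure set X -> \bar R}} {coord : X -> 'I_n -> R}.
Context (euc : euclidean mu coord).
Local Notation dcube := (@dcube R n d X coord).
Local Notation step_fun := (@step_fun R n d X coord _).
Implicit Types (u : 'I_n -> R) (l : R) (E F : set (X)) (f g h : X -> R).

(** Closed under sums and limits in L^1 and containing the indicators of measurable
    sets, hence containing the integrable functions. *)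
Definition L1_step u l f := measurable_fun setT f /\ forall e : R, 0 < e ->
  exists m g, [/\ measurable_fun setT g, step_fun m u l g &
    (\int[mu]_(x in dcube u l) `|f x - g x|%:E <= e%:E)%E].

Lemma measurable_normB f g : measurable_fun setT f -> measurable_fun setT g ->
  measurable_fun setT (fun x => `|f x - g x|%:E).
Proof.
move=> mf mg; apply/measurable_EFinP; apply: measurableT_comp => //.
exact: measurable_funB.
Qed.

Lemma integral_normB_trans (A : set (X)) f g h (e e' : R) : measurable A ->
  measurable_fun setT f -> measurable_fun setT g -> measurable_fun setT h ->
  (\int[mu]_(x in A) `|f x - g x|%:E <= e%:E)%E ->
  (\int[mu]_(x in A) `|g x - h x|%:E <= e'%:E)%E ->
  (\int[mu]_(x in A) `|f x - h x|%:E <= (e + e')%:E)%E.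
Proof.
move=> mA mf mg mh h1 h2; rewrite EFinD; apply: le_trans (leeD h1 h2).
have mN f' g' (mf' : measurable_fun setT f') (mg' : measurable_fun setT g') :=
  measurable_funTS (D := A) (measurable_normB mf' mg').
rewrite -ge0_integralD//; [|exact: mN|exact: mN].
apply: ge0_le_integral => //; [exact: mN|by apply: emeasurable_funD; exact: mN|].
by move=> x _; rewrite lee_fin ler_distD.
Qed.

Lemma L1_step_trans u l f : measurable_fun setT f ->
  (forall e : R, 0 < e -> exists2 g, L1_step u l g &
    (\int[mu]_(x in dcube u l) `|f x - g x|%:E <= e%:E)%E) -> L1_step u l f.
Proof.
move=> mf h; split => // e e0; have e2 : 0 < e / 2 by rewrite divr_gt0.
have [g [mg hg] fg] := h _ e2; have [m [k [mk sk gk]]] := hg _ e2.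
exists m, k; split => //; rewrite [e]splitr.
by apply: integral_normB_trans fg gk => //; exact: (measurable_dcube euc).
Qed.

Lemma L1_stepD u l f1 f2 : L1_step u l f1 -> L1_step u l f2 ->
  L1_step u l (fun x => f1 x + f2 x).
Proof.
move=> [m1 h1] [m2 h2]; split=> [|e e0]; first exact: measurable_funD.
have e2 : 0 < e / 2 by rewrite divr_gt0.
have [k1 [g1 [mg1 s1 fg1]]] := h1 _ e2; have [k2 [g2 [mg2 s2 fg2]]] := h2 _ e2.
exists (maxn k1 k2), (fun x => g1 x + g2 x); split.
- exact: measurable_funD.
- exact: (step_fun_comp2 +%R s1 s2).
rewrite [e]splitr EFinD; apply: le_trans (leeD fg1 fg2).
have mN f' g' (mf' : measurable_fun setT f') (mg' : measurable_fun setT g') :=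
  measurable_funTS (D := dcube u l) (measurable_normB mf' mg').
have mdq := (measurable_dcube euc) u l.
rewrite -ge0_integralD//; [|exact: mN|exact: mN].
apply: ge0_le_integral => //.
- by apply: mN; exact: measurable_funD.
- by apply: emeasurable_funD; exact: mN.
move=> x _; rewrite lee_fin opprD addrACA; exact: ler_normD.
Qed.

Lemma L1_stepZ_indic u l (y : R) E : 0 < l -> measurable E ->
  L1_step u l (fun x => y * \1_E x).
Proof.
move=> l0 mE; have mI F (mF : measurable F) : measurable_fun setT (fun x : X => y * \1_F x).
  by apply: measurable_funM => //; exact: measurable_indic.
split=> [|e e0]; first exact: mI.
have y1 : 0 < `|y| + 1 by rewrite ltr_wpDl.
have e1 : 0 < e / (`|y| + 1) by rewrite divr_gt0.
have [_ /(_ _ e1)[m [F [mF sF EF]]]] := step_approx_measurable euc u l0 mE.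
exists m, (fun x => y * \1_F x); split; first exact: mI.
  move=> p q hp hq pq; have := sF p q hp hq pq.
  by move=> Fpq; rewrite !indicE; congr (y * (nat_of_bool _)%:R); apply/idP/idP; rewrite !inE Fpq.
have mdq := (measurable_dcube euc) u l; have mS := measurable_symdiff mE mF.
apply: (@le_trans _ _ (`|y|%:E * mu (symdiff E F `&` dcube u l))%E).
  rewrite -integral_indic// -ge0_integralZl_EFin//; last first.
    by apply/measurable_EFinP; exact: measurable_indic.
  apply: ge0_le_integral => //.
  - by apply: measurable_funTS; apply: measurable_normB; exact: mI.
  - apply: emeasurable_funM => //; apply/measurable_EFinP.
    exact: measurable_indic.
  move=> x _; rewrite -EFinM lee_fin -mulrBr normrM ler_wpM2l// !indicE.
  have [Ex|Ex] := boolP (x \in E); have [Fx|Fx] := boolP (x \in F);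
    rewrite ?subrr ?normr0 ?subr0 ?sub0r ?normrN ?normr1//.
  - rewrite (_ : x \in _)// inE; left; split; first by rewrite inE in Ex.
    by rewrite notin_setE in Fx.
  - rewrite (_ : x \in _)// inE; right; split; first by rewrite inE in Fx.
    by rewrite notin_setE in Ex.
apply: (le_trans (lee_pmul _ _ (lexx _) EF)) => //.
rewrite -EFinM lee_fin mulrA ler_pdivrMr// mulrC ler_pM2l//.
by rewrite lerDl.
Qed.

Lemma integrable_L1_step u l f : 0 < l -> measurable_fun setT f ->
  mu.-integrable (dcube u l) (EFin \o f) -> L1_step u l f.
Proof.
move=> l0 mf If; have mdq := (measurable_dcube euc) u l.
have [g [Ig _ g0]] := approximation_sfun_integrable mdq If.
apply: L1_step_trans => // e e0.
have [N HN] := cvge0_lt e0 g0.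
exists (g N); last by apply: ltW; have := HN N (leqnn N).
rewrite (_ : (g N : X -> R) = fun x => \sum_(y <- finmap.enum_fset (fset_set (range (g N)))) (y * \1_(g N @^-1` [set y]) x)); last first.
  apply/funext => x; rewrite [LHS]fimfunE fsbig_finite//=.
elim: (finmap.enum_fset _) => [|y r IH].
  rewrite (_ : (fun _ => _) = fun x => 0 * \1_(set0) x) ?mul0r; last first.
    by apply/funext => x; rewrite big_nil mul0r.
  exact: L1_stepZ_indic.
rewrite (_ : (fun _ => _) = (fun x => y * \1_(g N @^-1` [set y]) x +
   \sum_(j <- r) (j * \1_(g N @^-1` [set j]) x))); last first.
  by apply/funext => x; rewrite big_cons.
by apply: L1_stepD => //; exact: L1_stepZ_indic.
Qed.

(** Clamping a step function to the interval [0, M] keeps it a step function and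
    brings it no farther from f. *)
Lemma bounded_L1_step u l f (M e : R) : 0 < l -> measurable_fun setT f ->
  0 <= M -> (forall x, 0 <= f x <= M) -> 0 < e ->
  exists m g, [/\ measurable_fun setT g, step_fun m u l g, forall x, 0 <= g x <= M &
    (\int[mu]_(x in dcube u l) `|f x - g x|%:E <= e%:E)%E].
Proof.
move=> l0 mf M0 fM e0; have mdq := (measurable_dcube euc) u l.
have If : mu.-integrable (dcube u l) (EFin \o f).
  apply: (@le_integrable _ _ _ mu _ mdq (EFin \o f) (EFin \o cst M)).
  - by apply/measurable_EFinP; exact: measurable_funTS.
  - move=> x _ /=; rewrite lee_fin; have /andP[? ?] := fM x.
    by rewrite !ger0_norm.
  - apply/integrableP; split; first exact/measurable_EFinP.
    rewrite [X in (X < _)%E](_ : _ = \int[mu]_(x in dcube u l) (cst M%:E x))%E; last first.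
      by apply: eq_integral => x _ /=; rewrite ger0_norm.
    by rewrite integral_cst// (leb_dcube euc) ?ltW// -EFinM ltry.
have [_ /(_ _ e0)[m [g [mg sg fg]]]] := integrable_L1_step l0 mf If.
exists m, (fun x => Num.min (Num.max (g x) 0) M).
have mG : measurable_fun setT (fun x => Num.min (Num.max (g x) 0) M).
  by apply: measurable_minr => //; exact: measurable_maxr.
split => //.
- by move=> x y hx hy xy; rewrite (sg x y).
- by move=> x; rewrite le_min le_max lexx orbT M0 ge_min lexx orbT.
apply: le_trans fg; apply: ge0_le_integral => //.
- by apply: measurable_funTS; exact: measurable_normB.
- by apply: measurable_funTS; exact: measurable_normB.
move=> x _; rewrite lee_fin; have /andP[h1 h2] := fM x.
rewrite /Num.max; case: (ltP (g x) 0) => g0; rewrite /Num.min; case: ltP => gM.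
- by rewrite subr0 ger0_norm// ger0_norm; lra.
- have -> : f x = 0 by lra.
  have -> : M = 0 by lra.
  by rewrite subrr normr0.
- exact: lexx.
- by rewrite ler0_norm ?subr_le0// ler0_norm; lra.
Qed.

End L1approx.

(** * The John-Nirenberg inequality *)

Section john_nirenberg.
Context {R : realType} {n : nat} {d : measure_display} {X : measurableType d}
  {mu : {measure set X -> \bar R}} {coord : X -> 'I_n -> R}.
Context (euc : euclidean mu coord).
Local Notation dcube := (@dcube R n d X coord).
Local Notation step_fun := (@step_fun R n d X coord _).
Implicit Types (u : 'I_n -> R) (l a : R).
Context (b : X -> R) (mb : measurable_fun setT b).
Context (ib : forall u l, 0 < l -> (\int[mu]_(x in dcube u l) `|b x|%:E < +oo)%E).

(** The oscillation is taken around an arbitrary constant a, not the mean: replacing a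
    by a constant better suited to a child is what drives the induction below. *)
Definition osc u l a : R := fine (\int[mu]_(x in dcube u l) `|b x - a|%:E).

Let mosc a : measurable_fun setT (fun x => `|b x - a|%:E).
Proof.
by apply/measurable_EFinP; apply: measurableT_comp => //; exact: measurable_funB.
Qed.

Lemma osc_ge0 u l a : 0 <= osc u l a.
Proof. by rewrite fine_ge0// integral_ge0. Qed.

Lemma oscE u l a : 0 < l -> (\int[mu]_(x in dcube u l) `|b x - a|%:E = (osc u l a)%:E)%E.
Proof.
move=> l0; rewrite fineK// ge0_fin_numE ?integral_ge0//.
have mdq := measurable_dcube euc u l.
apply: (@le_lt_trans _ _ (\int[mu]_(x in dcube u l) (`|b x|%:E + `|a|%:E))%E).
  apply: ge0_le_integral => //.
  - exact: measurable_funTS.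
  - apply: emeasurable_funD => //; apply: measurable_funTS; apply/measurable_EFinP.
    exact: measurableT_comp.
  - by move=> x _; rewrite -EFinD lee_fin ler_normB.
rewrite ge0_integralD//; last first.
  by apply: measurable_funTS; apply/measurable_EFinP; exact: measurableT_comp.
rewrite lte_add_pinfty ?ib// integral_cst// (leb_dcube euc) ?ltW//.
by rewrite -EFinM ltry.
Qed.

Lemma osc_children u l a : 0 < l ->
  osc u l a = \sum_(s : {ffun 'I_n -> bool}) osc (child u l s) (l / 2) a.
Proof.
move=> l0; apply: EFin_inj; rewrite -oscE// (ge0_integral_children euc)//.
by rewrite -sumEFin; apply: eq_bigr => s _; rewrite oscE// divr_gt0.
Qed.

(** Integrate |a - a'| <= |b - a| + |b - a'|. *)
Lemma osc_dist u l a a' : 0 < l -> `|a - a'| * l ^+ n <= osc u l a + osc u l a'.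
Proof.
move=> l0; rewrite -lee_fin EFinD -!oscE// -ge0_integralD//; [|exact: (measurable_dcube euc)|exact: measurable_funTS|exact: measurable_funTS].
have mdq := measurable_dcube euc u l.
rewrite EFinM -(leb_dcube euc u (ltW l0)) -integral_cst//.
apply: ge0_le_integral => //; first by move=> x _; rewrite lee_fin.
  by apply: emeasurable_funD; exact: measurable_funTS.
move=> x _; rewrite -EFinD lee_fin [`|b x - a|]distrC.
by rewrite (_ : a - a' = (a - b x) + (b x - a')) ?ler_normD//; lra.
Qed.

Lemma osc_shift u l a a' : 0 < l -> osc u l a <= osc u l a' + `|a - a'| * l ^+ n.
Proof.
move=> l0; rewrite -lee_fin EFinD -!oscE//.
have mdq := measurable_dcube euc u l.
rewrite EFinM -(leb_dcube euc u (ltW l0)) -integral_cst//.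
rewrite -ge0_integralD//; [|exact: measurable_funTS|by move=> x _; rewrite lee_fin].
apply: ge0_le_integral => //; first exact: measurable_funTS.
  by apply: emeasurable_funD => //; exact: measurable_funTS.
move=> x _; rewrite -EFinD lee_fin [`|a - a'|]distrC.
by rewrite (_ : b x - a = (b x - a') + (a' - a)) ?ler_normD//; lra.
Qed.

(** The integral of the t-th power of |b - a|, with |b - a| replaced by its averages over
    the subcubes of generation m. *)
Fixpoint dyadic_energy (t : R) m u l a : R :=
  if m is m'.+1 then
    \sum_(s : {ffun 'I_n -> bool}) dyadic_energy t m' (child u l s) (l / 2) a
  else l ^+ n * (osc u l a / l ^+ n) `^ t.

Lemma sum_children_vol l : 0 < l ->
  \sum_(s : {ffun 'I_n -> bool}) (l / 2) ^+ n = l ^+ n.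
Proof.
move=> l0; rewrite sumr_const card_ffun card_bool card_ord.
by rewrite -[LHS]mulr_natr natrX -exprMn divfK.
Qed.

Lemma dyadic_energy_shift t m u l a a' : 0 < t -> 0 < l ->
  dyadic_energy t m u l a <=
  2 `^ t * (dyadic_energy t m u l a' + `|a - a'| `^ t * l ^+ n).
Proof.
move=> t0; elim: m u l => [|m IH] u l l0 /=.
  have ln0 : 0 < l ^+ n by rewrite exprn_gt0.
  rewrite [X in _ <= _ * (_ + X)]mulrC -mulrDr mulrCA ler_pM2l//.
  have o0 := osc_ge0 u l.
  apply: le_trans (powR_addn_le (ltW t0) _ _) => //; last by rewrite divr_ge0// ltW.
  apply: (powR_le (ltW t0)); first by rewrite divr_ge0// ltW.
  by rewrite ler_pdivrMr// mulrDl divfK ?gt_eqF//; exact: osc_shift.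
rewrite -[l ^+ n]sum_children_vol// mulr_sumr -big_split/= mulr_sumr.
by apply: ler_sum => s _; apply: IH; rewrite divr_gt0.
Qed.

(** The Calderon-Zygmund stopping time as an induction on the generation m, uniform
    in m.  While the oscillation around a stays below lam, a is kept.  On a child where it
    exceeds lam for the first time, a is replaced by a constant a' adapted to that child;
    the cost is of order lam^t times its volume, and the volume of such children is paid
    for by the term K * osc.  With lam a large multiple of B, the energy around a' uses at
    most half of that term. *)
Lemma dyadic_energy_le (t B : R) m u l a : 1 < t -> 0 < B -> 
  (forall u l, 0 < l -> exists a, osc u l a <= B * l ^+ n) ->
  let lam := 2 `^ (t + 1) * B in
  let K := 2 `^ (t + 1) * (1 + 2 `^ (t * (n%:R + 1))) * lam `^ t / lam in
  0 < l -> osc u l a <= lam * l ^+ n ->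
  dyadic_energy t m u l a <= lam `^ t * l ^+ n + K * osc u l a.
Proof.
move=> t1 B0 hB lam K.
have t0 : 0 < t by lra.
have two1 : 1 <= 2 `^ (t + 1) :> R by rewrite -[leLHS](powRr0 2) ler_powR//; lra.
have lam0 : 0 < lam by rewrite mulr_gt0// powR_gt0.
have Blam : B <= lam by rewrite ler_peMl// ltW.
have K0 : 0 <= K.
  by rewrite /K divr_ge0 ?mulr_ge0 ?powR_ge0 ?ltW// addr_ge0// powR_ge0.
elim: m u l a => [|m IH] u l a l0 ha /=.
  have ln0 : 0 < l ^+ n by rewrite exprn_gt0.
  apply: ler_wpDr; first by rewrite mulr_ge0// osc_ge0.
  rewrite mulrC ler_pM2r//; apply: (powR_le (ltW t0)).
    by rewrite divr_ge0 ?osc_ge0// ltW.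
  by rewrite ler_pdivrMr.
rewrite -[l ^+ n]sum_children_vol// osc_children// !mulr_sumr -big_split/=.
apply: ler_sum => s _.
have l20 : 0 < l / 2 by rewrite divr_gt0.
have [|big] := leP (osc (child u l s) (l / 2) a) (lam * (l / 2) ^+ n).
  exact: IH.
have [a' ha'] := hB (child u l s) _ l20.
set l' := l / 2 in l20 big ha' *; set u' := child u l s in big ha' *.
have ln0 : 0 < l' ^+ n by rewrite exprn_gt0.
have ha'' : osc u' l' a' <= lam * l' ^+ n by rewrite (le_trans ha')// ler_wpM2r// ltW.
have up : osc u' l' a <= 2 ^+ n * lam * l' ^+ n.
  apply: (@le_trans _ _ (osc u l a)).
    rewrite (osc_children u a l0) (bigD1 s)//= -/l' -/u' lerDl sumr_ge0// => ? _; exact: osc_ge0.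
  have -> : 2 ^+ n * lam * l' ^+ n = lam * l ^+ n.
    by rewrite [2 ^+ n * lam]mulrC -mulrA -exprMn /l' [2 * _]mulrC divfK.
  exact: ha.
have hd : `|a - a'| <= 2 `^ (n%:R + 1) * lam.
  rewrite -(ler_pM2r ln0); apply: (le_trans (osc_dist u' a a' l20)).
  have -> : 2 `^ (n%:R + 1) = 2 ^+ n * 2 :> R.
    by rewrite powRD_gt0// powR_mulrn// powRr1.
  have : 1 * lam <= 2 ^+ n * lam by rewrite ler_pM2r// exprn_ege1//; lra.
  rewrite mul1r; nra.
apply: (le_trans (dyadic_energy_shift m u' a a' t0 l20)).
have := IH u' l' a' l20 ha''.
have : `|a - a'| `^ t <= 2 `^ (t * (n%:R + 1)) * lam `^ t.
  apply: (le_trans (powR_le (ltW t0) _ hd)) => //.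
  by rewrite powRM ?powR_ge0 ?(ltW lam0)// -powRrM [t * _]mulrC.
have KB : 2 `^ t * (K * B) = K * lam / 2.
  by rewrite /lam powRD_gt0// powRr1//; field.
have KE : K * lam = 2 `^ t * 2 * (1 + 2 `^ (t * (n%:R + 1))) * lam `^ t.
  by rewrite /K divfK ?gt_eqF// powRD_gt0// powRr1.
have p0 : 0 <= 2 `^ t :> R := powR_ge0 _ _.
have hK : K * (lam * l' ^+ n) <= K * osc u' l' a by rewrite ler_wpM2l// ltW.
have hK' : K * osc u' l' a' <= K * (B * l' ^+ n) by rewrite ler_wpM2l.
have L0 : 0 <= lam `^ t := powR_ge0 _ _.
move: (`|a - a'| `^ t) (2 `^ (t * (n%:R + 1))) (lam `^ t) (2 `^ t) KB KE p0 hK hK' L0 (dyadic_energy t m u' l' a').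
move=> A P L W KB KE p0 hK hK' L0 E hA hE.
have h1 : W * (E + A * l' ^+ n) <= W * ((L * l' ^+ n + K * (B * l' ^+ n)) + P * L * l' ^+ n).
  apply: ler_wpM2l => //; apply: lerD; first by lra.
  by rewrite ler_pM2r.
apply: (le_trans h1).
have e1 : W * (L * l' ^+ n + K * (B * l' ^+ n) + P * L * l' ^+ n) =
    (W * ((1 + P) * L) + W * (K * B)) * l' ^+ n by ring.
have e2 : W * ((1 + P) * L) = K * lam / 2 by rewrite KE; field.
rewrite e1 KB e2 -splitr.
have : 0 <= L * l' ^+ n by rewrite mulr_ge0// ltW.
lra.
Qed.

Lemma measurable_powR_comp (f : X -> R) (t : R) : measurable_fun setT f ->
  measurable_fun setT (fun x => f x `^ t).
Proof. by move=> mf; exact: (measurableT_comp (measurable_powR t)). Qed.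

(** A step function g of generation m tests b only through the averages over the
    subcubes, so Young's inequality in the tangent form bounds the pairing of
    g^(t-1) with |b - a| by the energy of generation m. *)
Lemma le_dyadic_energy (t : R) m u l a (g : X -> R) : 1 < t -> 0 < l ->
  measurable_fun setT g -> (forall x, 0 <= g x) -> step_fun m u l g ->
  (\int[mu]_(x in dcube u l) (g x `^ t + t * (g x `^ (t - 1) * `|b x - a|))%:E <=
   (dyadic_energy t m u l a)%:E + \int[mu]_(x in dcube u l) (t * g x `^ t)%:E)%E.
Proof.
move=> t1 l0 mg g0 sg; have t0 : 0 < t by lra.
have mba : measurable_fun setT (fun x => `|b x - a|).
  by apply: measurableT_comp => //; exact: measurable_funB.
have mF : measurable_fun setT (fun x => (g x `^ t + t * (g x `^ (t - 1) * `|b x - a|))%:E).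
  apply/measurable_EFinP; apply: measurable_funD; first exact: measurable_powR_comp.
  apply: measurable_funM => //; apply: measurable_funM => //.
  exact: measurable_powR_comp.
have mG : measurable_fun setT (fun x => (t * g x `^ t)%:E).
  apply/measurable_EFinP; apply: measurable_funM => //; exact: measurable_powR_comp.
have F0 x : (0 <= (g x `^ t + t * (g x `^ (t - 1) * `|b x - a|))%:E)%E.
  by rewrite lee_fin addr_ge0 ?mulr_ge0 ?powR_ge0// ltW.
have G0 x : (0 <= (t * g x `^ t)%:E)%E by rewrite lee_fin mulr_ge0 ?powR_ge0// ltW.
elim: m u l l0 sg => [|m IH] u l l0 sg /=; last first.
  rewrite (ge0_integral_children euc)// (ge0_integral_children euc u l mG)//.
  rewrite -sumEFin -big_split/=; apply: lee_sum => s _.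
  by apply: IH; [rewrite divr_gt0|exact: step_funS].
have mdq := measurable_dcube euc u l.
have ln0 : 0 < l ^+ n by rewrite exprn_gt0.
have [x0 x0E] := euclidean_surj euc u.
have dx0 : dcube u l x0 by move=> i; rewrite x0E lexx ltrDl.
have gv x : dcube u l x -> g x = g x0 by move=> dx; exact: (step_fun0 l0 sg).
set v := g x0 in gv; have v0 : 0 <= v := g0 x0.
rewrite [leLHS](_ : _ = \int[mu]_(x in dcube u l) ((v `^ t)%:E + (t * v `^ (t - 1))%:E * `|b x - a|%:E))%E; last first.
  by apply: eq_integral => x; rewrite inE => dx; rewrite gv// EFinD -EFinM mulrA.
rewrite [X in (_ <= _ + X)%E](_ : _ = \int[mu]_(x in dcube u l) (cst (t * v `^ t)%:E x))%E; last first.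
  by apply: eq_integral => x; rewrite inE => dx; rewrite gv.
have c0 : 0 <= t * v `^ (t - 1) by rewrite mulr_ge0 ?powR_ge0// ltW.
rewrite ge0_integralD//; first last.
- by apply: measurable_funTS; apply: emeasurable_funM.
- by move=> x _; rewrite -EFinM lee_fin mulr_ge0.
- by move=> x _; rewrite lee_fin powR_ge0.
rewrite ge0_integralZl_EFin//; last exact: measurable_funTS.
rewrite !integral_cst// (leb_dcube euc _ (ltW l0)) oscE// -!EFinM -!EFinD lee_fin.
have := @powR_tangent _ (osc u l a / l ^+ n) v t t1 (divr_ge0 (osc_ge0 _ _ _) (ltW ln0)) v0.
rewrite -(ler_pM2r ln0) -[t * v `^ (t - 1) * _]mulrA.
have -> : t * (v `^ (t - 1) * (osc u l a / l ^+ n)) * l ^+ n = t * (v `^ (t - 1) * osc u l a).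
  by field; exact: lt0r_neq0.
lra.
Qed.

Definition JN_const (t : R) := (2 + 2 `^ (t * (n%:R + 1))) * 2 `^ ((t + 1) * t).

(** Take for g a step function close to the truncation of |b - a| and absorb.  The
    truncation makes all integrals finite; the bound does not depend on it. *)
Lemma john_nirenberg_trunc (t B N : R) u l a : 1 < t -> 0 < B ->
  (forall u l, 0 < l -> exists a, osc u l a <= B * l ^+ n) ->
  0 < l -> osc u l a <= B * l ^+ n -> 0 < N ->
  (\int[mu]_(x in dcube u l) ((Num.min `|b x - a| N) `^ t)%:E <=
   (JN_const t * B `^ t * l ^+ n)%:E)%E.
Proof.
move=> t1 B0 hB l0 ha N0; have t0 : 0 < t by lra.
have ln0 : 0 < l ^+ n by rewrite exprn_gt0.
have mdq := measurable_dcube euc u l.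
have mba : measurable_fun setT (fun x => `|b x - a|).
  by apply: measurableT_comp => //; exact: measurable_funB.
pose f x := Num.min `|b x - a| N.
have mf : measurable_fun setT f by exact: measurable_minr.
have fN x : 0 <= f x <= N by rewrite le_min normr_ge0 ltW//= ge_min lexx orbT.
have fb x : f x <= `|b x - a| by rewrite ge_min lexx.
pose L := 2 * t * N `^ (t - 1).
have L0 : 0 < L by rewrite !mulr_gt0// powR_gt0.
apply/lee_addgt0Pr => e e0.
have eL : 0 < e / L by rewrite divr_gt0.
have [m [g [mg sg gN fg]]] := bounded_L1_step euc u l0 mf (ltW N0) fN eL.
have g0 x : 0 <= g x by have /andP[] := gN x.
have gNle x : g x <= N by have /andP[] := gN x.
have := le_dyadic_energy a t1 l0 mg g0 sg.
have energy : dyadic_energy t m u l a <= JN_const t * B `^ t * l ^+ n.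
  have two1 : 1 <= 2 `^ (t + 1) :> R by rewrite -[leLHS](powRr0 2) ler_powR//; lra.
  have B2 : B <= 2 `^ (t + 1) * B by rewrite ler_peMl// ltW.
  have ha2 : osc u l a <= 2 `^ (t + 1) * B * l ^+ n.
    by rewrite (le_trans ha)// ler_wpM2r// ltW.
  apply: (le_trans (dyadic_energy_le m t1 B0 hB l0 ha2)).
  set lam := 2 `^ (t + 1) * B in ha2 *.
  have lam0 : 0 < lam by rewrite mulr_gt0// powR_gt0.
  have -> : JN_const t * B `^ t = (2 + 2 `^ (t * (n%:R + 1))) * lam `^ t.
    by rewrite /JN_const /lam powRM ?powR_ge0 ?ltW// -powRrM mulrA.
  set P := 2 `^ (t * _); set K := _ / lam.
  have K0 : 0 <= K.
    have P0 : 0 <= 1 + P by rewrite addr_ge0 ?powR_ge0.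
    by rewrite /K divr_ge0 ?(ltW lam0)// !mulr_ge0 ?powR_ge0.
  have := ler_wpM2l K0 ha.
  have -> : K * (B * l ^+ n) = (1 + P) * lam `^ t * l ^+ n.
    by rewrite /K {2}/lam; field; rewrite (lt0r_neq0 B0)/= lt0r_neq0//.
  lra.
set A := (\int[mu]_(x in _) _)%E; set G := (\int[mu]_(x in _) (t * _)%:E)%E => H.
have mpf : measurable_fun setT (fun x => f x `^ t) := measurable_powR_comp t mf.
have mpg r : measurable_fun setT (fun x => g x `^ r) := measurable_powR_comp r mg.
have mG : measurable_fun setT (fun x => (t * g x `^ t)%:E).
  by apply/measurable_EFinP; exact: measurable_funM.
have Gfin : G \is a fin_num.
  rewrite ge0_fin_numE; last first.
    by apply: integral_ge0 => x _; rewrite lee_fin mulr_ge0 ?powR_ge0// ltW.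
  apply: (@le_lt_trans _ _ (\int[mu]_(x in dcube u l) (cst (t * N `^ t)%:E x))%E).
    apply: ge0_le_integral => //.
    - by move=> x _; rewrite lee_fin mulr_ge0 ?powR_ge0// ltW.
    - exact: measurable_funTS.
    - by move=> x _; rewrite lee_fin ler_pM2l//; apply: powR_le => //; exact: ltW.
  by rewrite integral_cst// (leb_dcube euc) ?ltW// -EFinM ltry.
rewrite -(leeD2rE _ _ Gfin).
apply: (@le_trans _ _ (A + L%:E * \int[mu]_(x in dcube u l) `|f x - g x|%:E)%E); last first.
  apply: (le_trans (leeD H (lee_pmul _ _ (lexx L%:E) fg))).
  - by rewrite lee_fin ltW.
  - exact: integral_ge0.
  rewrite addeAC -EFinM [L * _]mulrC divfK ?gt_eqF// leeD2r// leeD2r//.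
have mfg : measurable_fun setT (fun x => `|f x - g x|%:E) by exact: measurable_normB.
have mA : measurable_fun setT (fun x => (g x `^ t + t * (g x `^ (t - 1) * `|b x - a|))%:E).
  apply/measurable_EFinP; apply: measurable_funD => //.
  by apply: measurable_funM => //; exact: measurable_funM.
rewrite -ge0_integralZl_EFin//; [|exact: measurable_funTS|exact: ltW].
rewrite -ge0_integralD//; first last.
- exact: measurable_funTS.
- by move=> x _; rewrite lee_fin mulr_ge0 ?powR_ge0// ltW.
- by apply: measurable_funTS; exact/measurable_EFinP.
- by move=> x _; rewrite lee_fin powR_ge0.
rewrite -ge0_integralD//; first last.
- by apply: measurable_funTS; exact: emeasurable_funM.
- by move=> x _; rewrite -EFinM lee_fin mulr_ge0// ltW.
- exact: measurable_funTS.
- by move=> x _; rewrite lee_fin addr_ge0 ?mulr_ge0 ?powR_ge0// ltW.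
apply: ge0_le_integral => //.
- by move=> x _; rewrite -EFinD lee_fin addr_ge0 ?mulr_ge0 ?powR_ge0// ltW.
- apply: measurable_funTS; apply: emeasurable_funD => //; exact/measurable_EFinP.
- apply: measurable_funTS; apply: emeasurable_funD => //; exact: emeasurable_funM.
move=> x _; rewrite -EFinM -!EFinD lee_fin.
apply: (le_trans (powR_tangent_dist t1 (fN x) (gN x))).
rewrite lerD2r lerD2l ler_pM2l// ler_wpM2l ?powR_ge0//.
Qed.

(** The truncation is removed by monotone convergence. *)
Lemma john_nirenberg (t B : R) u l a : 1 < t -> 0 < B ->
  (forall u l, 0 < l -> exists a, osc u l a <= B * l ^+ n) ->
  0 < l -> osc u l a <= B * l ^+ n ->
  (\int[mu]_(x in dcube u l) (`|b x - a| `^ t)%:E <=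
   (JN_const t * B `^ t * l ^+ n)%:E)%E.
Proof.
move=> t1 B0 hB l0 ha; have t0 : 0 < t by lra.
have mdq := measurable_dcube euc u l.
have mba : measurable_fun setT (fun x => `|b x - a|).
  by apply: measurableT_comp => //; exact: measurable_funB.
pose g k x := ((Num.min `|b x - a| k.+1%:R) `^ t)%:E.
have mg k : measurable_fun (dcube u l) (g k).
  apply: measurable_funTS; apply/measurable_EFinP; apply: measurable_powR_comp.
  exact: measurable_minr.
have min0 x k : 0 <= Num.min `|b x - a| k.+1%:R by rewrite le_min normr_ge0/=.
have g0 k x : dcube u l x -> (0 <= g k x)%E by rewrite lee_fin powR_ge0.
have nd x : dcube u l x -> {homo g^~ x : k j / (k <= j)%N >-> (k <= j)%E}.
  move=> _ k j kj; rewrite lee_fin; apply: powR_le => //; first exact: ltW.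
  by rewrite le_min !ge_min lexx ler_nat ltnS kj orbT.
have cv := cvg_monotone_convergence (mu := mu) mdq mg g0 nd.
rewrite (_ : (\int[mu]_(x in dcube u l) (`|b x - a| `^ t)%:E = \int[mu]_(x in dcube u l) limn (g^~ x))%E); last first.
  apply: eq_integral => x _; apply/esym/cvg_lim => //.
  apply: cvg_near_cst; exists (Num.truncn `|b x - a|) => // k /= hk.
  rewrite /g (min_idPl _)//; apply: (le_trans (ltW (truncnS_gt _))).
  by rewrite ler_nat ltnS.
rewrite -(cvg_lim _ cv)//; apply: lime_le; first exact: (cvgP _ cv).
apply: nearW => k; exact: john_nirenberg_trunc.
Qed.

End john_nirenberg.

(** * Weights satisfying a reverse Hoelder inequality *)

Section weights.
Context {R : realType} {n : nat} {d : measure_display} {X : measurableType d}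
  {mu : {measure set X -> \bar R}} {coord : X -> 'I_n -> R}.
Context (euc : euclidean mu coord).
Local Notation dcube := (@dcube R n d X coord).
Local Notation ccube := (@ccube R n d X coord).
Implicit Types (u : 'I_n -> R) (l : R) (c : X) (f h : X -> R).
Context (w : X -> R) (mw : measurable_fun setT w) (w0 : forall x, 0 <= w x).

Definition wcube c l : R := fine (\int[mu]_(x in ccube c l) (w x)%:E).

Context (wfin : forall c l, 0 < l -> (\int[mu]_(x in ccube c l) (w x)%:E < +oo)%E)
  (wpos : forall c l, 0 < l -> 0 < wcube c l).
Context (r K : R) (r1 : 1 < r) (K0 : 0 <= K)
  (RH : forall c l, 0 < l -> (\int[mu]_(x in ccube c l) (w x `^ r)%:E <=
    (K * (l ^+ n * (wcube c l / l ^+ n) `^ r))%:E)%E).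

Lemma wcubeE c l : 0 < l -> (\int[mu]_(x in ccube c l) (w x)%:E = (wcube c l)%:E)%E.
Proof.
move=> l0; rewrite fineK// ge0_fin_numE ?wfin//.
by apply: integral_ge0 => x _; rewrite lee_fin.
Qed.

Lemma integral_supp (A : set X) (f : X -> \bar R) :
  (forall x, ~ A x -> f x = 0%E) ->
  (\int[mu]_(x in A) f x = \int[mu]_x f x)%E.
Proof.
move=> h; rewrite integral_mkcond; congr (integral mu setT _).
apply/funext => x; rewrite patchE; case: ifPn => //.
by rewrite notin_setE => /h ->.
Qed.

Lemma dcube_cover : \bigcup_k dcube (fun=> - k.+1%:R) (2 * k.+1%:R) = setT.
Proof.
apply/seteqP; split=> // x _; have [k hk] : exists k : nat, forall i, `|coord x i| < k.+1%:R.
  exists (Num.truncn (\sum_i `|coord x i|)) => i.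
  apply: le_lt_trans (truncnS_gt _).
  by rewrite (bigD1 i)//= lerDl sumr_ge0.
exists k => // i; have := hk i; rewrite ltr_norml => /andP[h1 h2].
by apply/andP; split; lra.
Qed.

(** If w vanished on a set of positive measure, some cube would be filled by this set
    up to a fraction eta.  Splitting w at the height m times its mean, the mass of w on
    the rest of the cube is at most m eta + K m^(1-r) times the mass of the cube, which
    is less than 1 for m large and then eta small. *)
Lemma weight_gt0_ae : {ae mu, forall x, 0 < w x}.
Proof.
pose E := w @^-1` [set 0].
have mE : measurable E by rewrite -[E]setTI; exact: mw.
suff E0 k : mu (E `&` dcube (fun=> - k.+1%:R) (2 * k.+1%:R)) = 0%E.
  apply: (@negligibleS _ _ _ mu (\bigcup_k (E `&` dcube (fun=> - k.+1%:R) (2 * k.+1%:R)))).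
    rewrite -setI_bigcupr dcube_cover setIT => x /= /negP; rewrite -leNgt => wx.
    by apply/eqP; rewrite eq_le wx w0.
  apply: negligible_bigcup => k; apply/negligibleP => //.
    by apply: measurableI => //; exact: (measurable_dcube euc).
  exact: E0.
apply/eqP; rewrite -measure_le0 leNgt; apply/negP => H.
have r1_ := r1; have K0_ := K0.
have r10 : 0 < r - 1 by lra.
have K1 : 0 < K + 1 by lra.
(* With this m the two parts contribute at most one third of the mass each:
   m eta = 1/3 for eta = 1/(3m), and K m^(1-r) < 1/3. *)
pose m := (3 * (K + 1)) `^ (r - 1)^-1.
have m0 : 0 < m by rewrite powR_gt0//; lra.
have mr : m `^ (r - 1) = 3 * (K + 1) by rewrite -powRrM mulVf ?gt_eqF// powRr1//; lra.
have eta0 : 0 < (3 * m)^-1 by rewrite invr_gt0 mulr_gt0.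
have k0 : 0 < 2 * k.+1%:R :> R by rewrite mulr_gt0.
have [u [l [l0 ul]]] := exists_dense_dcube euc k0 mE eta0 H.
have [c cu] := corner_surj euc u l.
have ln0 : 0 < l ^+ n by rewrite exprn_gt0.
have W0 := wpos c l0.
have mdq := measurable_dcube euc u l.
pose M := m * (wcube c l / l ^+ n).
have M0 : 0 < M by rewrite mulr_gt0// divr_gt0.
have P0 x : (0 <= M%:E + (M `^ (1 - r))%:E * (w x `^ r)%:E)%E.
  by rewrite -EFinM -EFinD lee_fin (addr_ge0 (ltW M0) (mulr_ge0 (powR_ge0 _ _) (powR_ge0 _ _))).
have : ((wcube c l)%:E <= \int[mu]_(x in dcube u l `\` E) (M%:E + (M `^ (1 - r))%:E * (w x `^ r)%:E))%E.
  rewrite -wcubeE// (ge0_integral_ccube_dcube euc c (ltW l0))//; last by apply/measurable_EFinP.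
  rewrite cu integral_mkcond [leRHS]integral_mkcond.
  apply: ge0_le_integral => //.
  - by move=> x _; rewrite patchE; case: ifP => // _; rewrite lee_fin.
  - by apply/(measurable_restrictT _ mdq); apply: measurable_funTS; exact/measurable_EFinP.
  - apply/(measurable_restrictT _ (measurableD mdq mE)); apply: measurable_funTS.
    apply: emeasurable_funD => //; apply: emeasurable_funM => //.
    by apply/measurable_EFinP; exact: measurable_powR_comp.
  move=> x _; rewrite !patchE; case: ifPn => [|_]; last first.
    by case: ifP => _ //; exact: P0.
  rewrite inE => dx; have [Ex|nEx] := pselect (E x).
    by move: (P0 x); rewrite Ex; case: ifP.
  rewrite mem_set// -EFinM -EFinD lee_fin.
  have [wM|/ltW Mw] := leP (w x) M; first by rewrite ler_wpDr// mulr_ge0 ?powR_ge0.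
  apply: ler_wpDl; first exact: ltW.
  have wx0 : 0 < w x by exact: lt_le_trans Mw.
  rewrite -(mulr_powRB1 (w0 x)); last by lra.
  rewrite mulrCA -[leLHS]mulr1 ler_pM2l// (_ : 1 - r = - (r - 1)); last by lra.
  rewrite powRN mulrC ler_pdivlMr ?powR_gt0// mul1r; apply: powR_le => //; exact: ltW.
have mw_r : measurable_fun setT (fun x => (w x `^ r)%:E).
  by apply/measurable_EFinP; exact: measurable_powR_comp.
have mdE := measurableD mdq mE.
rewrite ge0_integralD//; first last.
- by apply: measurable_funTS; exact: emeasurable_funM.
- by move=> x _; rewrite -EFinM lee_fin mulr_ge0 ?powR_ge0.
- by move=> x _; rewrite lee_fin ltW.
rewrite integral_cst// ge0_integralZl_EFin ?powR_ge0//; first last.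
- exact: measurable_funTS.
- by move=> x _; rewrite lee_fin powR_ge0.
have RH' : (\int[mu]_(x in dcube u l `\` E) (w x `^ r)%:E <=
    (K * (l ^+ n * (wcube c l / l ^+ n) `^ r))%:E)%E.
  apply: le_trans (RH c l0); apply: ge0_subset_integral => //.
  - exact: (measurable_ccube euc).
  - exact: measurable_funTS.
  - by move=> x _; rewrite lee_fin powR_ge0.
  - by move=> x [dx _]; rewrite -cu in dx; exact: dcube_ccube dx.
apply/negP; rewrite -ltNge.
apply: (@le_lt_trans _ _ (M * ((3 * m)^-1 * l ^+ n) +
   M `^ (1 - r) * (K * (l ^+ n * (wcube c l / l ^+ n) `^ r)))%:E).
  rewrite EFinD !EFinM; apply: leeD.
    by rewrite lee_pmul2l// ?lte_fin// -?EFinM ltW.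
  by rewrite lee_pmul2l// ?lte_fin ?powR_gt0// -!EFinM.
rewrite lte_fin.
have W0' : 0 < wcube c l / l ^+ n by rewrite divr_gt0.
have -> : M * ((3 * m)^-1 * l ^+ n) = wcube c l / 3.
  by rewrite /M; field; rewrite !lt0r_neq0.
have -> : M `^ (1 - r) * (K * (l ^+ n * (wcube c l / l ^+ n) `^ r)) =
    wcube c l * (K / (3 * (K + 1))).
  have -> : M `^ (1 - r) = (3 * (K + 1))^-1 * (wcube c l / l ^+ n) `^ (1 - r).
    rewrite /M powRM ?(ltW m0) ?(ltW W0')// (_ : m `^ (1 - r) = (3 * (K + 1))^-1)//.
    by rewrite -mr -powRN; congr (_ `^ _); lra.
  have e : (wcube c l / l ^+ n) `^ (1 - r) * (wcube c l / l ^+ n) `^ r = wcube c l / l ^+ n.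
    by rewrite -powRD_gt0// subrK powRr1// ltW.
  have -> : (3 * (K + 1))^-1 * (wcube c l / l ^+ n) `^ (1 - r) *
    (K * (l ^+ n * (wcube c l / l ^+ n) `^ r)) = (3 * (K + 1))^-1 *
    K * l ^+ n * ((wcube c l / l ^+ n) `^ (1 - r) * (wcube c l / l ^+ n) `^ r) by ring.
  by rewrite e; field; rewrite !lt0r_neq0.
clear H ul RH' P0; have : K / (3 * (K + 1)) <= 1 / 3.
  by rewrite ler_pdivrMr ?mulr_gt0//; lra.
move=> /(ler_wpM2l (ltW W0)); lra.
Qed.

End weights.

(** * Oscillation on dilated cubes *)

Section bmo.
Context {R : realType} {n : nat} {d : measure_display} {X : measurableType d}
  {mu : {measure set X -> \bar R}} {coord : X -> 'I_n -> R}.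
Context (euc : euclidean mu coord).
Local Notation dcube := (@dcube R n d X coord).
Local Notation ccube := (@ccube R n d X coord).
Local Notation corner := (@corner R n d X coord).
Implicit Types (u : 'I_n -> R) (l : R) (c : X).
Context (b : X -> R) (B : R) (mb : measurable_fun setT b) (B0 : 0 < B).
Context (ib : forall c l, 0 < l -> (\int[mu]_(x in ccube c l) `|b x|%:E < +oo)%E).
Context (bmo : forall c l, 0 < l ->
  exists a, (\int[mu]_(x in ccube c l) `|b x - a|%:E <= (B * l ^+ n)%:E)%E).

Let mba a : measurable_fun setT (fun x => `|b x - a|).
Proof. by apply: measurableT_comp => //; exact: measurable_funB. Qed.

Let ib_dcube u l : 0 < l -> (\int[mu]_(x in dcube u l) `|b x|%:E < +oo)%E.
Proof.
move=> l0; have [c <-] := corner_surj euc u l.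
rewrite -(ge0_integral_ccube_dcube euc c (ltW l0))//; first exact: ib.
by apply/measurable_EFinP; exact: measurableT_comp.
Qed.

Let osc_ccube c l a : 0 < l ->
  (\int[mu]_(x in ccube c l) `|b x - a|%:E = (@osc R n d X mu coord b (corner c l) l a)%:E)%E.
Proof.
move=> l0; rewrite (ge0_integral_ccube_dcube euc c (ltW l0))//; last exact/measurable_EFinP.
exact: (oscE euc mb ib_dcube).
Qed.

Let bmo_dcube u l : 0 < l -> exists a, @osc R n d X mu coord b u l a <= B * l ^+ n.
Proof.
move=> l0; have [c <-] := corner_surj euc u l; have [a] := bmo c l0.
by rewrite osc_ccube// lee_fin => h; exists a.
Qed.

Lemma bmo_Lt (t : R) c l a : 1 < t -> 0 < l ->
  (\int[mu]_(x in ccube c l) `|b x - a|%:E <= (B * l ^+ n)%:E)%E ->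
  (\int[mu]_(x in ccube c l) (`|b x - a| `^ t)%:E <=
   (@JN_const R n t * B `^ t * l ^+ n)%:E)%E.
Proof.
move=> t1 l0; rewrite osc_ccube// lee_fin => ha.
rewrite (ge0_integral_ccube_dcube euc c (ltW l0))//; first exact: (john_nirenberg euc mb ib_dcube t1 B0 bmo_dcube l0 ha).
by apply/measurable_EFinP; exact: (measurable_powR_comp t (mba a)).
Qed.

Lemma ccube_double c l : 0 <= l -> ccube c l `<=` ccube c (2 * l).
Proof. by move=> l0 x hx i; apply: (le_trans (hx i)); lra. Qed.

Lemma bmo_dist c l a a' : 0 < l ->
  (\int[mu]_(x in ccube c l) `|b x - a|%:E <= (B * l ^+ n)%:E)%E ->
  (\int[mu]_(x in ccube c (2 * l)) `|b x - a'|%:E <= (B * (2 * l) ^+ n)%:E)%E ->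
  `|a - a'| <= (2 ^+ n + 1) * B.
Proof.
move=> l0 ha ha'.
have ln0 : 0 < l ^+ n by rewrite exprn_gt0.
have {}ha' : (\int[mu]_(x in ccube c l) `|b x - a'|%:E <= (B * (2 * l) ^+ n)%:E)%E.
  apply: le_trans ha'; apply: ge0_subset_integral => //.
  - exact: (measurable_ccube euc).
  - exact: (measurable_ccube euc).
  - by apply: measurable_funTS; exact/measurable_EFinP.
  - by apply: ccube_double; exact: ltW.
move: ha ha'; rewrite !osc_ccube// !lee_fin => ha ha'.
have := osc_dist euc mb ib_dcube (corner c l) a a' l0.
move=> /le_trans/(_ (lerD ha ha')) H; rewrite -(ler_pM2r ln0) (le_trans H)// exprMn.
by rewrite le_eqVlt; apply/orP; left; apply/eqP; ring.
Qed.

(** Consecutive dilates have comparable size, so each doubling moves the adapted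
    constant by at most a multiple of B. *)
Lemma bmo_telescope c l a k : 0 < l ->
  (\int[mu]_(x in ccube c l) `|b x - a|%:E <= (B * l ^+ n)%:E)%E ->
  exists a', (\int[mu]_(x in ccube c (2 ^+ k * l)) `|b x - a'|%:E <= (B * (2 ^+ k * l) ^+ n)%:E)%E /\
   `|a - a'| <= k%:R * ((2 ^+ n + 1) * B).
Proof.
move=> l0 ha; elim: k => [|k [a' [ha' aa']]].
  by exists a; rewrite expr0 mul1r subrr normr0 mul0r.
have l0' : 0 < 2 ^+ k * l by rewrite mulr_gt0// exprn_gt0.
have [a'' ha''] := bmo c (mulr_gt0 (ltr0Sn R 1) l0').
have h := bmo_dist l0' ha' ha''.
exists a''; rewrite exprS -mulrA; split => //.
rewrite -natr1 mulrDl mul1r (_ : a - a'' = (a - a') + (a' - a'')); last by lra.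
by apply: (le_trans (ler_normD _ _)); exact: lerD.
Qed.

Definition bmo_const (t : R) := 2 `^ t * (@JN_const R n t + (2 ^+ n + 1) `^ t).

Lemma JN_const_ge0 (t : R) : 0 <= @JN_const R n t.
Proof. by rewrite /JN_const mulr_ge0 ?powR_ge0// addr_ge0 ?powR_ge0. Qed.

Lemma bmo_const_ge0 (t : R) : 0 <= bmo_const t.
Proof. by rewrite mulr_ge0 ?powR_ge0// addr_ge0 ?JN_const_ge0 ?powR_ge0. Qed.

(** By bmo_telescope the constant a of the original cube is within a multiple of k B of
    one adapted to the dilate, and the John-Nirenberg inequality holds around the latter. *)
Lemma bmo_dilate (t : R) c l a k : 1 < t -> 0 < l ->
  (\int[mu]_(x in ccube c l) `|b x - a|%:E <= (B * l ^+ n)%:E)%E ->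
  (\int[mu]_(x in ccube c (2 ^+ k * l)) (`|b x - a| `^ t)%:E <=
   (bmo_const t * (k.+1%:R * B) `^ t * (2 ^+ k * l) ^+ n)%:E)%E.
Proof.
move=> t1 l0 ha; have t0 : 0 < t by lra.
pose JN := @JN_const R n t.
have [a' [ha' aa']] := bmo_telescope k l0 ha.
have L0 : 0 < 2 ^+ k * l by rewrite mulr_gt0// exprn_gt0.
set L := 2 ^+ k * l in L0 ha' *.
have mcube := measurable_ccube euc c L.
have Ln0 : 0 < L ^+ n by rewrite exprn_gt0.
have mt a0 : measurable_fun (ccube c L) (fun x => (`|b x - a0| `^ t)%:E).
  by apply: measurable_funTS; apply/measurable_EFinP; exact: (measurable_powR_comp t (mba a0)).
apply: (@le_trans _ _ (\int[mu]_(x in ccube c L) ((2 `^ t)%:E * ((`|b x - a'| `^ t)%:E + (`|a - a'| `^ t)%:E)))%E).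
  apply: ge0_le_integral => //.
    by apply: emeasurable_funM => //; exact: emeasurable_funD.
  move=> x _; rewrite -EFinD -EFinM lee_fin.
  apply: le_trans (powR_addn_le (ltW t0) (normr_ge0 _) (normr_ge0 _)).
  apply: powR_le => //; first exact: ltW.
  rewrite [`|a - a'|]distrC (_ : b x - a = (b x - a') + (a' - a)) ?ler_normD//; lra.
rewrite ge0_integralZl_EFin ?powR_ge0//; first last.
- exact: emeasurable_funD.
- by move=> x _; rewrite -EFinD lee_fin addr_ge0 ?powR_ge0.
rewrite ge0_integralD//.
rewrite integral_cst// (leb_ccube euc c (ltW L0)) -EFinM.
apply: le_trans (lee_wpmul2l _ (leeD (bmo_Lt t1 L0 ha') (lexx _))) _.
  by rewrite lee_fin powR_ge0.
rewrite -EFinD -EFinM lee_fin /bmo_const.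
suff h : JN * B `^ t + `|a - a'| `^ t <= (JN + (2 ^+ n + 1) `^ t) * (k.+1%:R * B) `^ t.
  have := ler_wpM2r (ltW Ln0) (ler_wpM2l (powR_ge0 2 t) h).
  by rewrite -/JN => H; apply: le_trans (le_trans H _); rewrite le_eqVlt;
    apply/orP; left; apply/eqP; ring.
rewrite mulrDl; apply: lerD.
  apply: ler_wpM2l; first exact: JN_const_ge0.
  apply: powR_le; [exact: ltW|exact: ltW|].
  by rewrite ler_peMl ?(ltW B0)// ler1n.
have P0 : 0 <= 2 ^+ n + 1 :> R by rewrite addr_ge0// exprn_ge0.
have kB : 0 <= k.+1%:R * B by rewrite mulr_ge0// ltW.
rewrite -powRM//.
apply: powR_le; [exact: ltW|exact: normr_ge0|].
by apply: (le_trans aa'); rewrite mulrCA ler_wpM2l// ler_wpM2r ?(ltW B0)// ler_nat leqnSn.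
Qed.

End bmo.

(** * Blocks and domination by series of blocks *)

Section blocks.
Context {R : realType} {n : nat} {d : measure_display} {X : measurableType d}
  {mu : {measure set X -> \bar R}} {coord : X -> 'I_n -> R}.
Context (euc : euclidean mu coord).
Local Notation ccube := (@ccube R n d X coord).
Local Notation wcube := (@wcube R n d X mu coord).
Implicit Types (u : 'I_n -> R) (l : R) (c : X) (f g h F G : X -> R).
Context (w : X -> R) (mw : measurable_fun setT w) (w0 : forall x, 0 <= w x).
Context (wfin : forall c l, 0 < l -> (\int[mu]_(x in ccube c l) (w x)%:E < +oo)%E)
  (wpos : forall c l, 0 < l -> 0 < wcube w c l).
Context (r K : R) (r1 : 1 < r) (K0 : 0 <= K)
  (RH : forall c l, 0 < l -> (\int[mu]_(x in ccube c l) (w x `^ r)%:E <=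
    (K * (l ^+ n * (wcube w c l / l ^+ n) `^ r))%:E)%E).
Context (p s : R) (p0 : 0 < p) (rps : r * p / (r - 1) < s).

(** The norm condition of a block, raised to the power s. *)
Definition block_on c l h := [/\ measurable_fun setT h, 0 < l,
  forall x, h x != 0 -> ccube c l x &
  (\int[mu]_x (`|h x| `^ s)%:E <= (l ^+ n * wcube w c l `^ (- (s / p)))%:E)%E].

Definition is_block h := exists c l, block_on c l h.

Let s0 : 0 < s.
Proof.
have r1' := r1; have p0' := p0; apply: lt_trans rps; rewrite divr_gt0 ?mulr_gt0//; lra.
Qed.

Lemma measurable_norm_powR f (t : R) : measurable_fun setT f ->
  measurable_fun setT (fun x => (`|f x| `^ t)%:E).
Proof.
move=> mf; apply/measurable_EFinP.
by apply: (@measurable_powR_comp _ _ _ (fun x => `|f x|)); exact: measurableT_comp.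
Qed.

Lemma block_on_le c l h g : block_on c l h -> measurable_fun setT g ->
  (forall x, `|g x| <= `|h x|) -> block_on c l g.
Proof.
move=> [mh l0 sh ih] mg gh; split; [exact: mg|exact: l0|move=> x gx|].
  apply: sh; rewrite -normr_gt0 (lt_le_trans _ (gh x))// normr_gt0//.
apply: le_trans ih; apply: ge0_le_integral => //.
- exact: measurable_norm_powR.
- exact: measurable_norm_powR.
- by move=> x _; rewrite lee_fin; apply: powR_le => //; exact: ltW.
Qed.

Lemma block_on0 c l : 0 < l -> block_on c l (fun=> 0).
Proof.
move=> l0; split => // [x|]; first by rewrite eqxx.
rewrite integral0_eq ?lee_fin ?mulr_ge0 ?powR_ge0 ?exprn_ge0 ?ltW// => x _.
by rewrite normr0 powR0// gt_eqF.
Qed.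

Lemma is_block_measurable h : is_block h -> measurable_fun setT h.
Proof. by case=> c [l []]. Qed.

Lemma is_block_le h g : is_block h -> measurable_fun setT g ->
  (forall x, `|g x| <= `|h x|) -> is_block g.
Proof. by move=> [c [l hb]] mg gh; exists c, l; exact: block_on_le hb mg gh. Qed.

Lemma is_block0 : is_block (fun=> 0).
Proof. by have [c _] := euclidean_surj euc (fun=> 0); exists c, 1; exact: block_on0. Qed.

(** Where the reverse Hoelder inequality and s > rp/(r-1) enter: by Young's
    inequality with exponent r the integral of |h|^p w is controlled by those of |h|^s
    and w^r, and the normalizations cancel. *)
Lemma block_Lp h : is_block h ->
  (\int[mu]_x (`|h x| `^ p * w x)%:E <= (2 + K)%:E)%E.
Proof.
have r1' := r1; have p0' := p0; have rps' := rps.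
have r10 : 0 < r - 1 by lra.
move=> [c [l [mh l0 sh ih]]].
have W0 := wpos c l0; set W := wcube w c l in W0 ih *.
have ln0 : 0 < l ^+ n by rewrite exprn_gt0.
have mcube := measurable_ccube euc c l.
rewrite -(@integral_supp _ _ _ mu (ccube c l)); last first.
  move=> x nx; have /eqP -> : h x == 0 by apply/negPn/negP => /sh.
  by rewrite normr0 powR0 ?gt_eqF// mul0r.
have key x : `|h x| `^ p * w x <=
    (l ^+ n)^-1 * W `^ (s / p) * `|h x| `^ s + ((l ^+ n)^-1 + (l ^+ n)^-1 * (l ^+ n / W) `^ r * w x `^ r).
  pose u := `|h x| * W `^ p^-1; pose z := w x * (l ^+ n / W).
  have u0 : 0 <= u by rewrite mulr_ge0 ?powR_ge0.
  have lW : 0 < l ^+ n / W by rewrite divr_gt0.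
  have z0 : 0 <= z by rewrite mulr_ge0 ?w0// ltW.
  have up : u `^ p = `|h x| `^ p * W.
    by rewrite /u powRM ?powR_ge0// -powRrM mulVf ?gt_eqF// powRr1// ltW.
  have us : u `^ s = `|h x| `^ s * W `^ (s / p).
    by rewrite /u powRM ?powR_ge0// -powRrM [_^-1 * s]mulrC.
  have zr : z `^ r = w x `^ r * (l ^+ n / W) `^ r by rewrite /z powRM ?w0// ltW.
  have : z * u `^ p <= z `^ r + (1 + u `^ s).
    apply: (le_trans (mulr_le_powRD r1 z0 (powR_ge0 u p))); rewrite lerD2l -powRrM.
    have [u1|/ltW u1] := leP u 1.
      rewrite ler_wpDr ?powR_ge0//.
      have := @powR_le _ u 1 (p * (r / (r - 1))) _ u0 u1; rewrite powR1; apply.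
      by rewrite mulr_ge0 ?divr_ge0//; lra.
    rewrite ler_wpDl//; apply: ler_powR => //.
    by apply: ltW; apply: le_lt_trans rps; rewrite mulrA [p * r]mulrC.
  rewrite up us zr /z => H.
  have := ler_wpM2l (ltW (_ : 0 < (l ^+ n)^-1)) H; rewrite invr_gt0 => /(_ ln0).
  have -> : (l ^+ n)^-1 * (w x * (l ^+ n / W) * (`|h x| `^ p * W)) = `|h x| `^ p * w x.
    by field; rewrite !lt0r_neq0.
  by move/le_trans; apply; rewrite le_eqVlt; apply/orP; left; apply/eqP; ring.
apply: (@le_trans _ _ (\int[mu]_(x in ccube c l) (((l ^+ n)^-1 * W `^ (s / p))%:E * (`|h x| `^ s)%:E +
    ((l ^+ n)^-1%:E + ((l ^+ n)^-1 * (l ^+ n / W) `^ r)%:E * (w x `^ r)%:E)))%E).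
  apply: ge0_le_integral => //.
  - by move=> x _; rewrite lee_fin mulr_ge0 ?powR_ge0.
  - apply: measurable_funTS; apply/measurable_EFinP; apply: measurable_funM => //.
    by apply/measurable_EFinP; exact: measurable_norm_powR.
  - apply: measurable_funTS; apply: emeasurable_funD.
      by apply: emeasurable_funM => //; exact: measurable_norm_powR.
    apply: emeasurable_funD => //; apply: emeasurable_funM => //.
    by apply/measurable_EFinP; exact: measurable_powR_comp.
  - by move=> x _; rewrite -!EFinM -!EFinD lee_fin.
have c10 : 0 <= (l ^+ n)^-1 * W `^ (s / p) by rewrite mulr_ge0 ?powR_ge0// invr_ge0 ltW.
have c20 : 0 <= (l ^+ n)^-1 * (l ^+ n / W) `^ r by rewrite mulr_ge0 ?powR_ge0// invr_ge0 ltW.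
have c30 : 0 <= (l ^+ n)^-1 by rewrite invr_ge0 ltW.
have mh_s : measurable_fun (ccube c l) (fun x => (`|h x| `^ s)%:E).
  by apply: measurable_funTS; exact: measurable_norm_powR.
have mw_r : measurable_fun (ccube c l) (fun x => (w x `^ r)%:E).
  by apply: measurable_funTS; apply/measurable_EFinP; exact: measurable_powR_comp.
rewrite ge0_integralD//; first last.
- by apply: emeasurable_funD => //; exact: emeasurable_funM.
- by move=> x _; rewrite -EFinM -EFinD lee_fin addr_ge0// mulr_ge0// powR_ge0.
- exact: emeasurable_funM.
- by move=> x _; rewrite -EFinM lee_fin mulr_ge0// powR_ge0.
rewrite ge0_integralD//; first last.
- exact: emeasurable_funM.
- by move=> x _; rewrite -EFinM lee_fin mulr_ge0// powR_ge0.
rewrite ge0_integralZl_EFin//.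
rewrite ge0_integralZl_EFin//; last by move=> x _; rewrite lee_fin powR_ge0.
rewrite integral_cst//.
have lc := leb_ccube euc c (ltW l0). rewrite lc.
have ih' : (\int[mu]_(x in ccube c l) (`|h x| `^ s)%:E <= (l ^+ n * W `^ (- (s / p)))%:E)%E.
  rewrite integral_supp// => x nx; have /eqP -> : h x == 0 by apply/negPn/negP => /sh.
  by rewrite normr0 powR0 ?gt_eqF.
apply: (@le_trans _ _ (((l ^+ n)^-1 * W `^ (s / p) * (l ^+ n * W `^ (- (s / p)))) +
  ((l ^+ n)^-1 * l ^+ n + (l ^+ n)^-1 * (l ^+ n / W) `^ r * (K * (l ^+ n * (W / l ^+ n) `^ r))))%:E).
  rewrite EFinD EFinD; apply: leeD.
    by rewrite EFinM; apply: lee_wpmul2l ih'; rewrite lee_fin.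
  apply: leeD; first by rewrite -EFinM.
  by rewrite [leRHS]EFinM; apply: lee_wpmul2l (RH c l0); rewrite lee_fin.
rewrite lee_fin.
have e1 : W `^ (s / p) * W `^ (- (s / p)) = 1.
  by rewrite powRN mulfV// gt_eqF// powR_gt0.
have e2 : (l ^+ n / W) `^ r * (W / l ^+ n) `^ r = 1.
  rewrite -powRM ?divr_ge0 ?ltW// (_ : _ * _ = 1) ?powR1//.
  by field; rewrite !lt0r_neq0.
have -> : (l ^+ n)^-1 * W `^ (s / p) * (l ^+ n * W `^ (- (s / p))) +
  ((l ^+ n)^-1 * l ^+ n + (l ^+ n)^-1 * (l ^+ n / W) `^ r * (K * (l ^+ n * (W / l ^+ n) `^ r))) =
  ((l ^+ n)^-1 * l ^+ n) * ((W `^ (s / p) * W `^ (- (s / p))) + 1 +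
   K * ((l ^+ n / W) `^ r * (W / l ^+ n) `^ r)) by ring.
by rewrite e1 e2 mulVf ?gt_eqF// mul1r mulr1.
Qed.

Lemma pbar_gt0 : 0 < pbar p. Proof. by rewrite /pbar lt_min p0 ltr01. Qed.
Lemma pbar_le1 : pbar p <= 1. Proof. by rewrite /pbar ge_min lexx orbT. Qed.
Lemma pbar_le : pbar p <= p. Proof. by rewrite /pbar ge_min lexx. Qed.

(** Local integrability with exponent p-bar, for which sums of powers are
    subadditive. *)
Lemma block_Lpbar c l h : 0 < l -> is_block h ->
  (\int[mu]_(x in ccube c l) (`|h x| `^ pbar p * w x)%:E <= (wcube w c l + (2 + K))%:E)%E.
Proof.
move=> l0 hb; have mh := is_block_measurable hb.
have mcube := measurable_ccube euc c l.
have mp t : measurable_fun setT (fun x => (`|h x| `^ t * w x)%:E).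
  apply/measurable_EFinP; apply: measurable_funM => //.
  by apply/measurable_EFinP; exact: measurable_norm_powR.
have pw0 t x : (0 <= (`|h x| `^ t * w x)%:E)%E by rewrite lee_fin mulr_ge0 ?powR_ge0.
rewrite EFinD -wcubeE//; apply: le_trans (leeD (lexx _) (block_Lp hb)).
apply: (@le_trans _ _ (\int[mu]_(x in ccube c l) ((w x)%:E + (`|h x| `^ p * w x)%:E))%E).
  apply: ge0_le_integral => //.
  - exact: measurable_funTS.
  - apply: emeasurable_funD; apply: measurable_funTS => //; exact/measurable_EFinP.
  move=> x _; rewrite -EFinD lee_fin -[X in X + _]mul1r -mulrDl ler_wpM2r//.
  have [h1|/ltW h1] := leP `|h x| 1.
    apply: ler_wpDr; first exact: powR_ge0.
    have := @powR_le _ _ 1 (pbar p) (ltW pbar_gt0) (normr_ge0 (h x)) h1.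
    by rewrite powR1.
  by apply: ler_wpDl => //; apply: ler_powR => //; exact: pbar_le.
rewrite ge0_integralD//; first last.
- exact: measurable_funTS.
- by apply: measurable_funTS; exact/measurable_EFinP.
- by move=> x _; rewrite lee_fin.
rewrite leeD2l//; apply: ge0_subset_integral => //.
Qed.

(** k bounds the sum of the p-bar-th powers of the coefficients, not its root, so that
    domination adds up over countable sums (dom_series). *)
Definition dom F (k : \bar R) := exists (nu : nat -> R) (h : nat -> X -> R),
  [/\ forall i, is_block (h i), (coef_sum p nu <= k)%E &
    {ae mu, forall x, (`|F x|%:E <= \sum_(0 <= i <oo) (`|nu i| * `|h i x|)%:E)%E}].

Lemma dom_le F G (k k' : \bar R) : {ae mu, forall x, `|F x| <= `|G x|} ->
  (k <= k')%E -> dom G k -> dom F k'.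
Proof.
move=> FG kk' [nu [h [hb nuk Gh]]]; exists nu, h; split => //; first exact: le_trans kk'.
by apply: filterS2 FG Gh => x Fx; apply: le_trans; rewrite lee_fin.
Qed.

(** Countably many dominating series are merged into one by enumerating pairs. *)
Lemma dom_family (F : nat -> X -> R) (k : nat -> \bar R) :
  (forall j, dom (F j) (k j)) -> exists (nu : nat -> R) (h : nat -> X -> R),
  [/\ forall i, is_block (h i), (coef_sum p nu <= \sum_(0 <= j <oo) k j)%E &
    {ae mu, forall x, (\sum_(0 <= j <oo) `|F j x|%:E <=
      \sum_(0 <= i <oo) (`|nu i| * `|h i x|)%:E)%E}].
Proof.
move=> dF.
have /choice[nh Hnh] : forall j, exists nh : (nat -> R) * (nat -> X -> R),
  [/\ forall i, is_block (nh.2 i), (coef_sum p nh.1 <= k j)%E &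
    {ae mu, forall x, (`|F j x|%:E <= \sum_(0 <= i <oo) (`|nh.1 i| * `|nh.2 i x|)%:E)%E}].
  by move=> j; have [nu [h H]] := dF j; exists (nu, h).
have [e eP] := nat_pairing (R := R).
exists (fun i => (nh (e i).1).1 (e i).2), (fun i => (nh (e i).1).2 (e i).2); split.
- by move=> i; case: (Hnh (e i).1).
- rewrite /coef_sum (eP (fun j i => (`|(nh j).1 i| `^ pbar p)%:E)); last first.
    by move=> j i; rewrite lee_fin powR_ge0.
  apply: lee_nneseries => [j _ _|j _]; last by case: (Hnh j).
  by apply: nneseries_ge0 => i _ _; rewrite lee_fin powR_ge0.
have := ae_foralln (fun j => let: And3 _ _ H := Hnh j in H).
apply: filterS => x Hx; rewrite (eP (fun j i => (`|(nh j).1 i| * `|(nh j).2 i x|)%:E)); last first.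
  by move=> j i; rewrite lee_fin mulr_ge0.
by apply: lee_nneseries => [j _ _|j _]; [rewrite lee_fin|exact: Hx].
Qed.

Lemma dom_series G (F : nat -> X -> R) (k : nat -> \bar R) :
  (forall j, dom (F j) (k j)) ->
  {ae mu, forall x, (`|G x|%:E <= \sum_(0 <= j <oo) `|F j x|%:E)%E} ->
  dom G (\sum_(0 <= j <oo) k j)%E.
Proof.
move=> /dom_family[nu [h [hb nuk Fh]]] GF; exists nu, h; split => //.
by apply: filterS2 GF Fh => x; exact: le_trans.
Qed.

Lemma dom0 : dom (fun=> 0) 0%E.
Proof.
exists (fun=> 0), (fun=> fun=> 0); split; first by move=> _; exact: is_block0.
- rewrite /coef_sum eseries0// => i _ _.
  by rewrite normr0 powR0// gt_eqF// pbar_gt0.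
- apply: aeW => x; rewrite normr0; apply: nneseries_ge0 => i _ _.
  by rewrite lee_fin mulr_ge0.
Qed.

Lemma domD F G (k k' : \bar R) : (0 <= k)%E -> (0 <= k')%E -> dom F k -> dom G k' ->
  dom (fun x => F x + G x) (k + k')%E.
Proof.
move=> k0 k'0 dF dG.
pose H i : X -> R := if i is i'.+1 then if i' is 0%N then G else fun=> 0 else F.
pose kk i : \bar R := if i is i'.+1 then if i' is 0%N then k' else 0%E else k.
have -> : (k + k' = \sum_(0 <= j <oo) kk j)%E.
  rewrite (@nneseries_trunc _ _ 2); [|by case=> [|[]]|by case=> [|[]]].
  by rewrite big_nat_recr//= big_nat1.
apply: (@dom_series _ H); first by case=> [|[|]]//= _; exact: dom0.
apply: aeW => x; rewrite (@nneseries_trunc _ _ 2); last 2 first.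
- by move=> i; rewrite lee_fin.
- by case=> [|[|]]//= i _; rewrite normr0.
by rewrite big_nat_recr//= big_nat1 -EFinD lee_fin ler_normD.
Qed.

Lemma dom_scale F (a : R) (k : \bar R) : dom F k ->
  dom (fun x => a * F x) ((`|a| `^ pbar p)%:E * k)%E.
Proof.
move=> [nu [h [hb nuk Fh]]]; exists (fun i => a * nu i), h; split => //.
  rewrite /coef_sum (eq_eseriesr (g := fun i => ((`|a| `^ pbar p)%:E * (`|nu i| `^ pbar p)%:E)%E)).
    rewrite nneseriesZl; last by move=> i _; rewrite lee_fin powR_ge0.
    by apply: lee_wpmul2l => //; rewrite lee_fin powR_ge0.
  by move=> i _; rewrite normrM powRM.
apply: filterS Fh => x /(lee_wpmul2l (_ : 0 <= `|a|%:E)%E).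
rewrite lee_fin normr_ge0 => /(_ isT).
rewrite -nneseriesZl; last by move=> i _; rewrite lee_fin mulr_ge0.
rewrite -EFinM -normrM => /le_trans; apply; rewrite le_eqVlt; apply/orP; left; apply/eqP.
by apply: eq_eseriesr => i _; rewrite -EFinM normrM mulrA.
Qed.

Lemma dom_scaled_block c l F (k : R) : measurable_fun setT F -> 0 < l -> 0 < k ->
  (forall x, F x != 0 -> ccube c l x) ->
  (\int[mu]_x (`|F x| `^ s)%:E <= (k `^ s * (l ^+ n * wcube w c l `^ (- (s / p))))%:E)%E ->
  dom F (k `^ pbar p)%:E.
Proof.
move=> mF l0 k0 sF iF.
have mFk : measurable_fun setT (fun x => F x / k) by exact: measurable_funM.
exists (fun i => if i is 0%N then k else 0), (fun i => if i is 0%N then fun x => F x / k else fun=> 0).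
split.
- case=> [|_]; last exact: is_block0.
  exists c, l; split; [exact: mFk|exact: l0| |].
    by move=> x; rewrite mulf_eq0 negb_or => /andP[/sF].
  rewrite (_ : (fun x => _) = fun x => ((k `^ s)^-1%:E * (`|F x| `^ s)%:E)%E); last first.
    apply/funext => x; rewrite normrM powRM// normfV (gtr0_norm k0) -EFinM mulrC.
    by rewrite powRV// ltW.
  rewrite ge0_integralZl_EFin//; [|exact: measurable_norm_powR|by rewrite invr_ge0 powR_ge0].
  have ks0 : 0 < (k `^ s)^-1 by rewrite invr_gt0 powR_gt0.
  apply: le_trans (lee_wpmul2l _ iF) _; first by rewrite lee_fin ltW.
  by rewrite -EFinM lee_fin mulKf// gt_eqF// powR_gt0.
- rewrite /coef_sum (@nneseries_trunc _ _ 1); last 2 first.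
  + by move=> i; rewrite lee_fin powR_ge0.
  + by case=> // i _; rewrite normr0 powR0// gt_eqF// pbar_gt0.
  by rewrite big_nat1 gtr0_norm.
apply: aeW => x; rewrite (@nneseries_trunc _ _ 1); last 2 first.
- by move=> i; rewrite lee_fin mulr_ge0.
- by case=> // i _; rewrite normr0 mul0r.
by rewrite big_nat1 lee_fin -normrM mulrC divfK// gt_eqF.
Qed.

Lemma dom_cut F c l k (E : set X) : measurable_fun setT F -> measurable E -> 0 < l -> 0 < k ->
  E `<=` ccube c l ->
  (\int[mu]_(x in E) (`|F x| `^ s)%:E <= (k `^ s * (l ^+ n * wcube w c l `^ (- (s / p))))%:E)%E ->
  dom (fun x => F x * \1_E x) (k `^ pbar p)%:E.
Proof.
move=> mF mE l0 k0 El iF; apply: (dom_scaled_block _ l0 k0).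
- by apply: measurable_funM => //; exact: measurable_indic.
- move=> x; rewrite mulf_eq0 negb_or => /andP[_].
  have [/El Ec _|Ex] := pselect (E x); first exact: Ec.
  have -> : \1_E x = 0 :> R by rewrite indicE memNset.
  by rewrite eqxx.
apply: le_trans iF; rewrite le_eqVlt; apply/orP; left; apply/eqP.
rewrite -(@integral_supp _ _ _ mu E); last first.
  by move=> x Ex; rewrite indicE memNset// mulr0 normr0 powR0// gt_eqF.
by apply: eq_integral => x Ex; rewrite indicE Ex mulr1.
Qed.

Lemma ccube_cover c x : exists k : nat, ccube c k.+1%:R x.
Proof.
pose M := \sum_i `|coord x i - coord c i|.
exists (Num.truncn (2 * M)) => i.
have h1 : `|coord x i - coord c i| <= M by rewrite /M (bigD1 i)//= lerDl sumr_ge0.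
apply: (le_trans h1); rewrite ler_pdivlMr// mulrC.
exact: (ltW (truncnS_gt _)).
Qed.

Lemma measurable_coef_series (nu : nat -> R) (h : nat -> X -> R) (t : R) :
  (forall i, measurable_fun setT (h i)) ->
  measurable_fun setT (fun x => \sum_(0 <= i <oo) ((`|nu i| * `|h i x|) `^ t * w x)%:E)%E.
Proof.
move=> mh; apply: ge0_emeasurable_sum => [i x _ _|i _].
  by rewrite lee_fin mulr_ge0 ?powR_ge0.
apply/measurable_EFinP; apply: measurable_funM => //.
apply: (@measurable_powR_comp _ _ _ (fun x => `|nu i| * `|h i x|)).
by apply: measurable_funM => //; exact: measurableT_comp.
Qed.

Lemma integral_coef_series c l (nu : nat -> R) (h : nat -> X -> R) : 0 < l ->
  (forall i, is_block (h i)) ->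
  (\int[mu]_(x in ccube c l) \sum_(0 <= i <oo) ((`|nu i| * `|h i x|) `^ pbar p * w x)%:E <=
   (wcube w c l + (2 + K))%:E * coef_sum p nu)%E.
Proof.
move=> l0 hb; have mcube := measurable_ccube euc c l.
have mh i := is_block_measurable (hb i).
have mi i : measurable_fun setT (fun x => ((`|nu i| * `|h i x|) `^ pbar p * w x)%:E).
  apply/measurable_EFinP; apply: measurable_funM => //.
  apply: (@measurable_powR_comp _ _ _ (fun x => `|nu i| * `|h i x|)).
  by apply: measurable_funM => //; exact: measurableT_comp.
rewrite integral_nneseries//; first last.
- by move=> i x _; rewrite lee_fin mulr_ge0 ?powR_ge0.
- by move=> i; exact: measurable_funTS.
have W0 := wpos c l0; have K0' := K0.
have C0 : 0 <= wcube w c l + (2 + K) by rewrite !addr_ge0// ltW.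
rewrite -nneseriesZl; last by move=> i _; rewrite lee_fin powR_ge0.
apply: lee_nneseries => [i _ _|i _].
  by apply: integral_ge0 => x _; rewrite lee_fin mulr_ge0 ?powR_ge0.
rewrite (eq_integral (fun x => (`|nu i| `^ pbar p)%:E * (`|h i x| `^ pbar p * w x)%:E))%E; last first.
  by move=> x _; rewrite -EFinM powRM// mulrA.
rewrite ge0_integralZl_EFin ?powR_ge0//; first last.
- apply: measurable_funTS; apply/measurable_EFinP; apply: measurable_funM => //.
  by apply/measurable_EFinP; exact: measurable_norm_powR.
- by move=> x _; rewrite lee_fin mulr_ge0 ?powR_ge0.
rewrite muleC; apply: lee_wpmul2r; first by rewrite lee_fin powR_ge0.
exact: block_Lpbar.
Qed.

Lemma dom_Lpbar c l F (k : \bar R) : 0 < l -> measurable_fun setT F -> dom F k ->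
  (\int[mu]_(x in ccube c l) (`|F x| `^ pbar p * w x)%:E <=
   (wcube w c l + (2 + K))%:E * k)%E.
Proof.
move=> l0 mF [nu [h [hb nuk Fh]]]; have mcube := measurable_ccube euc c l.
have mh i := is_block_measurable (hb i).
have W0 := wpos c l0; have K0' := K0.
have C0 : 0 <= wcube w c l + (2 + K) by rewrite !addr_ge0// ltW.
apply: (@le_trans _ _ ((wcube w c l + (2 + K))%:E * coef_sum p nu)%E); last first.
  by apply: lee_wpmul2l; rewrite ?lee_fin.
apply: le_trans (integral_coef_series c nu l0 hb); apply: ae_ge0_le_integral => //.
- by move=> x _; rewrite lee_fin mulr_ge0 ?powR_ge0.
- apply: measurable_funTS; apply/measurable_EFinP; apply: measurable_funM => //.
  by apply/measurable_EFinP; exact: measurable_norm_powR.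
- by move=> x _; apply: nneseries_ge0 => i _ _; rewrite lee_fin mulr_ge0 ?powR_ge0.
- by apply: measurable_funTS; exact: measurable_coef_series.
apply: filterS Fh => x Fx _.
have a0 i : 0 <= `|nu i| * `|h i x| by rewrite mulr_ge0.
have := nneseries_powR_le pbar_gt0 pbar_le1 a0 (normr_ge0 _) Fx.
move=> /(lee_wpmul2l (_ : 0 <= (w x)%:E)%E); rewrite lee_fin w0 => /(_ isT).
rewrite -nneseriesZl; last by move=> i _; rewrite lee_fin powR_ge0.
rewrite -EFinM mulrC => /le_trans; apply; apply: lee_nneseries => i _ //.
  by rewrite -EFinM lee_fin mulr_ge0 ?powR_ge0.
by rewrite -EFinM mulrC.
Qed.

Lemma coef_series_lty (nu : nat -> R) (h : nat -> X -> R) :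
  (forall i, is_block (h i)) -> (coef_sum p nu < +oo)%E ->
  {ae mu, forall x, (\sum_(0 <= i <oo) (`|nu i| * `|h i x|)%:E < +oo)%E}.
Proof.
move=> hb nuk; have mh i := is_block_measurable (hb i).
have [c0 _] := euclidean_surj euc (fun=> 0).
have H k : {ae mu, forall x, ccube c0 k.+1%:R x ->
    (\sum_(0 <= i <oo) ((`|nu i| * `|h i x|) `^ pbar p * w x)%:E)%E \is a fin_num}.
  have mcube := measurable_ccube euc c0 k.+1%:R.
  apply: (integrable_ae mcube); apply/integrableP; split.
    by apply: measurable_funTS; exact: measurable_coef_series.
  rewrite (eq_integral (fun x => \sum_(0 <= i <oo) ((`|nu i| * `|h i x|) `^ pbar p * w x)%:E)%E); last first.
    move=> x _; rewrite gee0_abs//; apply: nneseries_ge0 => i _ _.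
    by rewrite lee_fin mulr_ge0 ?powR_ge0.
  apply: (le_lt_trans (integral_coef_series c0 nu (ltr0Sn _ _) hb)).
  rewrite lte_mul_pinfty ?lee_fin//.
  by rewrite !addr_ge0// ltW// wpos.
have wp := weight_gt0_ae euc mw w0 wfin wpos r1 K0 RH.
apply: filterS2 wp (ae_foralln H) => x wx Hx.
have [k kx] := ccube_cover c0 x; have := Hx k kx.
have a0 i : 0 <= `|nu i| * `|h i x| by rewrite mulr_ge0.
move=> fin; apply: (nneseries_powR_lty pbar_gt0 pbar_le1 a0).
have -> : (\sum_(0 <= i <oo) ((`|nu i| * `|h i x|) `^ pbar p)%:E =
  (w x)^-1%:E * \sum_(0 <= i <oo) ((`|nu i| * `|h i x|) `^ pbar p * w x)%:E)%E.
  rewrite -nneseriesZl; last by move=> i _; rewrite lee_fin mulr_ge0 ?powR_ge0.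
  by apply: eq_eseriesr => i _; rewrite -EFinM [(w x)^-1 * _]mulrC mulfK// gt_eqF.
by rewrite -(fineK fin) -EFinM ltry.
Qed.

(** F is th times the dominating series, where th is the quotient of F by that series;
    |th| <= 1, so the blocks times th are still blocks. *)
Lemma dom_decomp F (k : \bar R) : (k < +oo)%E -> measurable_fun setT F -> dom F k ->
  exists (nu : nat -> R) (h : nat -> X -> R),
  [/\ forall i, is_block (h i), (coef_sum p nu <= k)%E &
    {ae mu, forall x, series (fun i => nu i * h i x) @ \oo --> F x}].
Proof.
move=> koo mF [nu [h [hb nuk Fh]]]; have mh i := is_block_measurable (hb i).
pose G x := (\sum_(0 <= i <oo) (`|nu i| * `|h i x|)%:E)%E.
have mG : measurable_fun setT G.
  apply: ge0_emeasurable_sum => [i x _ _|i _]; first by rewrite lee_fin mulr_ge0.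
  by apply/measurable_EFinP; apply: measurable_funM => //; exact: measurableT_comp.
(* The clamping makes |th| <= 1 hold everywhere, not only where G dominates F. *)
pose th x := Num.max (-1) (Num.min 1 (F x * (fine (G x)) `^ (-1))).
have mth : measurable_fun setT th.
  apply: measurable_maxr => //; apply: measurable_minr => //.
  apply: measurable_funM => //; apply: measurable_powR_comp.
  exact: (measurableT_comp (fine_measurable measurableT)).
have th1 x : `|th x| <= 1.
  rewrite ler_norml /th le_max lexx/= ge_max; apply/andP; split; first by lra.
  by rewrite ge_min lexx.
exists (fun i => `|nu i|), (fun i x => `|h i x| * th x); split.
- move=> i; apply: (is_block_le (hb i)).
    by apply: measurable_funM => //; exact: measurableT_comp.
  by move=> x; rewrite normrM normr_id ler_piMr.
- apply: le_trans nuk; rewrite /coef_sum le_eqVlt; apply/orP; left; apply/eqP.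
  by apply: eq_eseriesr => i _; rewrite normr_id.
have Glty := coef_series_lty hb (le_lt_trans nuk koo).
apply: filterS2 Fh Glty => x; rewrite -/(G x) => Fx Gx.
have a0 i : 0 <= `|nu i| * `|h i x| by rewrite mulr_ge0.
have G0 : (0 <= G x)%E by apply: nneseries_ge0 => i _ _; rewrite lee_fin.
have Gf : G x \is a fin_num by rewrite ge0_fin_numE.
have FG : `|F x| <= fine (G x) by rewrite -lee_fin fineK.
have g0 : 0 <= fine (G x) by exact: fine_ge0.
have -> : F x = fine (G x) * th x.
  have [g00|gn0] := eqVneq (fine (G x)) 0.
    by rewrite g00 mul0r; apply/eqP; rewrite -normr_le0 -g00.
  have gp : 0 < fine (G x) by rewrite lt_def gn0.
  rewrite /th powR_inv1//.
  have : `|F x * (fine (G x))^-1| <= 1.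
    by rewrite normrM normfV (gtr0_norm gp) ler_pdivrMr// mul1r.
  rewrite ler_norml => /andP[h1 h2].
  by rewrite (min_idPr h2) (max_idPr h1) mulrC divfK.
rewrite (_ : series (fun i => `|nu i| * (`|h i x| * th x)) =
  series (fun i => `|nu i| * `|h i x|) \* cst (th x : R)).
  by apply: cvgM; [exact: nneseries_cvg_fine|exact: cvg_cst].
apply/funext => N /=; rewrite /series/= mulr_suml.
by apply: eq_bigr => i _; rewrite mulrA.
Qed.

End blocks.

(** * The commutator of a single block *)

Section operators.
Context {R : realType} {n : nat} {d : measure_display} {X : measurableType d}
  {mu : {measure set X -> \bar R}} {coord : X -> 'I_n -> R}.
Context (euc : euclidean mu coord).
Local Notation dcube := (@dcube R n d X coord).
Local Notation ccube := (@ccube R n d X coord).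
Local Notation wcube := (@wcube R n d X mu coord).
Implicit Types (u : 'I_n -> R) (l : R) (c : X) (f g h F G : X -> R).
Context (w : X -> R) (mw : measurable_fun setT w) (w0 : forall x, 0 <= w x).
Context (wfin : forall c l, 0 < l -> (\int[mu]_(x in ccube c l) (w x)%:E < +oo)%E)
  (wpos : forall c l, 0 < l -> 0 < wcube w c l).
Context (r K : R) (r1 : 1 < r) (K0 : 0 <= K)
  (RH : forall c l, 0 < l -> (\int[mu]_(x in ccube c l) (w x `^ r)%:E <=
    (K * (l ^+ n * (wcube w c l / l ^+ n) `^ r))%:E)%E).
Context (p s : R) (p0 : 0 < p) (rps : r * p / (r - 1) < s).
Local Notation block_on := (@block_on R n d X mu coord w p s).
Local Notation is_block := (@is_block R n d X mu coord w p s).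
Local Notation dom := (@dom R n d X mu coord w p s).
Let is_block_le := @is_block_le R n d X mu coord w r r1 p s p0 rps.
Let dom_cut := @dom_cut R n d X mu coord euc w r r1 p s p0 rps.

Definition dist (x y : X) : R := Num.sqrt (\sum_(i < n) (coord x i - coord y i) ^+ 2).

Context (s1 : 1 < s).
Context (T : (X -> R) -> (X -> R)) (D : set (X -> R)) (A1 A2 : R) (A10 : 0 <= A1) (A20 : 0 <= A2).
Context (Dlin : forall f g (al be : R), D f -> D g -> D (fun y => al * f y + be * g y)).
Context (Tsub : forall f g, D f -> D g -> {ae mu, forall x, forall al be : R,
  `|T (fun y => al * f y + be * g y) x| <= `|al| * `|T f x| + `|be| * `|T g x|}).
Context (Dblock : forall h, is_block h -> D h).
Context (size : forall h c l, is_block h -> 0 < l -> (forall x, h x != 0 -> ccube c l x) ->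
  {ae mu, forall x, ~ ccube c (2 * Num.sqrt n%:R * l) x ->
    (`|T h x|%:E <= A1%:E * \int[mu]_y `|h y|%:E * (dist x c ^- n)%:E)%E}).
Context (b : X -> R) (B : R) (mb : measurable_fun setT b) (B0 : 0 < B).
Context (ib : forall c l, 0 < l -> (\int[mu]_(x in ccube c l) `|b x|%:E < +oo)%E).
Context (bmo : forall c l, 0 < l ->
  exists a, (\int[mu]_(x in ccube c l) `|b x - a|%:E <= (B * l ^+ n)%:E)%E).

Definition comm f : X -> R := fun x => T (fun y => (b x - b y) * f y) x.

Context (comm_bound : forall h, is_block h -> measurable_fun setT (comm h) /\
  (\int[mu]_x (`|comm h x| `^ s)%:E <= ((A2 * B) `^ s)%:E * \int[mu]_x (`|h x| `^ s)%:E)%E).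
Context (comm_subadd : forall f g, is_block f -> is_block g ->
  {ae mu, forall x, `|comm (fun y => f y + g y) x| <= `|comm f x| + `|comm g x|}).

(** Only countably many null sets may be discarded, hence the detour over rational
    parameters. *)
Lemma rat_ae (P : R -> X -> Prop) : (forall q : rat, {ae mu, forall x, P (ratr q) x}) ->
  {ae mu, forall x, forall q : rat, P (ratr q) x}.
Proof.
move=> h.
have /ae_foralln : forall i : nat, {ae mu, forall x, P (ratr (odflt 0 (unpickle i))) x} by move=> i; exact: h.
by apply: filterS => x Hx q; have := Hx (pickle q); rewrite pickleK.
Qed.

(** In the commutator the constant b x depends on the point x at which the result is
    evaluated, while the size condition holds for a fixed function outside a null set that
    depends on it.  So it is used for q - b with q rational, and q is then sent to b x.
    The bound N on b makes (q - b) h a multiple of a block. *)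
Lemma comm_pointwise c l h beta (N H1 H2 : R) : 0 < l -> is_block h ->
  (forall x, h x != 0 -> ccube c l x) -> (forall x, h x != 0 -> `|b x| <= N) ->
  (\int[mu]_x `|h x|%:E <= H1%:E)%E -> (\int[mu]_x (`|b x - beta| * `|h x|)%:E <= H2%:E)%E ->
  {ae mu, forall x, ~ ccube c (2 * Num.sqrt n%:R * l) x ->
    `|comm h x| <= A1 * dist x c ^- n * (`|b x - beta| * H1 + H2)}.
Proof.
move=> l0 hb sh hN iH1 iH2; have mh := is_block_measurable hb.
have Dh := Dblock hb.
have H10 : 0 <= H1 by rewrite -lee_fin; apply: le_trans iH1; exact: integral_ge0.
pose g (q : R) y := (q - b y) * h y.
have mg q : measurable_fun setT (g q) by apply: measurable_funM => //; exact: measurable_funB.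
(* Dividing by t q brings (q - b) h below h, so the quotient is a block. *)
pose t (q : R) := `|q| + (Num.max N 0) + 1.
have t0 q : 0 < t q by rewrite ltr_wpDl// addr_ge0// le_max lexx orbT.
pose f q y := (t q)^-1 * g q y.
have fb q : is_block (f q).
  apply: (is_block_le hb); first exact: measurable_funM.
  move=> x; have [hx0|hx] := eqVneq (h x) 0; first by rewrite /f /g hx0 !mulr0 normr0.
  rewrite normrM gtr0_norm ?invr_gt0// ler_pdivrMl// normrM ler_wpM2r//.
  apply: (le_trans (ler_normB _ _)); rewrite /t.
  have := hN x hx; have : N <= Num.max N 0 by rewrite le_max lexx.
  lra.
have gE q : g q = (fun y => t q * f q y + 0 * f q y).
  by apply/funext => y; rewrite mul0r addr0 /f mulVKf// gt_eqF.
have Dg q : D (g q).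
  by have := Dlin (t q) 0 (Dblock (fb q)) (Dblock (fb q)); rewrite -gE.
have ig q : (\int[mu]_x `|f q x|%:E <= ((t q)^-1 * (`|q - beta| * H1 + H2))%:E)%E.
  have mN (k : X -> R) : measurable_fun setT k -> measurable_fun setT (fun x => `|k x|%:E).
    by move=> mk; apply/measurable_EFinP; exact: measurableT_comp.
  rewrite (eq_integral (fun x => (t q)^-1%:E * `|g q x|%:E)%E); last first.
    by move=> x _; rewrite /f normrM gtr0_norm ?invr_gt0// EFinM.
  rewrite ge0_integralZl_EFin//; [|exact: mN|by rewrite invr_ge0 ltW].
  rewrite EFinM; apply: lee_wpmul2l; first by rewrite lee_fin invr_ge0 ltW.
  have mbh : measurable_fun setT (fun x => (`|b x - beta| * `|h x|)%:E).
    apply/measurable_EFinP; apply: measurable_funM; apply: measurableT_comp => //.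
    exact: measurable_funB.
  apply: (@le_trans _ _ (\int[mu]_x (`|q - beta|%:E * `|h x|%:E + (`|b x - beta| * `|h x|)%:E))%E).
    apply: ge0_le_integral => //; first exact: mN.
      by apply: emeasurable_funD => //; apply: emeasurable_funM => //; exact: mN.
    move=> x _; rewrite -EFinM -EFinD lee_fin -mulrDl normrM ler_wpM2r//.
    by rewrite [`|b x - _|]distrC (_ : q - b x = (q - beta) + (beta - b x)) ?ler_normD//; lra.
  rewrite ge0_integralD//; last by apply: emeasurable_funM => //; exact: mN.
  rewrite ge0_integralZl_EFin//; last exact: mN.
  rewrite EFinD EFinM; apply: leeD => //; exact: lee_wpmul2l.
have Q1 : {ae mu, forall x, forall q : rat, ~ ccube c (2 * Num.sqrt n%:R * l) x ->
    `|T (g (ratr q)) x| <= A1 * dist x c ^- n * (`|ratr q - beta| * H1 + H2)}.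
  apply: (@rat_ae (fun q x => ~ ccube c (2 * Num.sqrt n%:R * l) x ->
    `|T (g q) x| <= A1 * dist x c ^- n * (`|q - beta| * H1 + H2))) => q.
  have sf x : f (ratr q) x != 0 -> ccube c l x.
    by rewrite /f /g !mulf_eq0 !negb_or => /andP[_ /andP[_ /sh]].
  apply: filterS2 (size (fb (ratr q)) l0 sf) (Tsub (Dblock (fb (ratr q))) (Dblock (fb (ratr q)))) => x sx Tx cx.
  have := Tx (t (ratr q)) 0; rewrite -gE normr0 mul0r addr0 (gtr0_norm (t0 _)) => /le_trans; apply.
  have d0 : 0 <= dist x c ^- n by rewrite invr_ge0 exprn_ge0// sqrtr_ge0.
  have : (`|T (f (ratr q)) x|%:E <=
    A1%:E * ((t (ratr q))^-1 * (`|ratr q - beta| * H1 + H2))%:E * (dist x c ^- n)%:E)%E.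
    apply: (le_trans (sx cx)); apply: lee_wpmul2r; first by rewrite lee_fin.
    by apply: lee_wpmul2l; [rewrite lee_fin|exact: ig].
  rewrite -!EFinM lee_fin => /(ler_wpM2l (ltW (t0 (ratr q)))) => /le_trans; apply.
  rewrite le_eqVlt; apply/orP; left; apply/eqP.
  by move: (dist x c ^- n) => dd; field; exact: lt0r_neq0.
have Q2 : {ae mu, forall x, forall q : rat,
    `|comm h x| <= `|T (g (ratr q)) x| + `|b x - ratr q| * `|T h x|}.
  apply: (@rat_ae (fun q x => `|comm h x| <= `|T (g q) x| + `|b x - q| * `|T h x|)) => q.
  apply: filterS (Tsub (Dg (ratr q)) Dh) => x /(_ 1 (b x - ratr q)).
  rewrite normr1 mul1r => H; apply: le_trans H; rewrite le_eqVlt; apply/orP; left; apply/eqP.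
  congr (`|T _ x|); apply/funext => y; rewrite /g; ring.
apply: filterS2 Q1 Q2 => x q1 q2 cx.
have d0 : 0 <= A1 * dist x c ^- n by rewrite mulr_ge0// invr_ge0 exprn_ge0// sqrtr_ge0.
set Z := A1 * dist x c ^- n * H1 + `|T h x|.
have Z0 : 0 <= Z by rewrite addr_ge0// mulr_ge0.
apply/ler_addgt0Pr => e e0.
have Z1 : 0 < Z + 1 by rewrite ltr_wpDl.
(* Z is the Lipschitz constant, as a function of q, of the bound that q1 and q2 give. *)
have eZ : b x < b x + e / (Z + 1) by rewrite ltrDl divr_gt0.
have [q] := rat_in_itvoo eZ; rewrite in_itv/= => /andP[qb bq].
apply: (le_trans (q2 q)); apply: (le_trans (lerD (q1 q cx) (lexx _))).
have dcube : `|b x - ratr q| <= e / (Z + 1) by rewrite distrC ger0_norm; lra.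
have h1 : `|ratr q - beta| <= `|b x - beta| + `|b x - ratr q|.
  by rewrite [`|b x - ratr q|]distrC [leRHS]addrC; exact: ler_distD.
have h2 : Z * `|b x - ratr q| <= e.
  apply: (le_trans (ler_wpM2l Z0 dcube)); rewrite mulrCA ler_piMr ?(ltW e0)//.
  by rewrite ler_pdivrMr// mul1r lerDl.
have h3 := ler_wpM2l d0 (ler_wpM2r H10 h1).
move: h2 h3; rewrite /Z; lra.
Qed.

Let s0 : 0 < s. Proof. by apply: lt_trans s1. Qed.

Let mba a : measurable_fun setT (fun x => `|b x - a|).
Proof. by apply: measurableT_comp => //; exact: measurable_funB. Qed.

Let mba_h a h : measurable_fun setT h -> measurable_fun setT (fun x => (`|b x - a| * `|h x|)%:E).
Proof.
by move=> mh; apply/measurable_EFinP; apply: measurable_funM => //; exact: measurableT_comp.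
Qed.

Lemma comm_off_bounded c l L (rho : R) (E : set X) h beta (N H1 H2 M : R) :
  0 < l -> is_block h -> (forall x, h x != 0 -> ccube c l x) ->
  (forall x, h x != 0 -> `|b x| <= N) -> measurable E -> 0 < rho ->
  (forall x, E x -> ~ ccube c (2 * Num.sqrt n%:R * l) x /\ rho <= dist x c) ->
  E `<=` ccube c L -> 0 < L ->
  (\int[mu]_x `|h x|%:E <= H1%:E)%E -> (\int[mu]_x (`|b x - beta| * `|h x|)%:E <= H2%:E)%E ->
  (\int[mu]_(x in ccube c L) (`|b x - beta| `^ s)%:E <= M%:E)%E ->
  (\int[mu]_(x in E) (`|comm h x| `^ s)%:E <=
    ((2 * A1 * rho ^- n) `^ s * (H1 `^ s * M + H2 `^ s * L ^+ n))%:E)%E.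
Proof.
move=> l0 hb sh hN mE rho0 Erho EL L0 iH1 iH2 iM.
have [mTh _] := comm_bound hb.
have H10 : 0 <= H1 by rewrite -lee_fin; apply: le_trans iH1; exact: integral_ge0.
have H20 : 0 <= H2.
  by rewrite -lee_fin; apply: le_trans iH2; apply: integral_ge0 => x _; rewrite lee_fin mulr_ge0.
have mcube := measurable_ccube euc c L.
have r0 : 0 <= rho ^- n by rewrite invr_ge0 exprn_ge0// ltW.
have P0 : 0 <= (2 * A1 * rho ^- n) `^ s := powR_ge0 _ _.
have mbs : measurable_fun setT (fun x => (`|b x - beta| `^ s)%:E).
  by apply/measurable_EFinP; exact: (measurable_powR_comp s (mba beta)).
apply: (@le_trans _ _ (\int[mu]_(x in E) (((2 * A1 * rho ^- n) `^ s)%:E *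
    ((H1 `^ s)%:E * (`|b x - beta| `^ s)%:E + (H2 `^ s)%:E)))%E).
  apply: ae_ge0_le_integral => //.
  - by apply: measurable_funTS; exact: measurable_norm_powR.
  - by move=> x _; rewrite -EFinM lee_fin mulr_ge0// addr_ge0 ?mulr_ge0 ?powR_ge0.
  - apply: measurable_funTS; apply: emeasurable_funM => //; apply: emeasurable_funD => //.
    exact: emeasurable_funM.
  apply: filterS (comm_pointwise l0 hb sh hN iH1 iH2) => x px Ex.
  have [nc rx] := Erho x Ex; rewrite -EFinM lee_fin.
  have bH0 : 0 <= `|b x - beta| * H1 by rewrite mulr_ge0.
  have d1 : dist x c ^- n <= rho ^- n.
    rewrite lef_pV2 ?posrE ?exprn_gt0//; last exact: lt_le_trans rx.
    by apply: lerXn2r => //; rewrite nnegrE ?sqrtr_ge0// ltW.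
  have h1 : `|comm h x| <= A1 * rho ^- n * (`|b x - beta| * H1 + H2).
    apply: (le_trans (px nc)); apply: ler_wpM2r; first exact: addr_ge0.
    exact: ler_wpM2l.
  apply: (le_trans (powR_le (ltW s0) (normr_ge0 _) h1)).
  rewrite powRM ?mulr_ge0//; last exact: addr_ge0.
  rewrite -[2 * A1 * _]mulrA [in leRHS]powRM ?mulr_ge0//.
  rewrite mulrC [2 `^ s * _]mulrC -[leRHS]mulrA [leRHS]mulrC; apply: ler_wpM2r; first exact: powR_ge0.
  apply: le_trans (powR_addn_le (ltW s0) bH0 H20) _.
  by rewrite powRM// [H1 `^ s * _]mulrC.
have mbsE : measurable_fun E (fun x => (`|b x - beta| `^ s)%:E) by exact: measurable_funTS.
rewrite ge0_integralZl_EFin//; first last.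
- by apply: emeasurable_funD => //; exact: emeasurable_funM.
- by move=> x _; rewrite -EFinM -EFinD lee_fin addr_ge0 ?mulr_ge0 ?powR_ge0.
rewrite EFinM; apply: lee_wpmul2l; first by rewrite lee_fin.
rewrite ge0_integralD//; first last.
- by move=> x _; rewrite lee_fin powR_ge0.
- exact: emeasurable_funM.
- by move=> x _; rewrite -EFinM lee_fin mulr_ge0 ?powR_ge0.
rewrite ge0_integralZl_EFin ?powR_ge0// integral_cst// EFinD; apply: leeD.
  rewrite EFinM; apply: lee_wpmul2l; first by rewrite lee_fin powR_ge0.
  apply: le_trans iM; apply: ge0_subset_integral => //; exact: measurable_funTS.
rewrite EFinM -(leb_ccube euc c (ltW L0)); apply: lee_wpmul2l; first by rewrite lee_fin powR_ge0.
by apply: le_measure; rewrite ?inE.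
Qed.

Lemma truncation_Ls h (e : R) : is_block h -> 0 < e -> exists N : R,
  (\int[mu]_x (`|h x * \1_[set y | N < `|b y|] x| `^ s)%:E <= e%:E)%E.
Proof.
move=> hb e0; have mh := is_block_measurable hb.
have mnb : measurable_fun setT (fun x => `|b x|) by exact: measurableT_comp.
have mS k : measurable [set y | k%:R < `|b y|].
  rewrite -[X in measurable X]setTI (_ : [set y | _] = (fun x => `|b x|) @^-1` `]k%:R, +oo[%classic).
    exact: mnb.
  by apply/seteqP; split=> y /=; rewrite in_itv/= andbT.
pose f (k : nat) x := (`|h x * \1_[set y | k%:R < `|b y|] x| `^ s)%:E.
have mf k : measurable_fun setT (f k).
  by apply: measurable_norm_powR; apply: measurable_funM.
have [c [l [_ l0 sh ih]]] := hb.
have ihs : mu.-integrable setT (fun x => (`|h x| `^ s)%:E).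
  apply/integrableP; split; first exact: measurable_norm_powR.
  rewrite (eq_integral (fun x => (`|h x| `^ s)%:E)); last first.
    by move=> x _; rewrite gee0_abs// lee_fin powR_ge0.
  by apply: le_lt_trans ih _; rewrite ltry.
have [] := @dominated_convergence _ _ _ mu setT measurableT f (cst 0%E) (fun x => (`|h x| `^ s)%:E) mf.
- exact: measurable_cst.
- apply: aeW => x _; apply: cvg_near_cst; exists (Num.truncn `|b x|).+1 => // k /= kb.
  rewrite /f indicE memNset ?mulr0 ?normr0 ?powR0 ?gt_eqF//=.
  apply/negP; rewrite -leNgt (le_trans (ltW (truncnS_gt _)))// ler_nat//.
- exact: ihs.
- apply: aeW => x k _; rewrite gee0_abs ?lee_fin ?powR_ge0//.
  apply: powR_le => //; first exact: ltW.
  by rewrite normrM ler_piMr// indicE; case: (_ \in _); rewrite ?normr1 ?normr0.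
move=> _ _; rewrite integral_cst// mul0e => /(cvge0_lt e0)[N HN].
by exists N%:R; apply: ltW; exact: (HN N (leqnn N)).
Qed.

(** The boundedness of b on the support of h, assumed in comm_off_bounded, is removed by
    truncation: the part of h where |b| is large is small in L^s, and the commutator bound
    applies to it. *)
Lemma comm_off c l L (rho : R) (E : set X) h beta (H1 H2 M : R) :
  0 < l -> is_block h -> (forall x, h x != 0 -> ccube c l x) ->
  measurable E -> 0 < rho ->
  (forall x, E x -> ~ ccube c (2 * Num.sqrt n%:R * l) x /\ rho <= dist x c) ->
  E `<=` ccube c L -> 0 < L ->
  (\int[mu]_x `|h x|%:E <= H1%:E)%E -> (\int[mu]_x (`|b x - beta| * `|h x|)%:E <= H2%:E)%E ->
  (\int[mu]_(x in ccube c L) (`|b x - beta| `^ s)%:E <= M%:E)%E ->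
  (\int[mu]_(x in E) (`|comm h x| `^ s)%:E <=
    (2 `^ s * ((2 * A1 * rho ^- n) `^ s * (H1 `^ s * M + H2 `^ s * L ^+ n)))%:E)%E.
Proof.
move=> l0 hb sh mE rho0 Erho EL L0 iH1 iH2 iM.
have mh := is_block_measurable hb.
set M0 := _ * (H1 `^ s * M + _).
apply/lee_addgt0Pr => e e0.
pose q := 2 `^ s * ((A2 * B) `^ s + 1).
have q0 : 0 < q by rewrite mulr_gt0 ?powR_gt0// ltr_wpDl// powR_ge0.
have [N HN] := truncation_Ls hb (divr_gt0 e0 q0).
have mnb : measurable_fun setT (fun x => `|b x|) by exact: measurableT_comp.
pose S : set X := [set y | N < `|b y|].
have mS : measurable S.
  rewrite -[X in measurable X]setTI (_ : S = (fun x => `|b x|) @^-1` `]N, +oo[%classic).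
    exact: mnb.
  by apply/seteqP; split=> y /=; rewrite in_itv/= andbT.
pose g x := h x * \1_(~` S) x; pose t x := h x * \1_S x.
have i1 (F : set X) x : `|\1_F x : R| <= 1.
  by rewrite indicE; case: (_ \in _); rewrite ?normr1 ?normr0.
have mg : measurable_fun setT g by apply: measurable_funM => //; apply: measurable_indic; exact: measurableC.
have mt : measurable_fun setT t by apply: measurable_funM.
have gh x : `|g x| <= `|h x| by rewrite normrM ler_piMr.
have th x : `|t x| <= `|h x| by rewrite normrM ler_piMr.
have gb : is_block g by exact: is_block_le hb mg gh.
have tb : is_block t by exact: is_block_le hb mt th.
have hE : h = fun y => g y + t y.
  apply/funext => y; rewrite /g /t -mulrDr !indicE in_setC.
  by case: (y \in S); rewrite /= ?addr0 ?add0r mulr1.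
have sg x : g x != 0 -> ccube c l x by rewrite mulf_eq0 negb_or => /andP[/sh].
have gN x : g x != 0 -> `|b x| <= N.
  rewrite mulf_eq0 negb_or indicE pnatr_eq0 eqb0 negbK => /andP[_].
  by rewrite inE /S/= => /negP; rewrite -leNgt.
have mN (k : X -> R) : measurable_fun setT k -> measurable_fun setT (fun x => `|k x|%:E).
  by move=> mk; apply/measurable_EFinP; exact: measurableT_comp.
have iH1' : (\int[mu]_x `|g x|%:E <= H1%:E)%E.
  by apply: le_trans iH1; apply: ge0_le_integral => //; [exact: mN|exact: mN|move=> x _; rewrite lee_fin].
have iH2' : (\int[mu]_x (`|b x - beta| * `|g x|)%:E <= H2%:E)%E.
  apply: le_trans iH2; apply: ge0_le_integral => //.
  - exact: mba_h.
  - exact: mba_h.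
  - by move=> x _; rewrite lee_fin ler_wpM2l.
have [mTg _] := comm_bound gb; have [mTt iTt] := comm_bound tb; have [mTh _] := comm_bound hb.
have := comm_off_bounded l0 gb sg gN mE rho0 Erho EL L0 iH1' iH2' iM; rewrite -/M0 => off.
have two0 : 0 <= 2 `^ s :> R := powR_ge0 _ _.
have mTgE : measurable_fun E (fun x => (`|comm g x| `^ s)%:E) by apply: measurable_funTS; exact: measurable_norm_powR.
have mTtE : measurable_fun E (fun x => (`|comm t x| `^ s)%:E) by apply: measurable_funTS; exact: measurable_norm_powR.
have pw (k : X -> R) x : (0 <= (`|k x| `^ s)%:E)%E by rewrite lee_fin powR_ge0.
apply: (@le_trans _ _ (\int[mu]_(x in E) ((2 `^ s)%:E * ((`|comm g x| `^ s)%:E + (`|comm t x| `^ s)%:E)))%E).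
  apply: ae_ge0_le_integral => //.
  - by apply: measurable_funTS; exact: measurable_norm_powR.
  - by move=> x _; rewrite -EFinD -EFinM lee_fin mulr_ge0// addr_ge0 ?powR_ge0.
  - by apply: emeasurable_funM => //; exact: emeasurable_funD.
  apply: filterS (comm_subadd gb tb) => x; rewrite -hE => hx _.
  rewrite -EFinD -EFinM lee_fin; apply: le_trans (powR_addn_le (ltW s0) (normr_ge0 _) (normr_ge0 _)).
  by apply: powR_le => //; exact: ltW.
rewrite ge0_integralZl_EFin//; first last.
- exact: emeasurable_funD.
- by move=> x _; rewrite -EFinD lee_fin addr_ge0 ?powR_ge0.
rewrite ge0_integralD//.
have iTtE : (\int[mu]_(x in E) (`|comm t x| `^ s)%:E <= ((A2 * B) `^ s * (e / q))%:E)%E.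
  apply: (@le_trans _ _ (\int[mu]_x (`|comm t x| `^ s)%:E)%E).
    by apply: ge0_subset_integral => //; exact: measurable_norm_powR.
  apply: (le_trans iTt); rewrite EFinM; apply: lee_wpmul2l => //.
  by rewrite lee_fin powR_ge0.
apply: (le_trans (lee_wpmul2l _ (leeD off iTtE))); first by rewrite lee_fin.
rewrite -EFinD -EFinM -EFinD lee_fin mulrDr lerD2l.
have -> : 2 `^ s * ((A2 * B) `^ s * (e / q)) = e * (2 `^ s * (A2 * B) `^ s / q).
  by field; exact: lt0r_neq0.
rewrite ler_piMr ?(ltW e0)// ler_pdivrMr// mul1r /q mulrDr lerDl.
by rewrite mulr1.
Qed.

Context (q KD : R) (n0 : (0 < n)%N) (qp : q < p) (KD0 : 0 < KD).
Context (Dq : forall c l lam, 0 < l -> 1 < lam ->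
  wcube w c (lam * l) <= KD * lam `^ (n%:R * q) * wcube w c l).

Let nrm c l := wcube w c l `^ p^-1.

Let nrm_gt0 c l : 0 < l -> 0 < nrm c l.
Proof. by move=> l0; rewrite powR_gt0// wpos. Qed.

Let wcube_nrm c l : 0 < l -> wcube w c l `^ (- (s / p)) = (nrm c l `^ s)^-1.
Proof. by move=> l0; rewrite powRN -powRrM [s / p]mulrC. Qed.

(** What the normalization of a block may lose from Q to lam Q, by D_q. *)
Lemma nrm_dilate c l lam : 0 < l -> 1 < lam ->
  nrm c (lam * l) <= KD `^ p^-1 * lam `^ (n%:R * q / p) * nrm c l.
Proof.
move=> l0 lam1; have p0' := p0; have lam0 : 0 < lam by lra.
have pV0 : 0 <= p^-1 by rewrite invr_ge0 ltW.
apply: (le_trans (powR_le pV0 _ (Dq c l0 lam1))).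
  by rewrite ltW// wpos// mulr_gt0.
rewrite powRM ?mulr_ge0 ?powR_ge0 ?(ltW KD0) ?(ltW (wpos _ _))//.
by rewrite powRM ?powR_ge0 ?(ltW KD0)// -powRrM.
Qed.

(** Hoelder's inequality in the form of Young's. *)
Lemma block_L1 c l h : block_on c l h -> (\int[mu]_x `|h x|%:E <= (2 * (l ^+ n / nrm c l))%:E)%E.
Proof.
move=> [mh l0 sh ih]; have v0 := nrm_gt0 c l0; set v := nrm c l in v0 *.
have mcube := measurable_ccube euc c l.
have hs0 x : ~ ccube c l x -> h x = 0 by move=> nx; apply/eqP/negPn/negP => /sh.
rewrite -(@integral_supp _ _ _ mu (ccube c l)); last by move=> x /hs0 ->; rewrite normr0.
have mhs : measurable_fun (ccube c l) (fun x => (`|h x| `^ s)%:E).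
  by apply: measurable_funTS; exact: measurable_norm_powR.
have vs0 : 0 < v `^ s by rewrite powR_gt0.
apply: (@le_trans _ _ (\int[mu]_(x in ccube c l) (v^-1%:E * (cst 1%E x + (v `^ s)%:E * (`|h x| `^ s)%:E)))%E).
  apply: ge0_le_integral => //.
  - by apply: measurable_funTS; apply/measurable_EFinP; exact: measurableT_comp.
  - by apply: emeasurable_funM => //; apply: emeasurable_funD => //; exact: emeasurable_funM.
  move=> x _; rewrite -EFinM lee_fin mulrC ler_pdivlMr// -powRM ?(ltW v0)// mulrC.
  have z0 : 0 <= v * `|h x| by rewrite mulr_ge0// ltW.
  have [z1|/ltW z1] := leP (v * `|h x|) 1; first by rewrite ler_wpDr ?powR_ge0.
  by rewrite ler_wpDl// le1r_powR// ltW.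
rewrite ge0_integralZl_EFin ?invr_ge0 ?(ltW v0)//; first last.
- by apply: emeasurable_funD => //; exact: emeasurable_funM.
- by move=> x _; rewrite -EFinM -EFinD lee_fin addr_ge0// mulr_ge0 ?powR_ge0.
rewrite ge0_integralD//; first last.
- exact: emeasurable_funM.
- by move=> x _; rewrite -EFinM lee_fin mulr_ge0 ?powR_ge0.
rewrite integral_cst// mul1e ge0_integralZl_EFin ?powR_ge0//.
rewrite (leb_ccube euc c (ltW l0)) integral_supp; last first.
  by move=> x /hs0 ->; rewrite normr0 powR0// gt_eqF.
apply: (@le_trans _ _ (v^-1%:E * ((l ^+ n)%:E + (v `^ s)%:E * (l ^+ n * (v `^ s)^-1)%:E))%E).
  apply: lee_wpmul2l; first by rewrite lee_fin invr_ge0 ltW.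
  rewrite leeD2l//; apply: lee_wpmul2l; first by rewrite lee_fin ltW.
  by rewrite -wcube_nrm.
rewrite -!EFinM lee_fin le_eqVlt; apply/orP; left; apply/eqP.
by field; rewrite !lt0r_neq0.
Qed.

Let Kb : R := @JN_const R n (s / (s - 1)) + 1.

Lemma block_osc_L1 c l h beta : block_on c l h ->
  (\int[mu]_(x in ccube c l) `|b x - beta|%:E <= (B * l ^+ n)%:E)%E ->
  (\int[mu]_x (`|b x - beta| * `|h x|)%:E <= (Kb * (B * (l ^+ n / nrm c l)))%:E)%E.
Proof.
move=> [mh l0 sh ih] hbeta; have v0 := nrm_gt0 c l0; set v := nrm c l in v0 *.
have s1' := s1; have B0' := B0.
have mcube := measurable_ccube euc c l.
pose s' := s / (s - 1).
have s'1 : 1 < s' by rewrite /s' ltr_pdivlMr; lra.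
have s'0 : 0 < s' by lra.
have hs0 x : ~ ccube c l x -> h x = 0 by move=> nx; apply/eqP/negPn/negP => /sh.
rewrite -(@integral_supp _ _ _ mu (ccube c l)); last by move=> x /hs0 ->; rewrite normr0 mulr0.
have mhs : measurable_fun (ccube c l) (fun x => (`|h x| `^ s)%:E).
  by apply: measurable_funTS; exact: measurable_norm_powR.
have mbs : measurable_fun (ccube c l) (fun x => (`|b x - beta| `^ s')%:E).
  by apply: measurable_funTS; apply/measurable_EFinP; exact: (measurable_powR_comp s' (mba beta)).
have vs0 : 0 < v `^ s by rewrite powR_gt0.
have Bs0 : 0 < B `^ s' by rewrite powR_gt0.
have Bv0 : 0 <= B / v by rewrite divr_ge0 ?ltW.
apply: (@le_trans _ _ (\int[mu]_(x in ccube c l) ((B / v)%:E *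
   ((v `^ s)%:E * (`|h x| `^ s)%:E + (B `^ s')^-1%:E * (`|b x - beta| `^ s')%:E)))%E).
  apply: ge0_le_integral => //.
  - by apply: measurable_funTS; exact: mba_h.
  - by apply: emeasurable_funM => //; apply: emeasurable_funD; exact: emeasurable_funM.
  move=> x _; rewrite -!EFinM lee_fin.
  have := @mulr_le_powRD _ (v * `|h x|) (B^-1 * `|b x - beta|) s s1.
  rewrite !mulr_ge0 ?invr_ge0 ?(ltW v0) ?(ltW B0)// => /(_ isT isT).
  rewrite !powRM ?invr_ge0 ?(ltW v0) ?(ltW B0)// powRV ?(ltW B0)// -/s' => /(ler_wpM2l Bv0).
  apply: le_trans; rewrite le_eqVlt; apply/orP; left; apply/eqP.
  by field; rewrite !lt0r_neq0.
have z0 x : (0 <= (v `^ s)%:E * (`|h x| `^ s)%:E)%E by rewrite -EFinM lee_fin mulr_ge0 ?powR_ge0.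
have z1 x : (0 <= (B `^ s')^-1%:E * (`|b x - beta| `^ s')%:E)%E.
  by rewrite -EFinM lee_fin mulr_ge0 ?powR_ge0// invr_ge0 ltW.
rewrite ge0_integralZl_EFin//; first last.
- by apply: emeasurable_funD; exact: emeasurable_funM.
- by move=> x _; exact: adde_ge0.
rewrite ge0_integralD//; [|exact: emeasurable_funM|exact: emeasurable_funM].
rewrite ge0_integralZl_EFin ?powR_ge0//.
rewrite ge0_integralZl_EFin ?invr_ge0 ?powR_ge0//.
rewrite integral_supp; last by move=> x /hs0 ->; rewrite normr0 powR0// gt_eqF.
apply: (@le_trans _ _ ((B / v)%:E * ((v `^ s)%:E * (l ^+ n * (v `^ s)^-1)%:E +
  (B `^ s')^-1%:E * (@JN_const R n s' * B `^ s' * l ^+ n)%:E))%E).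
  apply: lee_wpmul2l; first by rewrite lee_fin.
  apply: leeD; apply: lee_wpmul2l.
  - by rewrite lee_fin ltW.
  - by rewrite -wcube_nrm.
  - by rewrite lee_fin invr_ge0 ltW.
  - exact: (bmo_Lt euc mb B0 ib bmo s'1 l0 hbeta).
rewrite -!EFinM lee_fin le_eqVlt; apply/orP; left; apply/eqP.
by rewrite /Kb -/s'; field; rewrite !lt0r_neq0.
Qed.

Lemma dist_off_cube c L x : ~ ccube c L x -> L / 2 <= dist x c.
Proof.
move=> /existsNP[i /negP]; rewrite -ltNge => /ltW h; apply: (le_trans h).
rewrite -sqrtr_sqr /dist ler_sqrt; last by rewrite sumr_ge0// => j _; exact: sqr_ge0.
by rewrite (bigD1 i)//= lerDl sumr_ge0// => j _; exact: sqr_ge0.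
Qed.

Lemma sqrt_dim_le : 2 * Num.sqrt n%:R <= 2 ^+ n.+1 :> R.
Proof.
rewrite exprS ler_pM2l//; apply: (@le_trans _ _ n%:R).
  rewrite -[leRHS]ger0_norm// -sqrtr_sqr ler_wsqrtr// -natrX ler_nat.
  by rewrite -{1}[n]expn1 leq_pexp2l.
by rewrite -natrX ler_nat ltnW// ltn_expl.
Qed.

Lemma ccube_subset c l l' : l <= l' -> ccube c l `<=` ccube c l'.
Proof. by move=> ll' x hx i; apply: (le_trans (hx i)); rewrite ler_pM2r// invr_gt0. Qed.

Let kap : R := KD `^ p^-1.
Let dlt : R := n%:R * (1 - q / p).
Let tau : R := 2 `^ (- (dlt / 2)).
Let Gc : R := (2 `^ s * @bmo_const R n s + Kb `^ s) `^ s^-1.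
Let M0 : R := (A2 + 1) * kap * (2 ^+ n.+1) `^ (n%:R * q / p).
Let M1 : R := 4 ^+ n.+1 * (A1 + 1) * (Gc + 1) * kap * (1 - tau)^-1.

Let kap_gt0 : 0 < kap. Proof. by rewrite powR_gt0. Qed.

Let dlt_gt0 : 0 < dlt.
Proof.
have p0' := p0; have qp' := qp.
by rewrite mulr_gt0 ?ltr0n// subr_gt0 ltr_pdivrMr// mul1r.
Qed.

Let tau_gt0 : 0 < tau. Proof. by rewrite powR_gt0. Qed.

Let tau_lt1 : tau < 1.
Proof.
rewrite /tau powRN invf_lt1 ?powR_gt0//.
have d20 : 0 < dlt / 2 by rewrite divr_gt0.
rewrite ltNge; apply/negP => h.
have := @powR_le_inv _ 2 1 _ d20 (ler0n _ _) ler01; rewrite powR1 => /(_ h).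
by rewrite leNgt ltr1n.
Qed.

Let Kb_ge0 : 0 <= Kb. Proof. by rewrite addr_ge0// JN_const_ge0. Qed.

Let Gc_ge0 : 0 <= Gc. Proof. exact: powR_ge0. Qed.

Let M0_gt0 : 0 < M0.
Proof.
have A20' := A20; rewrite !mulr_gt0 ?powR_gt0 ?exprn_gt0//; lra.
Qed.

Let M1_gt0 : 0 < M1.
Proof.
have A10' := A10; have G0 := Gc_ge0; have t1 := tau_lt1.
rewrite !mulr_gt0 ?powR_gt0 ?exprn_gt0 ?invr_gt0 ?kap_gt0//; lra.
Qed.

(** Near the support the commutator bound on L^s suffices, as the number n + 1 of
    doublings does not depend on h. *)
Lemma comm_inner c l h : block_on c l h ->
  (\int[mu]_(x in ccube c (2 ^+ n.+1 * l)) (`|comm h x| `^ s)%:E <=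
   ((M0 * B) `^ s * ((2 ^+ n.+1 * l) ^+ n * wcube w c (2 ^+ n.+1 * l) `^ (- (s / p))))%:E)%E.
Proof.
move=> hb; have [mh l0 sh ih] := hb.
have [mTh iTh] := comm_bound (ex_intro _ c (ex_intro _ l hb)).
have lam1 : 1 < 2 ^+ n.+1 :> R by rewrite exprn_egt1//; lra.
have L0 : 0 < 2 ^+ n.+1 * l by rewrite mulr_gt0// exprn_gt0.
have v0 := nrm_gt0 c l0; have V0 := nrm_gt0 c L0.
apply: (@le_trans _ _ (\int[mu]_x (`|comm h x| `^ s)%:E)%E).
  apply: ge0_subset_integral => //; first exact: (measurable_ccube euc).
  exact: measurable_norm_powR.
apply: (le_trans iTh); rewrite wcube_nrm// in ih; rewrite wcube_nrm//.
apply: (le_trans (lee_wpmul2l _ ih)); first by rewrite lee_fin powR_ge0.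
rewrite -EFinM lee_fin mulrCA [leRHS]mulrCA.
have hd := nrm_dilate c l0 lam1.
have lL : l <= 2 ^+ n.+1 * l by rewrite ler_peMl ?(ltW l0)// ltW.
have M0E : M0 = (A2 + 1) * (kap * (2 ^+ n.+1) `^ (n%:R * q / p)) by rewrite /M0 mulrA.
have M0B : 0 <= M0 * B by exact: mulr_ge0 (ltW M0_gt0) (ltW B0).
have Z0 : 0 <= kap * (2 ^+ n.+1) `^ (n%:R * q / p) by rewrite mulr_ge0 ?powR_ge0.
move: hd lL M0E M0B Z0 L0 V0; rewrite -/kap.
move: (2 ^+ n.+1 * l) (kap * (2 ^+ n.+1) `^ _) M0 => L Z M0' hd lL M0E M0B Z0 L0 V0.
apply: ler_pM; [exact: (exprn_ge0 _ (ltW l0))|by rewrite mulr_ge0 ?invr_ge0 ?powR_ge0| |].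
  by apply: lerXn2r; rewrite ?nnegrE ?(ltW l0) ?(ltW L0).
have A2B0 : 0 <= A2 * B by exact: mulr_ge0 A20 (ltW B0).
apply: (powR_ratio_le (ltW s0) A2B0 M0B v0 V0 hd).
have BZ0 : 0 <= B * Z by exact: mulr_ge0 (ltW B0) Z0.
by rewrite M0E -subr_ge0 (_ : _ - _ = B * Z)//; ring.
Qed.

(** Against the decay 2^(-kn) of the kernel stands the loss 2^((k+1)nq/p) of the
    normalization by D_q; there remains 2^(-k dlt) with dlt = n(1 - q/p) > 0.  One half of
    this decay absorbs the factor k+2 of the oscillation, the other half is tau^(k+1). *)
Lemma outer_const k l : 0 < l ->
  2 * (2 * A1 * (2 ^+ k * l / 2) ^- n) * (l ^+ n * (k.+2%:R * B)) * Gc *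
    (kap * (2 ^+ k.+1) `^ (n%:R * q / p)) <= M1 * B * tau ^+ k.+1.
Proof.
move=> l0; have p0' := p0.
have e1 : (2 ^+ k.+1) `^ (n%:R * q / p) = 2 ^+ n * 2 ^+ (k * n) * (tau ^+ k.+1 * tau ^+ k.+1).
  have g0 : 0 < 2 ^+ k.+1 :> R by rewrite exprn_gt0.
  have tE : tau ^+ k.+1 = (2 ^+ k.+1) `^ (- (dlt / 2)).
    by rewrite -(powR_mulrn k.+1 (ltW tau_gt0)) -(powR_mulrn k.+1 (ler0n R 2)) /tau -!powRrM mulrC.
  rewrite tE -powRD_gt0// -exprD -mulSn exprM -(powR_mulrn n (ltW g0)) -powRD_gt0//.
  congr (_ `^ _); rewrite /dlt; field; exact: lt0r_neq0.
have e2 : (2 ^+ k * l / 2) ^- n * l ^+ n * 2 ^+ (k * n) = 2 ^+ n.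
  rewrite !exprMn exprVn -exprM; field.
  by rewrite !expf_neq0 ?lt0r_neq0.
have -> : 2 * (2 * A1 * (2 ^+ k * l / 2) ^- n) * (l ^+ n * (k.+2%:R * B)) * Gc *
    (kap * (2 ^+ k.+1) `^ (n%:R * q / p)) =
   4 * 2 ^+ n * A1 * Gc * kap * B * ((2 ^+ k * l / 2) ^- n * l ^+ n * 2 ^+ (k * n)) * (k.+2%:R * tau ^+ k.+1) * tau ^+ k.+1.
  rewrite e1; move: (2 ^+ n) (2 ^+ (k * n)) (tau ^+ k.+1) (l ^+ n) (_ ^- n) => z1 z2 z3 z4 z5.
  by ring.
rewrite e2; apply: ler_wpM2r; first by rewrite exprn_ge0// ltW.
have h3 := natr_geometric_le k.+1 (ltW tau_gt0) tau_lt1.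
have c0 : 0 <= 4 * 2 ^+ n * A1 * Gc * kap * B * 2 ^+ n.
  by rewrite !mulr_ge0 ?exprn_ge0// ltW.
apply: (le_trans (ler_wpM2l c0 h3)).
have -> : 4 * 2 ^+ n * A1 * Gc * kap * B * 2 ^+ n * (1 - tau)^-1 =
   (A1 * Gc) * (4 ^+ n.+1 * kap * B * (1 - tau)^-1).
  rewrite exprS (_ : 4 = 2 * 2 :> R); last by ring.
  by rewrite exprMn; ring.
have -> : M1 * B = ((A1 + 1) * (Gc + 1)) * (4 ^+ n.+1 * kap * B * (1 - tau)^-1).
  by rewrite /M1; ring.
apply: ler_wpM2r.
  by rewrite !mulr_ge0 ?exprn_ge0 ?(ltW kap_gt0) ?(ltW B0)// invr_ge0 subr_ge0 ltW.
by apply: ler_pM => //; rewrite lerDl.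
Qed.

Lemma outer_powR (rh a kB Ln : R) : 0 <= rh -> 0 <= a -> B <= kB -> 0 <= Ln ->
  2 `^ s * ((2 * A1 * rh) `^ s * ((2 * a) `^ s * (@bmo_const R n s * kB `^ s * Ln) +
    (Kb * (B * a)) `^ s * Ln)) <= (2 * (2 * A1 * rh) * (a * kB) * Gc) `^ s * Ln.
Proof.
move=> rh0 a0 BkB Ln0; have kB0 : 0 <= kB by exact: le_trans (ltW B0) BkB.
have u0 : 0 <= 2 * A1 * rh by rewrite !mulr_ge0.
have ak0 : 0 <= a * kB by rewrite mulr_ge0.
have Ba0 : 0 <= B * a by exact: mulr_ge0 (ltW B0) a0.
have bc0 := @bmo_const_ge0 R n s.
have two0 : 0 <= 2 :> R by [].
have -> : (2 * (2 * A1 * rh) * (a * kB) * Gc) `^ s =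
    2 `^ s * (2 * A1 * rh) `^ s * ((a * kB) `^ s * (2 `^ s * @bmo_const R n s + Kb `^ s)).
  rewrite (powRM s (mulr_ge0 (mulr_ge0 two0 u0) ak0) Gc_ge0).
  rewrite (powRM s (mulr_ge0 two0 u0) ak0) (powRM s two0 u0) -!mulrA.
  congr (_ * (_ * (_ * _))).
  rewrite /Gc -powRrM mulVf ?gt_eqF// powRr1//.
  exact: addr_ge0 (mulr_ge0 (powR_ge0 _ _) bc0) (powR_ge0 _ _).
have h1 : (2 * a) `^ s * (@bmo_const R n s * kB `^ s * Ln) =
    2 `^ s * @bmo_const R n s * (a * kB) `^ s * Ln.
  by rewrite (powRM s two0 a0) (powRM s a0 kB0); ring.
have h2 : (Kb * (B * a)) `^ s <= Kb `^ s * (a * kB) `^ s.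
  rewrite -(powRM s Kb_ge0 ak0).
  apply: powR_le; [exact: (ltW s0)|exact: mulr_ge0|].
  by apply: ler_wpM2l => //; rewrite mulrC; exact: ler_wpM2l.
have P2 := powR_ge0 2 s; have Pu := powR_ge0 (2 * A1 * rh) s.
rewrite h1; have := ler_wpM2l (mulr_ge0 P2 Pu) (ler_wpM2r Ln0 h2).
move: (2 `^ s) ((2 * A1 * rh) `^ s) ((a * kB) `^ s) ((Kb * (B * a)) `^ s) (Kb `^ s) (@bmo_const R n s).
move=> x1 x2 x3 x4 x5 x6 H.
have -> : x1 * (x2 * (x1 * x6 * x3 * Ln + x4 * Ln)) = x1 * x2 * (x1 * x6 * x3 * Ln) + x1 * x2 * (x4 * Ln) by ring.
have -> : x1 * x2 * (x3 * (x1 * x6 + x5)) * Ln = x1 * x2 * (x1 * x6 * x3 * Ln) + x1 * x2 * (x5 * x3 * Ln) by ring.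
by rewrite lerD2l.
Qed.

(** On the shell the pointwise bound has a term |b - beta| times the L^1 norm of h and a
    constant one with the L^1 norm of (b - beta) h; both are integrated to the power s. *)
Lemma comm_outer c l h k : block_on c l h -> (n.+1 <= k)%N ->
  (\int[mu]_(x in ccube c (2 ^+ k.+1 * l) `\` ccube c (2 ^+ k * l)) (`|comm h x| `^ s)%:E <=
   ((M1 * B * tau ^+ k.+1) `^ s * ((2 ^+ k.+1 * l) ^+ n * wcube w c (2 ^+ k.+1 * l) `^ (- (s / p))))%:E)%E.
Proof.
move=> hb nk; have [mh l0 sh ih] := hb.
have [beta hbeta] := bmo c l0.
have L0 m : 0 < 2 ^+ m * l by rewrite mulr_gt0// exprn_gt0.
have v0 := nrm_gt0 c l0; set v := nrm c l in v0.
have V0 := nrm_gt0 c (L0 k.+1).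
have mE : measurable (ccube c (2 ^+ k.+1 * l) `\` ccube c (2 ^+ k * l)).
  by apply: measurableD; exact: (measurable_ccube euc).
have rho0 : 0 < 2 ^+ k * l / 2 by rewrite divr_gt0.
have Erho x : (ccube c (2 ^+ k.+1 * l) `\` ccube c (2 ^+ k * l)) x ->
    ~ ccube c (2 * Num.sqrt n%:R * l) x /\ 2 ^+ k * l / 2 <= dist x c.
  move=> [_ nx]; split; last exact: dist_off_cube.
  move=> hx; apply: nx; apply: (ccube_subset _ hx); rewrite ler_pM2r//.
  by apply: (le_trans sqrt_dim_le); rewrite ler_weXn2l//; lra.
have := comm_off l0 (ex_intro _ c (ex_intro _ l hb)) sh mE rho0 Erho (@subDsetl _ _ _) (L0 k.+1)
  (block_L1 hb) (block_osc_L1 hb hbeta) (bmo_dilate euc mb B0 ib bmo k.+1 s1 l0 hbeta).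
move=> /le_trans; apply; rewrite lee_fin wcube_nrm//.
rewrite -/v; set a := l ^+ n / v; have a0 : 0 < a := divr_gt0 (exprn_gt0 n l0) v0.
set L := 2 ^+ k.+1 * l; set V := nrm c L.
have Ln0 : 0 <= L ^+ n := exprn_ge0 n (ltW (L0 k.+1)).
set rh := (2 ^+ k * l / 2) ^- n.
have rh0 : 0 < rh by rewrite /rh invr_gt0 (exprn_gt0 n rho0).
have BkB : B <= k.+2%:R * B by rewrite (ler_peMl (ltW B0))// ler1n.
have kB0 : 0 < k.+2%:R * B := lt_le_trans B0 BkB.
pose Y := 2 * (2 * A1 * rh) * (a * (k.+2%:R * B)) * Gc.
apply: (le_trans (outer_powR (ltW rh0) (ltW a0) BkB Ln0)); rewrite -/Y.
rewrite [leRHS]mulrCA [leLHS]mulrC; apply: (ler_wpM2l Ln0).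
pose Yv := 2 * (2 * A1 * rh) * (l ^+ n * (k.+2%:R * B)) * Gc.
have Yv0 : 0 <= Yv.
  have h1 : 0 <= 2 * A1 * rh by exact: mulr_ge0 (mulr_ge0 (ler0n _ _) A10) (ltW rh0).
  have h2 : 0 <= l ^+ n * (k.+2%:R * B) by exact: mulr_ge0 (exprn_ge0 _ (ltW l0)) (ltW kB0).
  exact: mulr_ge0 (mulr_ge0 (mulr_ge0 (ler0n _ _) h1) h2) Gc_ge0.
have -> : Y `^ s = Yv `^ s * (v `^ s)^-1.
  have iv0 : 0 <= v^-1 by rewrite invr_ge0 (ltW v0).
  rewrite -(powRV _ (ltW v0)) -(powRM _ Yv0 iv0); congr (_ `^ _).
  by rewrite /Y /Yv /a -/v; ring.
have lam1 : 1 < 2 ^+ k.+1 :> R by rewrite exprn_egt1//; lra.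
have M1t : 0 <= M1 * B * tau ^+ k.+1.
  exact: mulr_ge0 (mulr_ge0 (ltW M1_gt0) (ltW B0)) (exprn_ge0 _ (ltW tau_gt0)).
exact: (powR_ratio_le (ltW s0) Yv0 M1t v0 V0 (nrm_dilate c l0 lam1) (outer_const k l0)).
Qed.

Lemma powR_exprn (x t : R) j : 0 <= x -> (x ^+ j) `^ t = (x `^ t) ^+ j.
Proof.
move=> x0; rewrite -(powR_mulrn j x0) -(powR_mulrn j (powR_ge0 x t)) -!powRrM.
by rewrite mulrC.
Qed.

Lemma ccube_exhaust c l x : 0 < l -> exists k, ccube c (2 ^+ (n.+1 + k) * l) x.
Proof.
move=> l0; pose M := \sum_i `|coord x i - coord c i|.
exists (Num.truncn (2 * M / l)) => i.
have h1 : `|coord x i - coord c i| <= M by rewrite /M (bigD1 i)//= lerDl sumr_ge0.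
apply: (le_trans h1); rewrite ler_pdivlMr// mulrC -ler_pdivrMr//.
apply: (le_trans (ltW (truncnS_gt _))); rewrite -natrX ler_nat.
apply: (leq_trans (ltn_expl (Num.truncn (2 * M / l)) (ltnSn 1))).
by rewrite leq_pexp2l// leq_addl.
Qed.

Let shell c l k : set X := if k is k'.+1
  then ccube c (2 ^+ (n.+1 + k) * l) `\` ccube c (2 ^+ (n.+1 + k') * l)
  else ccube c (2 ^+ (n.+1 + k) * l).

Let measurable_shell c l k : measurable (shell c l k).
Proof. by case: k => [|k]; [|apply: measurableD]; exact: (measurable_ccube euc). Qed.

Let shell_sub c l k : shell c l k `<=` ccube c (2 ^+ (n.+1 + k) * l).
Proof. by case: k => [|k] x => // -[]. Qed.

Let shell_cover c l x : 0 < l -> exists k, shell c l k x.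
Proof.
move=> /(ccube_exhaust c x) ex.
have ex' : exists k, `[< ccube c (2 ^+ (n.+1 + k) * l) x >] by have [k kx] := ex; exists k; exact/asboolP.
case: (ex_minnP ex') => -[|k] /asboolP kx kmin; first by exists 0%N.
exists k.+1; split=> // kx'; have := kmin k (asboolT kx').
by rewrite ltnn.
Qed.

Let comm_shell c l h k : block_on c l h ->
  (\int[mu]_(x in shell c l k) (`|comm h x| `^ s)%:E <=
   (((M0 + M1) * B * tau ^+ k) `^ s *
     ((2 ^+ (n.+1 + k) * l) ^+ n * wcube w c (2 ^+ (n.+1 + k) * l) `^ (- (s / p))))%:E)%E.
Proof.
move=> hb; have [mh l0 sh ih] := hb.
have L0 : 0 < 2 ^+ (n.+1 + k) * l by rewrite mulr_gt0// exprn_gt0.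
have z0 : 0 <= (2 ^+ (n.+1 + k) * l) ^+ n * wcube w c (2 ^+ (n.+1 + k) * l) `^ (- (s / p)).
  exact: mulr_ge0 (exprn_ge0 _ (ltW L0)) (powR_ge0 _ _).
have t0 m : 0 <= tau ^+ m by exact: exprn_ge0 (ltW tau_gt0).
case: k L0 z0 => [|k] L0 z0; rewrite /shell.
  rewrite addn0 in L0 z0 *; apply: (le_trans (comm_inner hb)).
  rewrite lee_fin expr0 mulr1; apply: (ler_wpM2r z0); apply: powR_le; first exact: ltW.
    exact: mulr_ge0 (ltW M0_gt0) (ltW B0).
  by apply: ler_wpM2r; [exact: (ltW B0)|rewrite lerDl (ltW M1_gt0)].
rewrite addnS in L0 z0 *; apply: (le_trans (comm_outer hb (leq_addr k n.+1))).
rewrite lee_fin; apply: (ler_wpM2r z0); apply: powR_le; first exact: ltW.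
  exact: mulr_ge0 (mulr_ge0 (ltW M1_gt0) (ltW B0)) (t0 _).
apply: ler_pM; [exact: mulr_ge0 (ltW M1_gt0) (ltW B0)|exact: t0| |].
  by apply: ler_wpM2r; [exact: (ltW B0)|rewrite lerDr (ltW M0_gt0)].
apply: ler_wiXn2l; [exact: (ltW tau_gt0)|exact: (ltW tau_lt1)|].
by rewrite ltnS leq_addl.
Qed.

(** The geometric sum over the shells; it does not involve b or B. *)
Definition comm_const : R := (M0 + M1) `^ pbar p / (1 - tau `^ pbar p).

Let tau_pbar_lt1 : tau `^ pbar p < 1.
Proof.
rewrite ltNge; apply/negP => h1; have := powR_le_inv (pbar_gt0 p0) ler01 (ltW tau_gt0).
by rewrite powR1 => /(_ h1); rewrite leNgt tau_lt1.
Qed.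

Lemma comm_const_gt0 : 0 < comm_const.
Proof.
apply: divr_gt0; first exact: (powR_gt0 _ (addr_gt0 M0_gt0 M1_gt0)).
by rewrite subr_gt0 tau_pbar_lt1.
Qed.

(** The shells partition the space, so the commutator is the sum of its restrictions to
    them, each of which is a small multiple of a block. *)
Lemma comm_dom h : is_block h -> dom (comm h) (comm_const * B `^ pbar p)%:E.
Proof.
move=> hb; have [mTh _] := comm_bound hb; have [c [l hbl]] := hb.
have [mh l0 sh ih] := hbl.
have M00 : 0 < M0 + M1 by exact: addr_gt0 M0_gt0 M1_gt0.
have MB0 : 0 < (M0 + M1) * B by exact: mulr_gt0 M00 B0.
have pb0 := pbar_gt0 p0.
pose k j : R := ((M0 + M1) * B * tau ^+ j) `^ pbar p.
have kE j : k j = ((M0 + M1) * B) `^ pbar p * (tau `^ pbar p) ^+ j.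
  by rewrite /k (powRM _ (ltW MB0) (exprn_ge0 _ (ltW tau_gt0))) powR_exprn ?(ltW tau_gt0).
have t1 := tau_pbar_lt1.
have dk j : dom (fun x => comm h x * \1_(shell c l j) x) (k j)%:E.
  have L0 : 0 < 2 ^+ (n.+1 + j) * l by rewrite mulr_gt0// exprn_gt0.
  have kj0 : 0 < (M0 + M1) * B * tau ^+ j by exact: mulr_gt0 MB0 (exprn_gt0 _ tau_gt0).
  exact: (dom_cut mTh (measurable_shell c l j) L0 kj0 (@shell_sub c l j) (comm_shell j hbl)).
have cov : {ae mu, forall x, (`|comm h x|%:E <= \sum_(0 <= j <oo) `|comm h x * \1_(shell c l j) x|%:E)%E}.
  apply: aeW => x; have [j jx] := shell_cover c x l0.
  have e0 i : (0 <= `|comm h x * \1_(shell c l i) x|%:E)%E by rewrite lee_fin.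
  apply: (@le_trans _ _ (\sum_(0 <= i < j.+1) `|comm h x * \1_(shell c l i) x|%:E)%E).
    by rewrite big_nat_recr//= indicE mem_set// mulr1 leeDr// sume_ge0.
  exact: nneseries_lim_ge.
apply: (dom_le (G := comm h) _ _ (dom_series dk cov)); first exact: aeW.
apply: (@le_trans _ _ (((M0 + M1) * B) `^ pbar p / (1 - tau `^ pbar p))%:E).
  rewrite (eq_eseriesr (g := fun j => (((M0 + M1) * B) `^ pbar p * (tau `^ pbar p) ^+ j)%:E)).
    exact: nneseries_geometric_le (powR_ge0 _ _) (powR_ge0 _ _) t1.
  by move=> j _; rewrite kE.
by rewrite lee_fin /comm_const (powRM _ (ltW M00) (ltW B0)) mulrAC.
Qed.
End operators.

(** * Series of images of blocks *)

Section extension.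
Context {R : realType} {n : nat} {d : measure_display} {X : measurableType d}
  {mu : {measure set X -> \bar R}} {coord : X -> 'I_n -> R}.
Context (euc : euclidean mu coord).
Local Notation ccube := (@ccube R n d X coord).
Local Notation wcube := (@wcube R n d X mu coord).
Implicit Types (u : 'I_n -> R) (l : R) (c : X) (f g h F G : X -> R).
Context (w : X -> R) (mw : measurable_fun setT w) (w0 : forall x, 0 <= w x).
Context (wfin : forall c l, 0 < l -> (\int[mu]_(x in ccube c l) (w x)%:E < +oo)%E)
  (wpos : forall c l, 0 < l -> 0 < wcube w c l).
Context (r K : R) (r1 : 1 < r) (K0 : 0 <= K)
  (RH : forall c l, 0 < l -> (\int[mu]_(x in ccube c l) (w x `^ r)%:E <=
    (K * (l ^+ n * (wcube w c l / l ^+ n) `^ r))%:E)%E).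
Context (p s : R) (p0 : 0 < p) (rps : r * p / (r - 1) < s).
Local Notation is_block := (@is_block R n d X mu coord w p s).
Local Notation dom := (@dom R n d X mu coord w p s).
Let is_block_le := @is_block_le R n d X mu coord w r r1 p s p0 rps.
Let is_block0 := @is_block0 R n d X mu coord euc w r r1 p s p0 rps.
Let domD := @domD R n d X mu coord euc w r r1 p s p0 rps.
Let dom_Lpbar := @dom_Lpbar R n d X mu coord euc w mw w0 wfin wpos r K r1 K0 RH p s p0 rps.
Let coef_series_lty := @coef_series_lty R n d X mu coord euc w mw w0 wfin wpos r K r1 K0 RH p s p0 rps.
Let dom_cut := @dom_cut R n d X mu coord euc w r r1 p s p0 rps.
Let dom_family := @dom_family R n d X mu coord w p s.

Context (Op : (X -> R) -> X -> R) (DD : set (X -> R)) (A kappa : R)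
  (A0 : 0 <= A) (kappa0 : 0 <= kappa).
Context (Cbound : forall h, is_block h -> measurable_fun setT (Op h) /\
  (\int[mu]_x (`|Op h x| `^ s)%:E <= A%:E * \int[mu]_x (`|h x| `^ s)%:E)%E).
Context (Cdom : forall h, is_block h -> dom (Op h) kappa%:E).
Context (DDlin : forall f g (al be : R), DD f -> DD g -> DD (fun y => al * f y + be * g y)).
Context (DDblock : forall h, is_block h -> DD h).
Context (Clin : forall f g (al be : R), DD f -> DD g -> {ae mu, forall x,
  Op (fun y => al * f y + be * g y) x = al * Op f x + be * Op g x}).

Let s0 : 0 < s.
Proof.
have r1' := r1; have p0' := p0; apply: lt_trans rps; rewrite divr_gt0 ?mulr_gt0//; lra.
Qed.

Lemma op_sum (lam : nat -> R) (f : nat -> X -> R) N : (forall j, DD (f j)) ->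
  DD (fun y => \sum_(0 <= j < N) lam j * f j y) /\
  {ae mu, forall x, Op (fun y => \sum_(0 <= j < N) lam j * f j y) x =
    \sum_(0 <= j < N) lam j * Op (f j) x}.
Proof.
move=> Df; elim: N => [|N [IH1 IH2]].
  have e : (fun y => \sum_(0 <= j < 0) lam j * f j y) = (fun y => 0 * f 0%N y + 0 * f 0%N y).
    by apply/funext => y; rewrite big_geq// !mul0r addr0.
  rewrite e; split; first exact: DDlin.
  by apply: filterS (Clin 0 0 (Df 0%N) (Df 0%N)) => x ->; rewrite big_geq// !mul0r addr0.
have e : (fun y => \sum_(0 <= j < N.+1) lam j * f j y) =
    (fun y => 1 * (\sum_(0 <= j < N) lam j * f j y) + lam N * f N y).
  by apply/funext => y; rewrite big_nat_recr//= mul1r.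
rewrite e; split; first exact: (DDlin 1 (lam N) IH1).
apply: filterS2 IH2 (Clin 1 (lam N) IH1 (Df N)) => x hx ->.
by rewrite mul1r hx big_nat_recr.
Qed.

(** Multiples of blocks are the compactly supported functions in L^s; unlike blocks they
    form a linear space. *)
Definition mult_block g := exists2 k : R, 0 < k & is_block (fun x => k * g x).

Lemma is_block_mult h : is_block h -> mult_block h.
Proof.
move=> hb; exists 1; first exact: ltr01.
have -> : (fun x => 1 * h x) = h by apply/funext => x; rewrite mul1r.
exact: hb.
Qed.

Lemma mult_block_le f g : mult_block g -> measurable_fun setT f -> (forall x, `|f x| <= `|g x|) -> mult_block f.
Proof.
move=> [k k0 kg] mf fg; exists k; [exact: k0|apply: (is_block_le kg)]; first exact: measurable_funM.
by move=> x; rewrite !normrM ler_wpM2l.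
Qed.

Lemma mult_block_measurable g : mult_block g -> measurable_fun setT g.
Proof.
move=> [k k0 /is_block_measurable mk]; rewrite (_ : g = (fun x => k^-1 * (k * g x))).
  exact: measurable_funM.
by apply/funext => x; rewrite mulKf// gt_eqF.
Qed.

Lemma integral_scale_powR f (k : R) : measurable_fun setT f ->
  (\int[mu]_x (`|k * f x| `^ s)%:E = (`|k| `^ s)%:E * \int[mu]_x (`|f x| `^ s)%:E)%E.
Proof.
move=> mf; rewrite -ge0_integralZl_EFin ?powR_ge0//; last exact: measurable_norm_powR.
by apply: eq_integral => x _; rewrite normrM powRM.
Qed.

Lemma mult_blockI g c l : measurable_fun setT g -> 0 < l -> (forall x, g x != 0 -> ccube c l x) ->
  (\int[mu]_x (`|g x| `^ s)%:E < +oo)%E -> mult_block g.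
Proof.
move=> mg l0 sg ig; set I := (X in (X < _)%E) in ig.
have I0 : (0 <= I)%E by apply: integral_ge0 => x _; rewrite lee_fin powR_ge0.
have If : I \is a fin_num by rewrite ge0_fin_numE.
set Z := l ^+ n * wcube w c l `^ (- (s / p)).
have Z0 : 0 < Z by rewrite mulr_gt0 ?exprn_gt0// powR_gt0// wpos.
have fI0 : 0 <= fine I by exact: fine_ge0.
have I1 : 0 < fine I + 1 by rewrite ltr_wpDl.
pose k := (Z / (fine I + 1)) `^ s^-1.
have k0 : 0 < k by rewrite powR_gt0// divr_gt0.
exists k; [exact: k0|exists c, l; split; [exact: measurable_funM|exact: l0| |]].
  by move=> x; rewrite mulf_eq0 negb_or => /andP[_ /sg].
rewrite integral_scale_powR// -/I -[I]fineK// gtr0_norm// -EFinM lee_fin -/Z.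
rewrite /k -powRrM mulVf ?gt_eqF// powRr1 ?divr_ge0 ?(ltW Z0) ?(ltW I1)//.
by rewrite mulrAC ler_pdivrMr// ler_pM2l// lerDl.
Qed.

Lemma mult_blockE g : mult_block g -> exists c l, [/\ 0 < l, forall x, g x != 0 -> ccube c l x &
  (\int[mu]_x (`|g x| `^ s)%:E < +oo)%E].
Proof.
move=> gb; have mg := mult_block_measurable gb; have [k k0 [c [l [_ l0 sg ig]]]] := gb.
exists c, l; split; [exact: l0|by move=> x gx; apply: sg; rewrite mulf_eq0 negb_or gx gt_eqF|].
move: ig; rewrite integral_scale_powR// gtr0_norm// => ig.
have ks0 : 0 < k `^ s by rewrite powR_gt0.
rewrite ltey; apply/eqP => e; move: ig; rewrite e gt0_muley ?lte_fin//.
Qed.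

(** A cube containing both supports carries the sum. *)
Lemma mult_blockD f g : mult_block f -> mult_block g -> mult_block (fun x => f x + g x).
Proof.
move=> fb gb; have mf := mult_block_measurable fb; have mg := mult_block_measurable gb.
have [c [l [l0 sf iF]]] := mult_blockE fb; have [c' [l' [l'0 sg iG]]] := mult_blockE gb.
pose M := \sum_i `|coord c i - coord c' i|.
have M0 : 0 <= M by rewrite sumr_ge0.
have L0 : 0 < l + l' + 2 * M by rewrite ltr_wpDr ?addr_gt0// mulr_ge0.
apply: (mult_blockI (measurable_funD mf mg) L0).
  move=> x fgx; have [fx|/sf cx] := eqVneq (f x) 0; last first.
    by move=> i; have := cx i; lra.
  move: fgx => /=; rewrite fx add0r => /sg cx i.
  have h1 : `|coord c i - coord c' i| <= M by rewrite /M (bigD1 i)//= lerDl sumr_ge0.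
  have := ler_distD (coord c' i) (coord x i) (coord c i); have := cx i.
  by move: h1; rewrite [`|coord c' i - _|]distrC; lra.
have mfs := measurable_norm_powR s mf; have mgs := measurable_norm_powR s mg.
have two0 : 0 <= 2 `^ s :> R by exact: powR_ge0.
apply: (@le_lt_trans _ _ (\int[mu]_x ((2 `^ s)%:E * ((`|f x| `^ s)%:E + (`|g x| `^ s)%:E)))%E).
  apply: ge0_le_integral => //.
  - by apply: measurable_norm_powR; exact: measurable_funD.
  - by apply: emeasurable_funM => //; exact: emeasurable_funD.
  move=> x _; rewrite -EFinD -EFinM lee_fin.
  apply: (le_trans (powR_le (ltW s0) (normr_ge0 _) (ler_normD _ _))).
  exact: powR_addn_le (ltW s0) (normr_ge0 _) (normr_ge0 _).
rewrite ge0_integralZl_EFin//; [|by move=> x _; rewrite -EFinD lee_fin addr_ge0 ?powR_ge0|exact: emeasurable_funD].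
rewrite ge0_integralD//.
exact: (lte_mul_pinfty (powR_ge0 _ _ : (0 <= (2 `^ s)%:E)%E) isT (lte_add_pinfty iF iG)).
Qed.

Lemma mult_blockZ f k : mult_block f -> mult_block (fun x => k * f x).
Proof.
move=> fb; have mf := mult_block_measurable fb; have [c [l [l0 sf iF]]] := mult_blockE fb.
apply: (mult_blockI (_ : measurable_fun setT (fun x => k * f x)) l0); first exact: measurable_funM.
  by move=> x; rewrite mulf_eq0 negb_or => /andP[_ fx]; exact: (sf x fx).
rewrite (integral_scale_powR k mf).
exact: (lte_mul_pinfty (powR_ge0 _ _ : (0 <= (`|k| `^ s)%:E)%E) isT iF).
Qed.

Lemma mult_block_sum (lam : nat -> R) (f : nat -> X -> R) N : (forall j, mult_block (f j)) ->
  mult_block (fun y => \sum_(0 <= j < N) lam j * f j y).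
Proof.
move=> fb; elim: N => [|N IH].
  have -> : (fun y => \sum_(0 <= j < 0) lam j * f j y) = (fun=> 0).
    by apply/funext => y; rewrite big_geq.
  exact: is_block_mult is_block0.
have -> : (fun y => \sum_(0 <= j < N.+1) lam j * f j y) =
    (fun y => (\sum_(0 <= j < N) lam j * f j y) + lam N * f N y).
  by apply/funext => y; rewrite big_nat_recr.
exact: mult_blockD IH (mult_blockZ _ (fb N)).
Qed.

Lemma mult_block_DD g : mult_block g -> DD g.
Proof.
move=> [k k0 /DDblock kg]; have := DDlin k^-1 0 kg kg.
have -> : (fun y => k^-1 * (k * g y) + 0 * (k * g y)) = g.
  by apply/funext => x; rewrite mul0r addr0 mulKf// gt_eqF.
exact.
Qed.

Lemma op_mult_block g : mult_block g -> exists k, [/\ 0 < k, is_block (fun x => k * g x) &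
  {ae mu, forall x, Op g x = k^-1 * Op (fun x => k * g x) x}].
Proof.
move=> [k k0 kg]; exists k; split; [exact: k0|exact: kg|].
have := Clin k^-1 0 (DDblock kg) (DDblock kg).
have -> : (fun y => k^-1 * (k * g y) + 0 * (k * g y)) = g.
  by apply/funext => x; rewrite mul0r addr0 mulKf// gt_eqF.
by apply: filterS => x ->; rewrite mul0r addr0.
Qed.

(** A function small in L^s has an image which is small in L^s, and on a fixed cube this
    is the same as being a small multiple of a block. *)
Lemma dom_op_small g (e : R) c L : mult_block g -> 0 < e -> 0 < L ->
  (A%:E * \int[mu]_x (`|g x| `^ s)%:E <=
    ((e `^ (pbar p)^-1) `^ s * (L ^+ n * wcube w c L `^ (- (s / p))))%:E)%E ->
  dom (fun x => Op g x * \1_(ccube c L) x) e%:E.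
Proof.
move=> gb e0 L0 ig; have mg := mult_block_measurable gb.
have [k [k0 kg Cg]] := op_mult_block gb; have [mC iC] := Cbound kg.
have mcube := measurable_ccube euc c L.
have ek : (e `^ (pbar p)^-1) `^ pbar p = e.
  by rewrite -powRrM mulVf ?gt_eqF ?pbar_gt0// powRr1// ltW.
have mkC : measurable_fun setT (fun x => k^-1 * Op (fun x => k * g x) x) by exact: measurable_funM.
have ek0 : 0 < e `^ (pbar p)^-1 by rewrite powR_gt0.
have /(dom_cut mkC mcube L0 ek0 (@subset_refl _ _)) : (\int[mu]_(x in ccube c L) (`|k^-1 * Op (fun x => k * g x) x| `^ s)%:E <=
    ((e `^ (pbar p)^-1) `^ s * (L ^+ n * wcube w c L `^ (- (s / p))))%:E)%E.
  apply: le_trans ig.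
  apply: (@le_trans _ _ (\int[mu]_x (`|k^-1 * Op (fun x => k * g x) x| `^ s)%:E)%E).
    apply: ge0_subset_integral => //; exact: measurable_norm_powR.
  rewrite (integral_scale_powR _ mC).
  apply: (@le_trans _ _ ((`|k^-1| `^ s)%:E * (A%:E * \int[mu]_x (`|k * g x| `^ s)%:E))%E).
    by apply: lee_wpmul2l => //; rewrite lee_fin powR_ge0.
  rewrite muleCA; apply: lee_wpmul2l; first by rewrite lee_fin.
  rewrite -integral_scale_powR; last exact: measurable_funM.
  rewrite le_eqVlt; apply/orP; left; apply/eqP; apply: eq_integral => x _.
  by rewrite mulKf// gt_eqF.
rewrite ek; apply: dom_le; last exact: lexx.
by apply: filterS Cg => x ->.
Qed.

(** The key to the independence of the decomposition.  On the set E N where |g| is at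
    most twice the N-th partial sum of the dominating series, g is a combination of N
    blocks, so linearity gives a bound by k up to constants, independent of N.  The rest
    of g tends to zero in L^s and is disposed of by dom_op_small.  The factor 2 makes
    every point belong to E N for N large, also where |g| equals the whole series. *)
Lemma dom_op_local g (k : \bar R) (e : R) c L : mult_block g -> dom g k -> 0 < e -> 0 < L ->
  dom (fun x => Op g x * \1_(ccube c L) x) ((2 `^ pbar p * kappa)%:E * k + e%:E)%E.
Proof.
move=> gb [nu [a [ab nuk ga]]] e0 L0; have mg := mult_block_measurable gb.
have ma j := is_block_measurable (ab j).
pose H N x := \sum_(0 <= j < N) (2 * `|nu j|) * `|a j x|.
have mH N : measurable_fun setT (H N).
  apply: measurable_sum => j; apply: measurable_funM => //; exact: measurableT_comp.
have H0 N x : 0 <= H N x by apply: sumr_ge0 => j _; rewrite !mulr_ge0.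
pose E N := [set x | `|g x| <= H N x].
have mE N : measurable (E N).
  have mgH : measurable_fun setT (fun x => `|g x| - H N x).
    by apply: measurable_funB => //; exact: measurableT_comp.
  rewrite -[E N]setTI (_ : E N = (fun x => `|g x| - H N x) @^-1` `]-oo, 0]%classic).
    exact: mgH.
  by apply/seteqP; split=> x /=; rewrite in_itv/= subr_le0.
have m1 N : measurable_fun setT (\1_(E N) : X -> R) by exact: measurable_indic.
have m1C N : measurable_fun setT (\1_(~` E N) : X -> R) by apply: measurable_indic; exact: measurableC.
have E1 N x : `|\1_(E N) x : R| <= 1 by rewrite indicE; case: (_ \in _); rewrite ?normr1 ?normr0.
have E1C N x : `|\1_(~` E N) x : R| <= 1 by rewrite indicE; case: (_ \in _); rewrite ?normr1 ?normr0.
pose g' N x := g x * \1_(~` E N) x.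
have mg' N : measurable_fun setT (g' N) by exact: measurable_funM.
have g'g N x : `|g' N x| <= `|g x| by rewrite normrM ler_piMr.
have g'b N : mult_block (g' N) by exact: mult_block_le gb (mg' N) (g'g N).
(* By dominated convergence the rest g' N tends to zero in L^s. *)
have [c' [l' [_ _ igs]]] := mult_blockE gb.
have igs' : mu.-integrable setT (fun x => (`|g x| `^ s)%:E).
  apply/integrableP; split; first exact: measurable_norm_powR.
  rewrite (eq_integral (fun x => (`|g x| `^ s)%:E))//.
  by move=> x _; rewrite gee0_abs// lee_fin powR_ge0.
have tail : {ae mu, forall x, setT x -> (fun N => (`|g' N x| `^ s)%:E) @ \oo --> 0%E}.
  apply: filterS ga => x gx _.
  suff [N0 HN0] : exists N0, `|g x| <= H N0 x.
    apply: cvg_near_cst; exists N0 => // N /= N0N.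
    suff EN : E N x by rewrite /g' indicE memNset ?mulr0 ?normr0 ?powR0 ?gt_eqF// => /(_ EN).
    rewrite /E /=; apply: (le_trans HN0); rewrite /H (big_cat_nat (leq0n N0) N0N)/= lerDl.
    by apply: sumr_ge0 => j _; rewrite !mulr_ge0.
  have [g0|gn0] := eqVneq (g x) 0; first by exists 0%N; rewrite g0 normr0.
  apply/not_existsP => HN.
  have : (\sum_(0 <= i <oo) (`|nu i| * `|a i x|)%:E <= (`|g x| / 2)%:E)%E.
    apply: nneseries_le_bound => [i|N]; first by rewrite lee_fin mulr_ge0.
    rewrite sumEFin lee_fin ler_pdivlMr// mulr_suml.
    have /negP := HN N; rewrite -ltNge => /ltW; apply: le_trans.
    by rewrite le_eqVlt; apply/orP; left; apply/eqP; apply: eq_bigr => i _; ring.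
  move=> /(le_trans gx); rewrite lee_fin ler_pdivlMr// -subr_le0.
  have : 0 < `|g x| by rewrite normr_gt0.
  lra.
have [|_ _] := @dominated_convergence _ _ _ mu setT measurableT (fun N x => (`|g' N x| `^ s)%:E)
  (cst 0%E) (fun x => (`|g x| `^ s)%:E) (fun N => measurable_norm_powR s (mg' N)) (measurable_cst _) tail igs'.
  apply: aeW => x N _; rewrite gee0_abs ?lee_fin ?powR_ge0//.
  by apply: powR_le => //; exact: ltW.
rewrite integral_cst// mul0e => cv.
pose Z := (e `^ (pbar p)^-1) `^ s * (L ^+ n * wcube w c L `^ (- (s / p))).
have Z0 : 0 < Z by rewrite !mulr_gt0 ?powR_gt0 ?exprn_gt0 ?wpos// powR_gt0.
have A1 : 0 < A + 1 by have A0' := A0; lra.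
have [N /(_ N (leqnn N))/ltW HN] := cvge0_lt (divr_gt0 Z0 A1) cv.
have small : dom (fun x => Op (g' N) x * \1_(ccube c L) x) e%:E.
  apply: (dom_op_small (g'b N) e0 L0); rewrite -/Z.
  apply: (@le_trans _ _ (A%:E * (Z / (A + 1))%:E)%E); first by apply: lee_wpmul2l.
  by rewrite -EFinM lee_fin mulrCA ler_piMr ?(ltW Z0)// ler_pdivrMr// mul1r lerDl.
(* The truncation is H N times th, a sum of N multiples of blocks. *)
pose th x := g x * \1_(E N) x * (H N x) `^ (-1).
have mth : measurable_fun setT th.
  apply: measurable_funM; first exact: measurable_funM.
  exact: measurable_powR_comp.
have th1 x : `|th x| <= 1.
  rewrite /th powR_inv1// !normrM normfV (ger0_norm (H0 _ _)) indicE.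
  case: (pselect (E N x)) => [EN|EN]; last by rewrite memNset// normr0 mulr0 mul0r ler01.
  rewrite mem_set// normr1 mulr1; have [->|HN0] := eqVneq (H N x) 0; first by rewrite invr0 mulr0 ler01.
  rewrite ler_pdivrMr ?mul1r; [exact: EN|by rewrite lt_def HN0 H0].
pose f j x := `|a j x| * th x.
have fb j : is_block (f j).
  apply: (is_block_le (ab j)); first by apply: measurable_funM => //; exact: measurableT_comp.
  by move=> x; rewrite normrM normr_id ler_piMr.
have gE x : g x * \1_(E N) x = \sum_(0 <= j < N) (2 * `|nu j|) * f j x.
  rewrite (eq_bigr (fun j => (2 * `|nu j|) * `|a j x| * th x)); last by move=> j _; rewrite mulrA.
  rewrite -mulr_suml -/(H N x) /th powR_inv1//.
  have [HN0|HN0] := eqVneq (H N x) 0; last by rewrite [RHS]mulrC divfK.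
  rewrite HN0 mul0r indicE; case: (pselect (E N x)) => [EN|EN]; last by rewrite memNset// mulr0.
  by move: EN; rewrite /E /= HN0 normr_le0 => /eqP ->; rewrite mul0r.
have [DS CS] := op_sum (fun j => 2 * `|nu j|) N (fun j => DDblock (fb j)).
have dj j : dom (fun x => (2 * `|nu j|) * Op (f j) x) ((2 `^ pbar p * kappa)%:E * (`|nu j| `^ pbar p)%:E)%E.
  have := dom_scale (2 * `|nu j|) (Cdom (fb j)).
  rewrite (ger0_norm (_ : 0 <= 2 * `|nu j|)) ?mulr_ge0// powRM// -EFinM.
  by rewrite [2 `^ _ * _ * kappa]mulrAC.
have finite : dom (Op (fun y => \sum_(0 <= j < N) (2 * `|nu j|) * f j y)) ((2 `^ pbar p * kappa)%:E * k)%E.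
  apply: (@dom_le _ _ _ _ _ _ _ _ _ (Op (fun y => \sum_(0 <= j < N) (2 * `|nu j|) * f j y)) _ _ _ _ _ (dom_series dj _)).
  - exact: aeW.
  - rewrite nneseriesZl; last by move=> i _; rewrite lee_fin powR_ge0.
    by apply: lee_wpmul2l => //; rewrite lee_fin mulr_ge0 ?powR_ge0.
  apply: filterS CS => x ->.
  apply: (@le_trans _ _ (\sum_(0 <= j < N) `|2 * `|nu j| * Op (f j) x|%:E)%E).
    by rewrite sumEFin lee_fin ler_norm_sum.
  by apply: nneseries_lim_ge => i _ _; rewrite lee_fin.
have k0 : (0 <= (2 `^ pbar p * kappa)%:E * k)%E.
  apply: mule_ge0; first by rewrite lee_fin mulr_ge0 ?powR_ge0.
  by apply: le_trans nuk; apply: nneseries_ge0 => i _ _; rewrite lee_fin powR_ge0.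
have e0' : (0 <= e%:E)%E by rewrite lee_fin ltW.
apply: dom_le (domD k0 e0' finite small); last exact: lexx.
have := Clin 1 1 DS (mult_block_DD (g'b N)).
have -> : (fun y => 1 * (\sum_(0 <= j < N) 2 * `|nu j| * f j y) + 1 * g' N y) = g.
  apply/funext => y; rewrite -gE /g' !mul1r -mulrDr !indicE.
  case: (pselect (E N y)) => [EN|EN].
    by rewrite mem_set// memNset ?addr0 ?mulr1// => /(_ EN).
  by rewrite memNset// mem_set// add0r mulr1.
apply: filterS => x ->; rewrite !mul1r.
rewrite indicE; case: (_ \in _); rewrite ?mulr1// !mulr0 normr0; exact: normr_ge0.
Qed.

(** The triangle inequality for the tail of a series. *)
Lemma series_tail_le (u : nat -> R) (L : R) N : series u @ \oo --> L ->
  (`|L - \sum_(0 <= j < N) u j|%:E <= \sum_(0 <= j <oo) `|u (j + N)%N|%:E)%E.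
Proof.
move=> uL; set Z := (X in (_ <= X)%E).
have Z0 : (0 <= Z)%E by apply: nneseries_ge0 => j _ _; rewrite lee_fin.
have [->|] := eqVneq Z +oo%E; first exact: leey.
rewrite -ltey => Zoo; have Zf : Z \is a fin_num by rewrite ge0_fin_numE.
rewrite -[Z]fineK// lee_fin; apply/ler_addgt0Pr => e e0.
have /cvgrPdist_lt/(_ e e0)[M _ HM] := uL.
have := HM (M + N)%N (leq_addr _ _); rewrite /series/= => Le.
have h : `|\sum_(0 <= j < M + N) u j - \sum_(0 <= j < N) u j| <= fine Z.
  rewrite (big_cat_nat (leq0n N) (leq_addl M N))/= addrAC subrr add0r.
  rewrite -{1}[N]add0n big_addn addnK; apply: (le_trans (ler_norm_sum _ _ _)).
  rewrite -lee_fin fineK// -sumEFin; apply: nneseries_lim_ge => j _ _.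
  by rewrite lee_fin.
rewrite [leRHS]addrC; apply: (le_trans (ler_distD (\sum_(0 <= j < M + N) u j) _ _)).
exact: lerD (ltW Le) h.
Qed.

Lemma series_abs_cvg (u : nat -> R) : (\sum_(0 <= j <oo) `|u j|%:E < +oo)%E -> cvgn (series u).
Proof.
move=> uoo; apply: normed_cvg.
have := nneseries_cvg_fine (fun j => normr_ge0 (u j)) uoo.
exact: cvgP.
Qed.

Definition coef_tail (lam : nat -> R) N := coef_sum p (fun j => lam (j + N)%N).

Lemma coef_tail_small lam (e : R) : (coef_sum p lam < +oo)%E -> 0 < e ->
  exists N0, forall N, (N0 <= N)%N -> (coef_tail lam N <= e%:E)%E.
Proof.
move=> lamoo e0.
have l0 k : xpredT k -> (0 <= (`|lam k| `^ pbar p)%:E)%E by rewrite lee_fin powR_ge0.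
have [N0 H] := cvge0_lt e0 (nneseries_tail_cvg lamoo l0).
exists N0 => N /H/ltW; rewrite -nneseries_addn// => i; exact: l0.
Qed.

Lemma coef_tail_ge0 lam N : (0 <= coef_tail lam N)%E.
Proof. by apply: nneseries_ge0 => j _ _; rewrite lee_fin powR_ge0. Qed.

(** The upper limit is measurable without knowing where the series converges. *)
Definition op_series (lam : nat -> R) (a : nat -> X -> R) x : R :=
  fine (limn_esup (fun N => (\sum_(0 <= j < N) lam j * Op (a j) x)%:E)).

Section decomposition.
Context (lam : nat -> R) (a : nat -> X -> R) (ab : forall j, is_block (a j))
  (lamoo : (coef_sum p lam < +oo)%E).

Let mCa j : measurable_fun setT (Op (a j)).
Proof. by case: (Cbound (ab j)). Qed.

Lemma dom_op_term j : dom (fun x => lam j * Op (a j) x) (kappa%:E * (`|lam j| `^ pbar p)%:E)%E.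
Proof. by rewrite muleC; exact: dom_scale (Cdom (ab j)). Qed.

Lemma measurable_op_series : measurable_fun setT (op_series lam a).
Proof.
apply: (measurableT_comp (fine_measurable measurableT)).
apply: measurable_fun_limn_esup => N; apply/measurable_EFinP.
by apply: measurable_sum => j; exact: measurable_funM.
Qed.

Lemma op_series_cvg :
  {ae mu, forall x, series (fun j => lam j * Op (a j) x) @ \oo --> op_series lam a x}.
Proof.
have [nu [h [hb nuk Fh]]] := dom_family dom_op_term.
have nuoo : (coef_sum p nu < +oo)%E.
  apply: (le_lt_trans nuk); rewrite nneseriesZl; last by move=> i _; rewrite lee_fin powR_ge0.
  exact: (lte_mul_pinfty (kappa0 : (0 <= kappa%:E)%E) isT lamoo).
apply: filterS2 Fh (coef_series_lty hb nuoo) => x Fx hx.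
have /series_abs_cvg/cvg_ex[L uL] := le_lt_trans Fx hx.
suff -> : op_series lam a x = L by [].
have EL : (fun N => (\sum_(0 <= j < N) lam j * Op (a j) x)%:E) @ \oo --> L%:E.
  by apply: cvg_EFin uL; exact: nearW.
by rewrite /op_series (cvg_limn_einf_sup EL).2.
Qed.

Lemma dom_op_tail N : dom (fun x => op_series lam a x - \sum_(0 <= j < N) lam j * Op (a j) x)
  (kappa%:E * coef_tail lam N)%E.
Proof.
rewrite -nneseriesZl; last by move=> i _; rewrite lee_fin powR_ge0.
apply: (dom_series (fun j => dom_op_term (j + N)%N)).
by apply: filterS op_series_cvg => x; exact: series_tail_le.
Qed.

End decomposition.

(** A function dominated with arbitrarily small constants on each cube has a vanishing
    integral of |F|^p-bar w there. *)
Lemma dom_null F : measurable_fun setT F ->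
  (forall c L e, 0 < L -> 0 < e -> dom (fun x => F x * \1_(ccube c L) x) e%:E) ->
  {ae mu, forall x, F x = 0}.
Proof.
move=> mF dF; have [c0 _] := euclidean_surj euc (fun=> 0).
have pb0 := pbar_gt0 p0.
have H k : {ae mu, forall x, ccube c0 k.+1%:R x -> (`|F x| `^ pbar p * w x)%:E = 0%E}.
  have L0 : 0 < k.+1%:R :> R by exact: ltr0Sn.
  have mcube := measurable_ccube euc c0 k.+1%:R.
  have mG : measurable_fun (ccube c0 k.+1%:R) (fun x => (`|F x| `^ pbar p * w x)%:E).
    apply: measurable_funTS; apply/measurable_EFinP; apply: measurable_funM => //.
    by apply/measurable_EFinP; exact: measurable_norm_powR.
  have z0 x : (0 <= (`|F x| `^ pbar p * w x)%:E)%E by rewrite lee_fin mulr_ge0 ?powR_ge0.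
  have /(ae_eq_integral_abs mu mcube mG) : (\int[mu]_(x in ccube c0 k.+1%:R) `|(`|F x| `^ pbar p * w x)%:E| = 0)%E.
    rewrite (eq_integral (fun x => (`|F x| `^ pbar p * w x)%:E)); last by move=> x _; rewrite gee0_abs.
    apply/eqP; rewrite eq_le; apply/andP; split; last exact: integral_ge0.
    have W0 := wpos c0 L0; have K0' := K0.
    have C0 : 0 < wcube w c0 k.+1%:R + (2 + K) by lra.
    apply/lee_addgt0Pr => e e0; rewrite add0e.
    have mF1 : measurable_fun setT (fun x => F x * \1_(ccube c0 k.+1%:R) x).
      by apply: measurable_funM => //; exact: measurable_indic.
    have := dom_Lpbar c0 L0 mF1 (dF c0 _ _ L0 (divr_gt0 e0 C0)).
    rewrite -EFinM mulrC (divfK (lt0r_neq0 C0)); apply: le_trans.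
    rewrite le_eqVlt; apply/orP; left; apply/eqP; apply: eq_integral => x xQ.
    by rewrite indicE xQ mulr1.
  by apply: filterS => x /=.
have wp := weight_gt0_ae euc mw w0 wfin wpos r1 K0 RH.
apply: filterS2 wp (ae_foralln H) => x wx Hx.
have [k kx] := @ccube_cover R n d X coord c0 x; have /eqP := Hx k kx.
rewrite eqe mulf_eq0 (gt_eqF wx) orbF => /eqP h.
apply/eqP; rewrite -normr_eq0; apply/negPn/negP => F0.
have : 0 < `|F x| `^ pbar p by rewrite powR_gt0// lt_def F0 normr_ge0.
by rewrite h ltxx.
Qed.

(** Both series differ from their N-th partial sums by tails.  The difference of the
    partial sums is the image of P, the difference of the partial sums of the two
    decompositions of f, and P is itself dominated by tails; so dom_op_local applies. *)
Lemma op_series_unique f (lam nu : nat -> R) (a h : nat -> X -> R) :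
  (forall j, is_block (a j)) -> (coef_sum p lam < +oo)%E ->
  (forall j, is_block (h j)) -> (coef_sum p nu < +oo)%E ->
  {ae mu, forall x, series (fun j => lam j * a j x) @ \oo --> f x} ->
  {ae mu, forall x, series (fun j => nu j * h j x) @ \oo --> f x} ->
  {ae mu, forall x, op_series lam a x = op_series nu h x}.
Proof.
move=> ab lamoo hb nuoo fa fh.
pose F x := op_series lam a x - op_series nu h x.
have mF : measurable_fun setT F by apply: measurable_funB; exact: measurable_op_series.
suff : {ae mu, forall x, F x = 0} by apply: filterS => x /eqP; rewrite subr_eq0 => /eqP.
apply: (dom_null mF) => c L e L0 e0.
pose kp := kappa + 2 `^ pbar p * kappa.
have kp0 : 0 <= kp by rewrite addr_ge0// mulr_ge0 ?powR_ge0.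
(* The four tails contribute 2 kp e1 in all; e2 is what remains of e. *)
pose e1 := e / (2 * (kp + 1)).
have e10 : 0 < e1 by rewrite divr_gt0// mulr_gt0// ltr_wpDl.
pose e2 := e - 2 * kp * e1.
have e20 : 0 < e2.
  have -> : e2 = e * (kp + 1)^-1 by rewrite /e2 /e1; field; rewrite gt_eqF// ltr_wpDl.
  by rewrite mulr_gt0// invr_gt0 ltr_wpDl.
have [N1 HN1] := coef_tail_small lamoo e10; have [N2 HN2] := coef_tail_small nuoo e10.
pose N := maxn N1 N2.
have t1 := HN1 N (leq_maxl _ _); have t2 := HN2 N (leq_maxr _ _).
have t10 := coef_tail_ge0 lam N; have t20 := coef_tail_ge0 nu N.
have k0 : (0 <= kappa%:E)%E by rewrite lee_fin.
pose P y := (\sum_(0 <= j < N) lam j * a j y) + (-1) * \sum_(0 <= j < N) nu j * h j y.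
have Sb (l' : nat -> R) (g' : nat -> X -> R) : (forall j, is_block (g' j)) -> mult_block (fun y => \sum_(0 <= j < N) l' j * g' j y).
  by move=> gb; exact: (mult_block_sum l' N (fun j => is_block_mult (gb j))).
have Pb : mult_block P := mult_blockD (Sb lam a ab) (mult_blockZ (-1) (Sb nu h hb)).
have dtail (l' : nat -> R) (g' : nat -> X -> R) : (forall j, is_block (g' j)) ->
    {ae mu, forall x, series (fun j => l' j * g' j x) @ \oo --> f x} ->
    dom (fun x => f x - \sum_(0 <= j < N) l' j * g' j x) (coef_tail l' N).
  move=> gb gf; exists (fun j => l' (j + N)%N), (fun j => g' (j + N)%N); split.
  - by move=> i; exact: gb.
  - exact: lexx.
  apply: filterS gf => x /(series_tail_le N) /le_trans; apply.
  rewrite le_eqVlt; apply/orP; left; apply/eqP.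
  by apply: eq_eseriesr => j _; rewrite normrM.
have dP : dom P (coef_tail lam N + coef_tail nu N)%E.
  have h1 := dom_scale (-1) (dtail lam a ab fa).
  rewrite normrN1 powR1 mul1e in h1.
  apply: dom_le (domD t10 t20 h1 (dtail nu h hb fh)); last exact: lexx.
  by apply: aeW => x; rewrite le_eqVlt; apply/orP; left; apply/eqP; congr (`|_|); rewrite /P; ring.
have d3 := dom_op_local c Pb dP e20 L0.
have d1 := dom_op_tail ab lamoo N.
have d2 := dom_op_tail hb nuoo N.
have k1 : (0 <= kappa%:E * coef_tail lam N)%E by exact: mule_ge0.
have k2 : (0 <= kappa%:E * coef_tail nu N)%E by exact: mule_ge0.
have k3 : (0 <= (2 `^ pbar p * kappa)%:E * (coef_tail lam N + coef_tail nu N) + e2%:E)%E.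
  apply: adde_ge0; last by rewrite lee_fin ltW.
  by apply: mule_ge0; [rewrite lee_fin mulr_ge0 ?powR_ge0|exact: adde_ge0].
have d2' := dom_scale (-1) d2.
rewrite normrN1 powR1 mul1e in d2'.
apply: dom_le (domD k1 (adde_ge0 k2 k3) d1 (domD k2 k3 d2' d3)).
  have [D1 C1] := op_sum lam N (fun j => DDblock (ab j)).
  have [D2 C2] := op_sum nu N (fun j => DDblock (hb j)).
  have := Clin 1 (-1) D1 D2.
  have -> : (fun y => 1 * (\sum_(0 <= j < N) lam j * a j y) + -1 * (\sum_(0 <= j < N) nu j * h j y)) = P.
    by apply/funext => y; rewrite mul1r.
  apply: filterS3 C1 C2 => x c1 c2 c3.
  rewrite c3 c1 c2 indicE; case: (x \in ccube c L); rewrite ?mulr1 ?mulr0 ?normr0//.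
  by rewrite /F le_eqVlt; apply/orP; left; apply/eqP; congr (`|_|); ring.
clear d1 d2 d3 d2' dP k1 k2 k3 HN1 HN2 fa fh.
have h3 : ((2 `^ pbar p * kappa)%:E * (coef_tail lam N + coef_tail nu N) <= (2 `^ pbar p * kappa * (e1 + e1))%:E)%E.
  by rewrite (EFinM _ (e1 + e1)) (EFinD e1 e1); apply: lee_wpmul2l (leeD t1 t2); rewrite lee_fin mulr_ge0 ?powR_ge0.
have h1 : (kappa%:E * coef_tail lam N <= (kappa * e1)%:E)%E by rewrite EFinM; exact: lee_wpmul2l.
have h2 : (kappa%:E * coef_tail nu N <= (kappa * e1)%:E)%E by rewrite EFinM; exact: lee_wpmul2l.
apply: (le_trans (leeD h1 (leeD h2 (leeD h3 (lexx _))))).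
rewrite -!EFinD lee_fin le_eqVlt; apply/orP; left; apply/eqP.
by rewrite /e2 /kp; ring.
Qed.

End extension.

(** * Extended real powers and Lebesgue norms as integrals *)

Section ereal_powers.
Context {R : realType}.

Lemma poweR_inv_le (t b : R) (a : \bar R) : 0 < t -> 0 <= b -> (0 <= a)%E ->
  (a `^ t^-1 <= b%:E)%E = (a <= (b `^ t)%:E)%E.
Proof.
move=> t0 b0; case: a => [a| |//] a0; last first.
  by rewrite poweRyr ?invr_eq0 ?gt_eqF// !leye_eq.
rewrite poweR_EFin !lee_fin; rewrite lee_fin in a0.
have aE : a = (a `^ t^-1) `^ t by rewrite -powRrM mulVf ?gt_eqF// powRr1.
rewrite [in RHS]aE; apply/idP/idP => [h|]; first exact: powR_le (ltW t0) (powR_ge0 _ _) h.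
exact: powR_le_inv t0 (powR_ge0 _ _) b0.
Qed.

Lemma poweR_le (t : R) (a b : \bar R) : 0 <= t -> (0 <= a)%E -> (a <= b)%E -> (a `^ t <= b `^ t)%E.
Proof.
move=> t0 a0 ab; have b0 := le_trans a0 ab.
by apply: gt0_ler_poweR => //; rewrite in_itv/= leey andbT.
Qed.

Lemma powR_inv_eq (t a : R) : 0 < t -> 0 <= a -> (a `^ t^-1) `^ t = a.
Proof. by move=> t0 a0; rewrite -powRrM mulVf ?gt_eqF// powRr1. Qed.

Lemma cvge0_of_small (u : nat -> \bar R) : (forall N, (0 <= u N)%E) ->
  (forall e, 0 < e -> exists N0, forall N, (N0 <= N)%N -> (u N <= e%:E)%E) -> u @ \oo --> 0%E.
Proof.
move=> u0 h; apply/fine_cvgP; split.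
  have [N0 HN0] := h 1 ltr01; exists N0 => // N /= N0N.
  by rewrite ge0_fin_numE//; apply: le_lt_trans (HN0 N N0N) _; rewrite ltry.
apply/cvgrPdist_le => e e0; have [N0 HN0] := h e e0.
exists N0 => // N /= N0N; have := HN0 N N0N.
rewrite sub0r normrN; case: (u N) (u0 N) => //= a; rewrite !lee_fin => a0 ae.
by rewrite ger0_norm.
Qed.

(** Used to let the BMO bound decrease to the seminorm, which may be zero. *)
Lemma le_of_scaled_le (x y : \bar R) (c beta : R) : (0 <= y)%E -> (y < +oo)%E -> 0 <= c -> 0 <= beta ->
  (forall e, 0 < e -> (x <= (c * (beta + e))%:E * y)%E) -> (x <= c%:E * beta%:E * y)%E.
Proof.
move=> y0 yoo c0 b0; have yf : y \is a fin_num by rewrite ge0_fin_numE.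
rewrite -(fineK yf); have z0 := fine_ge0 y0; move: (fine y) z0 => z z0 H.
have cz1 : 0 < c * z + 1 by rewrite ltr_wpDl// mulr_ge0.
apply/lee_addgt0Pr => e e0; apply: (le_trans (H _ (divr_gt0 e0 cz1))).
rewrite -!EFinM -EFinD lee_fin.
have : c * z * (e / (c * z + 1)) <= e.
  by rewrite mulrCA ler_piMr ?(ltW e0)// ler_pdivrMr// mul1r lerDl.
by rewrite mulrDr mulrDl; lra.
Qed.
End ereal_powers.

Section conversions.
Context {R : realType} {n : nat} {d : measure_display} {X : measurableType d}
  {mu : {measure set X -> \bar R}} {coord : X -> 'I_n -> R}.
Context (euc : euclidean mu coord).
Local Notation ccube := (@ccube R n d X coord).
Local Notation wcube := (@wcube R n d X mu coord).
Implicit Types (l : R) (c : X) (f g h w : X -> R).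

Lemma Lnorm_powR (s : R) h :
  ('N[mu]_s%:E[EFin \o h] = (\int[mu]_x (`|h x| `^ s)%:E) `^ s^-1)%E.
Proof. by rewrite unlock. Qed.

Lemma measurable_on_cubes f : (forall c l, 0 < l -> measurable_fun (ccube c l) (EFin \o f)) ->
  measurable_fun setT f.
Proof.
move=> h; have [c0 _] := euclidean_surj euc (fun=> 0).
have -> : [set: X] = \bigcup_k ccube c0 k.+1%:R.
  apply/seteqP; split=> // x _; have [k kx] := @ccube_cover R n d X coord c0 x.
  by exists k; [|exact: kx].
apply/measurable_fun_bigcup => k; first exact: (measurable_ccube euc).
by apply/measurable_EFinP; apply: h; exact: ltr0Sn.
Qed.

Lemma inv_leb_cube c l : 0 < l -> ((mu (ccube c l))^-1 = (l ^- n)%:E)%E.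
Proof. by move=> l0; rewrite (leb_ccube euc c (ltW l0)) inver gt_eqF// exprn_gt0. Qed.

Lemma reverse_holder_integral w (r C : R) c l : 0 < l -> 1 < r -> measurable_fun setT w ->
  (forall x, 0 <= w x) -> (\int[mu]_(x in ccube c l) (w x)%:E < +oo)%E ->
  (((mu (ccube c l))^-1 * \int[mu]_(x in ccube c l) (w x `^ r)%:E) `^ r^-1 <=
    C%:E * ((mu (ccube c l))^-1 * \int[mu]_(x in ccube c l) (w x)%:E))%E ->
  (\int[mu]_(x in ccube c l) (w x `^ r)%:E <=
    (`|C| `^ r * (l ^+ n * (wcube w c l / l ^+ n) `^ r))%:E)%E.
Proof.
move=> l0 r1 mw w0 wfin; rewrite inv_leb_cube//.
have r0 : 0 < r by apply: lt_trans r1.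
have W0 : 0 <= wcube w c l by apply: fine_ge0; apply: integral_ge0 => x _; rewrite lee_fin.
have -> : (\int[mu]_(x in ccube c l) (w x)%:E = (wcube w c l)%:E)%E.
  rewrite fineK// ge0_fin_numE//; apply: integral_ge0 => x _; by rewrite lee_fin.
set I := (\int[mu]_(x in ccube c l) (w x `^ r)%:E)%E => H.
have I0 : (0 <= I)%E by apply: integral_ge0 => x _; rewrite lee_fin powR_ge0.
have ln0 : 0 < l ^- n by rewrite invr_gt0 exprn_gt0.
have z0 : 0 <= wcube w c l / l ^+ n by rewrite divr_ge0// exprn_ge0// ltW.
have : (((l ^- n)%:E * I) `^ r^-1 <= (`|C| * (wcube w c l / l ^+ n))%:E)%E.
  apply: (le_trans H); rewrite -?EFinM lee_fin [wcube _ _ _ / _]mulrC.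
  by rewrite mulrC in z0; exact: (ler_wpM2r z0 (ler_norm C)).
rewrite poweR_inv_le//; last 2 first.
- by rewrite mulr_ge0.
- by apply: mule_ge0 => //; rewrite lee_fin ltW.
rewrite lee_pdivrMl ?exprn_gt0// (powRM r (normr_ge0 C) z0) -EFinM => /le_trans; apply.
by rewrite lee_fin mulrCA.
Qed.

Lemma mean_osc_integral b c l (a beta : R) : 0 < l ->
  ((mu (ccube c l))^-1 * \int[mu]_(x in ccube c l) `|b x - a|%:E <= beta%:E)%E ->
  (\int[mu]_(x in ccube c l) `|b x - a|%:E <= (beta * l ^+ n)%:E)%E.
Proof.
move=> l0; rewrite inv_leb_cube// lee_pdivrMl ?exprn_gt0//.
by rewrite -EFinM mulrC.
Qed.

Lemma Lnorm_bound_integral (s C B : R) (beta : \bar R) f h : 0 < s -> 0 <= B ->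
  (0 <= beta)%E -> (beta <= B%:E)%E -> (\int[mu]_x (`|h x| `^ s)%:E < +oo)%E ->
  ('N[mu]_s%:E[EFin \o f] <= C%:E * beta * 'N[mu]_s%:E[EFin \o h])%E ->
  (\int[mu]_x (`|f x| `^ s)%:E <= ((`|C| * B) `^ s)%:E * \int[mu]_x (`|h x| `^ s)%:E)%E.
Proof.
move=> s0 B0 b0 bB; rewrite !Lnorm_powR.
have I0 (k : X -> R) : (0 <= \int[mu]_x (`|k x| `^ s)%:E)%E.
  by apply: integral_ge0 => x _; rewrite lee_fin powR_ge0.
set I := (\int[mu]_x (`|h x| `^ s)%:E)%E => Ioo H.
have Ih : I \is a fin_num by rewrite ge0_fin_numE ?I0.
have i0 : 0 <= fine I by apply: fine_ge0; exact: I0.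
rewrite -(fineK Ih) -EFinM -[fine I](powR_inv_eq s0 i0) -powRM ?mulr_ge0 ?powR_ge0//.
rewrite -poweR_inv_le ?mulr_ge0 ?powR_ge0//.
apply: (le_trans H); rewrite -(fineK Ih) poweR_EFin EFinM.
apply: lee_wpmul2r; first by rewrite lee_fin powR_ge0.
apply: (@le_trans _ _ (`|C|%:E * beta)%E).
  by apply: lee_wpmul2r => //; rewrite lee_fin ler_norm.
by rewrite EFinM; apply: lee_wpmul2l.
Qed.

Lemma null_weight_ae w (P : X -> Prop) : measurable_fun setT w -> (forall x, 0 <= w x) ->
  {ae mu, forall x, 0 < w x} ->
  (exists E, [/\ measurable E, (\int[mu]_(x in E) (w x)%:E = 0)%E & forall x, ~ E x -> P x]) <->
  {ae mu, forall x, P x}.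
Proof.
move=> mw w0 wp; split=> [[E [mE iE EP]]|[N [mN N0 PN]]].
  have mwE : measurable_fun E (EFin \o w) by apply: measurable_funTS; exact/measurable_EFinP.
  have /(ae_eq_integral_abs mu mE mwE) : (\int[mu]_(x in E) `|(EFin \o w) x| = 0)%E.
    rewrite -[RHS]iE; apply: eq_integral => x _ /=; by rewrite ger0_norm.
  apply: filterS2 wp => x wx Ex; apply: EP => /Ex /= /eqP.
  by rewrite eqe gt_eqF.
exists N; split; [exact: mN| |].
  apply: (null_set_integral mN _ N0); apply: measurable_funTS; exact/measurable_EFinP.
by move=> x Nx; apply/not_notP => Px; apply: Nx; exact: PN.
Qed.

Section block_conversion.
Context (w : X -> R) (w0 : forall x, 0 <= w x)
  (wfin : forall c l, 0 < l -> (\int[mu]_(x in ccube c l) (w x)%:E < +oo)%E)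
  (wpos : forall c l, 0 < l -> 0 < wcube w c l).
Context (p s : R) (p0 : 0 < p) (s0 : 0 < s).

Lemma block_size_integral h c l : 0 < l ->
  ('N[mu]_s%:E[EFin \o h] <= mu (ccube c l) `^ s^-1 *
     ((\int[mu]_(x in ccube c l) (w x)%:E) `^ p^-1)^-1)%E =
  (\int[mu]_x (`|h x| `^ s)%:E <= (l ^+ n * wcube w c l `^ (- (s / p)))%:E)%E.
Proof.
move=> l0; rewrite Lnorm_powR (leb_ccube euc c (ltW l0)).
have W0 := wpos c l0; have ln0 : 0 < l ^+ n by rewrite exprn_gt0.
have -> : (\int[mu]_(x in ccube c l) (w x)%:E = (wcube w c l)%:E)%E.
  rewrite fineK// ge0_fin_numE ?wfin//; apply: integral_ge0 => x _; by rewrite lee_fin.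
rewrite !poweR_EFin inver gt_eqF ?powR_gt0// -EFinM poweR_inv_le//; last 2 first.
- by rewrite mulr_ge0 ?powR_ge0// invr_ge0 powR_ge0.
- by apply: integral_ge0 => x _; rewrite lee_fin powR_ge0.
rewrite powRM ?powR_ge0 ?invr_ge0 ?powR_ge0// powR_inv_eq ?(ltW ln0)//.
by rewrite powRV ?powR_ge0// -powRrM powRN [p^-1 * s]mulrC.
Qed.
End block_conversion.
End conversions.

(** * The block space and the extension of an operator by series *)

Section block_space.
Context {R : realType} {n : nat} {d : measure_display} {X : measurableType d}
  {mu : {measure set X -> \bar R}} {coord : X -> 'I_n -> R}.
Context (euc : euclidean mu coord).
Local Notation ccube := (@ccube R n d X coord).
Local Notation wcube := (@wcube R n d X mu coord).
Implicit Types (u : 'I_n -> R) (l : R) (c : X) (f g h F G : X -> R).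
Context (w : X -> R) (mw : measurable_fun setT w) (w0 : forall x, 0 <= w x).
Context (wfin : forall c l, 0 < l -> (\int[mu]_(x in ccube c l) (w x)%:E < +oo)%E)
  (wpos : forall c l, 0 < l -> 0 < wcube w c l).
Context (r K : R) (r1 : 1 < r) (K0 : 0 <= K)
  (RH : forall c l, 0 < l -> (\int[mu]_(x in ccube c l) (w x `^ r)%:E <=
    (K * (l ^+ n * (wcube w c l / l ^+ n) `^ r))%:E)%E).
Context (p s : R) (p0 : 0 < p) (rps : r * p / (r - 1) < s).
Local Notation is_block := (@is_block R n d X mu coord w p s).
Local Notation dom := (@dom R n d X mu coord w p s).
Let dom_decomp := @dom_decomp R n d X mu coord euc w mw w0 wfin wpos r K r1 K0 RH p s p0 rps.
Let dom_series := @dom_series R n d X mu coord w p s.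

Definition block_dec f (lam : nat -> R) (a : nat -> X -> R) := [/\ forall j, is_block (a j),
  (coef_sum p lam < +oo)%E &
  {ae mu, forall x, series (fun k => lam k * a k x) @ \oo --> f x}].

Definition block_norm f : \bar R := ereal_inf [set y | exists lam a,
  block_dec f lam a /\ y = (coef_sum p lam `^ (pbar p)^-1%R)%E].

Definition in_block_space f := exists lam a, block_dec f lam a.

Let pb0 : 0 < pbar p := pbar_gt0 p0.
Let ipb0 : 0 < (pbar p)^-1. Proof. by rewrite invr_gt0. Qed.

Lemma coef_sum_ge0 (lam : nat -> R) : (0 <= coef_sum p lam)%E.
Proof. by apply: nneseries_ge0 => j _ _; rewrite lee_fin powR_ge0. Qed.

Lemma block_norm_ge0 f : (0 <= block_norm f)%E.
Proof. by apply: le_ereal_inf_tmp => _ [lam [a [_ ->]]]; exact: poweR_ge0. Qed.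

Lemma block_norm_lty f : in_block_space f -> (block_norm f < +oo)%E.
Proof.
move=> [lam [a da]]; apply: (@le_lt_trans _ _ (coef_sum p lam `^ (pbar p)^-1)%E).
  by apply: ereal_inf_lbound; exists lam, a.
by case: da => _ lamoo _; exact: poweR_lty.
Qed.

Lemma dom_in_block_space F (k : \bar R) : (k < +oo)%E -> measurable_fun setT F -> dom F k ->
  in_block_space F /\ (block_norm F <= k `^ (pbar p)^-1)%E.
Proof.
move=> koo mF dF; have [nu [h [hb nuk Fh]]] := dom_decomp koo mF dF.
have da : block_dec F nu h by split; [exact: hb|exact: le_lt_trans nuk koo|exact: Fh].
split; first by exists nu, h.
apply: (@le_trans _ _ (coef_sum p nu `^ (pbar p)^-1)%E).
  by apply: ereal_inf_lbound; exists nu, h.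
exact: poweR_le (ltW ipb0) (coef_sum_ge0 nu) nuk.
Qed.

(** A bound in terms of every decomposition of f passes to the infimum. *)
Lemma dom_bound G f (kappa : R) : 0 < kappa -> measurable_fun setT G ->
  (forall lam a, block_dec f lam a -> dom G (kappa%:E * coef_sum p lam)%E) -> in_block_space f ->
  in_block_space G /\ (block_norm G <= (kappa `^ (pbar p)^-1)%:E * block_norm f)%E.
Proof.
move=> k0 mG H bf.
have koo lam : (coef_sum p lam < +oo)%E -> (kappa%:E * coef_sum p lam < +oo)%E.
  exact: (lte_mul_pinfty (ltW k0 : (0 <= kappa%:E)%E) isT).
have bound lam a : block_dec f lam a -> in_block_space G /\ (block_norm G <= (kappa%:E * coef_sum p lam) `^ (pbar p)^-1)%E.
  by move=> da; apply: dom_in_block_space mG (H lam a da); apply: koo; case: da.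
split; first by case: bf => lam [a /bound[]].
have kp0 : 0 < kappa `^ (pbar p)^-1 by rewrite powR_gt0.
rewrite -lee_pdivrMl//; apply: le_ereal_inf_tmp => _ [lam [a [da ->]]].
rewrite lee_pdivrMl// -poweR_EFin -poweRM//; first by case: (bound lam a da).
- by rewrite lee_fin ltW.
- exact: coef_sum_ge0.
Qed.

(** A block is its own decomposition; repeating h in place of zero terms avoids a case
    distinction. *)
Lemma block_dec_block h : is_block h -> block_dec h (fun j => (j == 0%N)%:R) (fun=> h).
Proof.
move=> hb; split; first by move=> _; exact: hb.
  rewrite /coef_sum (@nneseries_trunc _ _ 1).
  - by rewrite big_nat1 ltry.
  - by move=> i; rewrite lee_fin powR_ge0.
  - by case=> // i _; rewrite normr0 powR0// gt_eqF.
apply: aeW => x; apply: cvg_near_cst; exists 1%N => // -[//|N] _ /=.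
rewrite /series/= big_nat_recl// big1 ?addr0 ?mul1r// => i _.
by rewrite mul0r.
Qed.

Lemma block_dec_pair f g : is_block f -> is_block g -> block_dec (fun x => f x + g x)
  (fun j => (j < 2)%:R) (fun j => if j is 0%N then f else g).
Proof.
move=> fb gb; split; first by case=> [|j]; [exact: fb|exact: gb].
  rewrite /coef_sum (@nneseries_trunc _ _ 2).
  - by rewrite sumEFin ltry.
  - by move=> i; rewrite lee_fin powR_ge0.
  - by case=> [|[|i]]// _; rewrite normr0 powR0// gt_eqF.
apply: aeW => x; apply: cvg_near_cst; exists 2%N => // -[//|[//|N]] _ /=.
rewrite /series/= big_nat_recl// big_nat_recl// big1 ?addr0 ?mul1r// => i _.
by rewrite mul0r.
Qed.

Section operator.
Context (Op : (X -> R) -> X -> R) (DD : set (X -> R)) (A kappa : R)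
  (A0 : 0 <= A) (kappa0 : 0 < kappa).
Context (Cbound : forall h, is_block h -> measurable_fun setT (Op h) /\
  (\int[mu]_x (`|Op h x| `^ s)%:E <= A%:E * \int[mu]_x (`|h x| `^ s)%:E)%E).
Context (Cdom : forall h, is_block h -> dom (Op h) kappa%:E).

Lemma dominated_image f : in_block_space f -> measurable_fun setT (Op f) ->
  (forall lam a, block_dec f lam a -> {ae mu, forall x,
    (`|Op f x|%:E <= \sum_(0 <= j <oo) (`|lam j| * `|Op (a j) x|)%:E)%E}) ->
  in_block_space (Op f) /\ (block_norm (Op f) <= (kappa `^ (pbar p)^-1)%:E * block_norm f)%E.
Proof.
move=> bf mCf H; apply: dom_bound => // lam a da.
rewrite -nneseriesZl; last by move=> i _; rewrite lee_fin powR_ge0.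
have [ab _ _] := da.
apply: (dom_series (fun j => dom_op_term Cdom lam ab j)).
apply: filterS (H lam a da) => x /le_trans; apply.
rewrite le_eqVlt; apply/orP; left; apply/eqP.
by apply: eq_eseriesr => j _; rewrite normrM.
Qed.

Context (DDlin : forall f g (al be : R), DD f -> DD g -> DD (fun y => al * f y + be * g y)).
Context (DDblock : forall h, is_block h -> DD h).
Context (Clin : forall f g (al be : R), DD f -> DD g -> {ae mu, forall x,
  Op (fun y => al * f y + be * g y) x = al * Op f x + be * Op g x}).

(** A decomposition is chosen; by op_series_unique the choice is immaterial up to null
    sets. *)
Definition extend f : X -> R :=
  if pselect (exists la : (nat -> R) * (nat -> X -> R), block_dec f la.1 la.2) is left e
  then op_series Op (sval (cid e)).1 (sval (cid e)).2 else fun=> 0.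

Lemma extend_op_series f lam a : block_dec f lam a -> {ae mu, forall x, extend f x = op_series Op lam a x}.
Proof.
move=> da; rewrite /extend; case: pselect => [e|]; last by case; exists (lam, a).
have [b1 b2 b3] := svalP (cid e); have [d1 d2 d3] := da.
exact: (op_series_unique euc mw w0 wfin wpos r1 K0 RH p0 rps A0 (ltW kappa0) Cbound Cdom DDlin DDblock Clin b1 b2 d1 d2 b3 d3).
Qed.

Lemma measurable_extend f : measurable_fun setT (extend f).
Proof.
rewrite /extend; case: pselect => [e|_]; last exact: measurable_cst.
have [b1 _ _] := svalP (cid e).
exact: (measurable_op_series Cbound (sval (cid e)).1 b1).
Qed.

Lemma extend_cvg f lam a : block_dec f lam a ->
  {ae mu, forall x, series (fun j => lam j * Op (a j) x) @ \oo --> extend f x}.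
Proof.
move=> da; have [d1 d2 _] := da.
have := op_series_cvg euc mw w0 wfin wpos r1 K0 RH p0 rps (ltW kappa0) Cdom d1 d2.
by apply: filterS2 (extend_op_series da) => x ->.
Qed.

Lemma extend_block h : is_block h -> {ae mu, forall x, extend h x = Op h x}.
Proof.
move=> hb; apply: filterS (extend_cvg (block_dec_block hb)) => x hx.
apply/esym; apply: cvg_unique hx => //.
apply: cvg_near_cst; exists 1%N => // -[//|N] _ /=.
rewrite /series/= big_nat_recl// big1 ?addr0 ?mul1r// => i _.
by rewrite mul0r.
Qed.

Lemma extend_tail f lam a N : block_dec f lam a ->
  dom (fun x => extend f x - \sum_(0 <= j < N) lam j * Op (a j) x) (kappa%:E * coef_tail p lam N)%E.
Proof.
move=> da; have [d1 d2 _] := da.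
have := dom_op_tail euc mw w0 wfin wpos r1 K0 RH p0 rps (ltW kappa0) Cdom d1 d2 N.
apply: dom_le; last exact: lexx.
by apply: filterS (extend_op_series da) => x ->.
Qed.

Lemma extend_norm_cvg f lam a : block_dec f lam a ->
  (fun N => block_norm (fun x => extend f x - \sum_(0 <= j < N) lam j * Op (a j) x)) @ \oo --> 0%E.
Proof.
move=> da; have [d1 d2 _] := da.
apply: cvge0_of_small => [N|e e0]; first exact: block_norm_ge0.
have ep0 : 0 < e `^ pbar p / kappa by rewrite divr_gt0// powR_gt0.
have [N0 HN0] := coef_tail_small d2 ep0.
exists N0 => N /HN0 tN.
have kt : (kappa%:E * coef_tail p lam N <= (e `^ pbar p)%:E)%E.
  apply: (@le_trans _ _ (kappa%:E * (e `^ pbar p / kappa)%:E)%E).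
    by apply: lee_wpmul2l => //; rewrite lee_fin ltW.
  by rewrite -EFinM lee_fin mulrC divfK// gt_eqF.
have mF : measurable_fun setT (fun x => extend f x - \sum_(0 <= j < N) lam j * Op (a j) x).
  apply: measurable_funB; first exact: measurable_extend.
  apply: measurable_sum => j; apply: measurable_funM => //; by case: (Cbound (d1 j)).
have [_ /le_trans] := dom_in_block_space (le_lt_trans kt (ltry _)) mF (extend_tail N da).
apply; apply: (@le_trans _ _ ((e `^ pbar p)%:E `^ (pbar p)^-1)%E).
  apply: (poweR_le (ltW ipb0) _ kt); apply: mule_ge0; first by rewrite lee_fin ltW.
  exact: coef_tail_ge0.
by rewrite poweR_EFin lee_fin -powRrM mulfV ?gt_eqF// powRr1// ltW.
Qed.

Lemma extend_bound f : in_block_space f ->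
  in_block_space (extend f) /\ (block_norm (extend f) <= (kappa `^ (pbar p)^-1)%:E * block_norm f)%E.
Proof.
apply: dom_bound => //; first exact: measurable_extend.
move=> lam a da; have := extend_tail 0 da.
have -> : coef_tail p lam 0 = coef_sum p lam.
  by apply: eq_eseriesr => j _; rewrite addn0.
apply: dom_le; last exact: lexx.
by apply: aeW => x; rewrite big_geq// subr0.
Qed.

End operator.
End block_space.

(** * The commutator on the block space *)

Section commutator_extension.
Context {R : realType} {n : nat} {d : measure_display} {X : measurableType d}
  {mu : {measure set X -> \bar R}} {coord : X -> 'I_n -> R}.
Context (euc : euclidean mu coord).
Local Notation ccube := (@ccube R n d X coord).
Local Notation wcube := (@wcube R n d X mu coord).
Implicit Types (u : 'I_n -> R) (l : R) (c : X) (f g h F G : X -> R).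
Context (w : X -> R) (mw : measurable_fun setT w) (w0 : forall x, 0 <= w x).
Context (wfin : forall c l, 0 < l -> (\int[mu]_(x in ccube c l) (w x)%:E < +oo)%E)
  (wpos : forall c l, 0 < l -> 0 < wcube w c l).
Context (r K : R) (r1 : 1 < r) (K0 : 0 <= K)
  (RH : forall c l, 0 < l -> (\int[mu]_(x in ccube c l) (w x `^ r)%:E <=
    (K * (l ^+ n * (wcube w c l / l ^+ n) `^ r))%:E)%E).
Context (p s : R) (p0 : 0 < p) (rps : r * p / (r - 1) < s).
Local Notation is_block := (@is_block R n d X mu coord w p s).
Local Notation dom := (@dom R n d X mu coord w p s).
Local Notation block_dec := (@block_dec R n d X mu coord w p s).
Local Notation in_block_space := (@in_block_space R n d X mu coord w p s).
Local Notation block_norm := (@block_norm R n d X mu coord w p s).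
Local Notation dist := (@dist R n d X coord).
Context (s1 : 1 < s).
Context (q KD : R) (n0 : (0 < n)%N) (qp : q < p) (KD0 : 0 < KD).
Context (Dq : forall c l lam, 0 < l -> 1 < lam ->
  wcube w c (lam * l) <= KD * lam `^ (n%:R * q) * wcube w c l).
Context (T : (X -> R) -> (X -> R)) (D : set (X -> R)) (A1 A2 : R) (A10 : 0 <= A1) (A20 : 0 <= A2).
Context (Dlin : forall f g (al be : R), D f -> D g -> D (fun y => al * f y + be * g y)).
Context (Dblock : forall h, is_block h -> D h).
Context (size : forall h c l, is_block h -> 0 < l -> (forall x, h x != 0 -> ccube c l x) ->
  {ae mu, forall x, ~ ccube c (2 * Num.sqrt n%:R * l) x ->
    (`|T h x|%:E <= A1%:E * \int[mu]_y `|h y|%:E * (dist x c ^- n)%:E)%E}).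
Context (b : X -> R) (beta : R) (mb : measurable_fun setT b) (beta0 : 0 <= beta).
Context (ib : forall c l, 0 < l -> (\int[mu]_(x in ccube c l) `|b x|%:E < +oo)%E).
Context (bmo : forall c l, 0 < l ->
  exists a, (\int[mu]_(x in ccube c l) `|b x - a|%:E <= (beta * l ^+ n)%:E)%E).
Local Notation Tb := (comm T b).
Context (comm_bound : forall h, is_block h -> measurable_fun setT (Tb h) /\
  (\int[mu]_x (`|Tb h x| `^ s)%:E <= ((A2 * beta) `^ s)%:E * \int[mu]_x (`|h x| `^ s)%:E)%E).

Local Notation comm_const := (@comm_const R n p s A1 A2 q KD).
Let C : R := comm_const `^ (pbar p)^-1.

Let s0 : 0 < s. Proof. by apply: lt_trans s1. Qed.
Let pb0 : 0 < pbar p := pbar_gt0 p0.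
Let C0 : 0 < C. Proof. by rewrite powR_gt0//; exact: comm_const_gt0. Qed.

Let kap (e : R) : R := comm_const * (beta + e) `^ pbar p.

Let be0 e : 0 < e -> 0 < beta + e.
Proof. by move=> e0; rewrite ltr_wpDl. Qed.

Let kap_gt0 e : 0 < e -> 0 < kap e.
Proof.
move=> e0; apply: mulr_gt0; first exact: comm_const_gt0.
exact: (powR_gt0 _ (be0 e0)).
Qed.

Let kap_root e : 0 < e -> kap e `^ (pbar p)^-1 = C * (beta + e).
Proof.
move=> e0; have c0 : 0 <= comm_const by apply: ltW; exact: comm_const_gt0.
rewrite /kap (powRM _ c0 (powR_ge0 _ _)) -powRrM mulfV ?gt_eqF// powRr1//.
exact: (ltW (be0 e0)).
Qed.

Section subadditive.
Context (Tsub : forall f g, D f -> D g -> {ae mu, forall x, forall al be : R,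
  `|T (fun y => al * f y + be * g y) x| <= `|al| * `|T f x| + `|be| * `|T g x|}).
Context (comm_subadd : forall f g, is_block f -> is_block g ->
  {ae mu, forall x, `|Tb (fun y => f y + g y) x| <= `|Tb f x| + `|Tb g x|}).

(** comm_dom needs a positive bound on the oscillation, and beta may be zero. *)
Lemma comm_dom_eps e h : 0 < e -> is_block h -> dom (Tb h) (kap e)%:E.
Proof.
move=> e0 hb.
have bmo' c l : 0 < l -> exists a, (\int[mu]_(x in ccube c l) `|b x - a|%:E <= ((beta + e) * l ^+ n)%:E)%E.
  move=> l0; have [a ha] := bmo c l0; exists a; apply: (le_trans ha).
  by rewrite lee_fin ler_wpM2r ?exprn_ge0 ?(ltW l0)// lerDl (ltW e0).
have cb' g : is_block g -> measurable_fun setT (Tb g) /\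
  (\int[mu]_x (`|Tb g x| `^ s)%:E <= ((A2 * (beta + e)) `^ s)%:E * \int[mu]_x (`|g x| `^ s)%:E)%E.
  move=> gb; have [mg ig] := comm_bound gb; split; first exact: mg.
  apply: (le_trans ig); apply: lee_wpmul2r.
    by apply: integral_ge0 => x _; rewrite lee_fin powR_ge0.
  rewrite lee_fin; apply: (powR_le (ltW s0) (mulr_ge0 A20 beta0)).
  by apply: (ler_wpM2l A20); rewrite lerDl (ltW e0).
exact: (comm_dom euc wpos r1 p0 rps s1 A10 A20 Dlin Tsub Dblock size mb (be0 e0) ib bmo' cb' comm_subadd n0 qp KD0 Dq hb).
Qed.

Theorem sublinear_bound : (forall f, in_block_space f -> measurable_fun setT (Tb f)) ->
  (forall f lam a, block_dec f lam a -> {ae mu, forall x,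
    (`|Tb f x|%:E <= \sum_(0 <= j <oo) (`|lam j| * `|Tb (a j) x|)%:E)%E}) ->
  forall f, in_block_space f -> in_block_space (Tb f) /\ (block_norm (Tb f) <= C%:E * beta%:E * block_norm f)%E.
Proof.
move=> mT dT f bf.
have H e : 0 < e -> in_block_space (Tb f) /\ (block_norm (Tb f) <= (kap e `^ (pbar p)^-1)%:E * block_norm f)%E.
  move=> e0; exact: (dominated_image euc mw w0 wfin wpos r1 K0 RH p0 rps (kap_gt0 e0) (fun h hb => comm_dom_eps e0 hb) bf (mT f bf) (dT f)).
split; first by case: (H 1 ltr01).
apply: le_of_scaled_le; [exact: block_norm_ge0|exact: (block_norm_lty bf)|exact: ltW|exact: beta0|].
by move=> e e0; rewrite -kap_root//; case: (H e e0).
Qed.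

End subadditive.

Section linear.
Context (Tlin : forall f g, D f -> D g -> {ae mu, forall x, forall al be : R,
  T (fun y => al * f y + be * g y) x = al * T f x + be * T g x}).
Context (Db : forall h x, is_block h -> D (fun y => (b x - b y) * h y)).

Let DD : set (X -> R) := [set f | D f /\ D (fun y => b y * f y)].

Let DDlin f g (al be : R) : DD f -> DD g -> DD (fun y => al * f y + be * g y).
Proof.
move=> [f1 f2] [g1 g2]; split; first exact: Dlin.
have -> : (fun y => b y * (al * f y + be * g y)) = (fun y => al * (b y * f y) + be * (b y * g y)).
  by apply/funext => y; ring.
exact: Dlin.
Qed.

Let DDblock h : is_block h -> DD h.
Proof.
move=> hb; split; first exact: Dblock.
have [x0 _] := euclidean_surj euc (fun=> 0).
have -> : (fun y => b y * h y) = (fun y => b x0 * h y + (-1) * ((b x0 - b y) * h y)).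
  by apply/funext => y; ring.
apply: Dlin; [exact: Dblock|exact: Db].
Qed.

(** Linearity may be applied with the scalars b x and -1 since its exceptional null set
    is the same for all scalars. *)
Lemma comm_formula f : DD f ->
  {ae mu, forall x, Tb f x = b x * T f x - T (fun y => b y * f y) x}.
Proof.
move=> [f1 f2]; apply: filterS (Tlin f1 f2) => x /(_ (b x) (-1)).
rewrite mulN1r => <-; rewrite /comm; congr (T _ x).
by apply/funext => y; ring.
Qed.

Lemma comm_linear f g (al be : R) : DD f -> DD g -> {ae mu, forall x,
  Tb (fun y => al * f y + be * g y) x = al * Tb f x + be * Tb g x}.
Proof.
move=> Df Dg; have DF := DDlin al be Df Dg.
have [f1 f2] := Df; have [g1 g2] := Dg.
have bE : (fun y => b y * (al * f y + be * g y)) = (fun y => al * (b y * f y) + be * (b y * g y)).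
  by apply/funext => y; ring.
have := comm_formula DF; rewrite bE => h0.
apply: filterS3 (filterI (comm_formula Df) (comm_formula Dg)) (filterI (Tlin f1 g1) (Tlin f2 g2)) h0.
move=> x [hf hg] [h1 h2] ->; rewrite h1 h2 hf hg; ring.
Qed.

Let Tsub f g : D f -> D g -> {ae mu, forall x, forall al be : R,
  `|T (fun y => al * f y + be * g y) x| <= `|al| * `|T f x| + `|be| * `|T g x|}.
Proof.
move=> Df Dg; apply: filterS (Tlin Df Dg) => x h al be.
by rewrite h -!normrM ler_normD.
Qed.

Let comm_subadd f g : is_block f -> is_block g ->
  {ae mu, forall x, `|Tb (fun y => f y + g y) x| <= `|Tb f x| + `|Tb g x|}.
Proof.
move=> fb gb; have := comm_linear 1 1 (DDblock fb) (DDblock gb).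
have -> : (fun y => 1 * f y + 1 * g y) = (fun y => f y + g y) by apply/funext => y; rewrite !mul1r.
by apply: filterS => x ->; rewrite !mul1r ler_normD.
Qed.

Let cdom e (e0 : 0 < e) h (hb : is_block h) := comm_dom_eps Tsub comm_subadd e0 hb.

Theorem linear_extension : let S := @extend R n d X mu coord w p s Tb in
  [/\ forall h, is_block h -> {ae mu, forall x, S h x = Tb h x},
      forall f, in_block_space f -> in_block_space (S f) /\ (block_norm (S f) <= C%:E * beta%:E * block_norm f)%E &
      forall f lam a, block_dec f lam a ->
        (fun N => block_norm (fun x => S f x - \sum_(0 <= j < N) lam j * Tb (a j) x)) @ \oo --> 0%E /\
        {ae mu, forall x, series (fun j => lam j * Tb (a j) x) @ \oo --> S f x}].
Proof.
move=> S; have A0 : 0 <= (A2 * beta) `^ s by exact: powR_ge0.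
split.
- move=> h hb; exact: (extend_block euc mw w0 wfin wpos r1 K0 RH p0 rps A0 (kap_gt0 ltr01) comm_bound (cdom ltr01) DDlin DDblock comm_linear hb).
- move=> f bf.
  have H e (e0 : 0 < e) := extend_bound euc mw w0 wfin wpos r1 K0 RH p0 rps A0 (kap_gt0 e0) comm_bound (cdom e0) DDlin DDblock comm_linear bf.
  split; first by case: (H 1 ltr01).
  apply: le_of_scaled_le; [exact: block_norm_ge0|exact: (block_norm_lty bf)|exact: ltW|exact: beta0|].
  by move=> e e0; rewrite -kap_root//; case: (H e e0).
- move=> f lam a da; split.
    exact: (extend_norm_cvg euc mw w0 wfin wpos r1 K0 RH p0 rps A0 (kap_gt0 ltr01) comm_bound (cdom ltr01) DDlin DDblock comm_linear da).
  exact: (extend_cvg euc mw w0 wfin wpos r1 K0 RH p0 rps A0 (kap_gt0 ltr01) comm_bound (cdom ltr01) DDlin DDblock comm_linear da).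
Qed.

End linear.
End commutator_extension.

(** * The coordinates of R^n *)

Section Rn_euclidean.
Context {R : realType} {n : nat}.
Local Notation X1 := (measurableTypeR R).

Let rays_tuple : set (set (n.-tuple X1)) := [set A | exists i a, A = [set x | a < tnth x i]].

(** The product sigma-algebra is generated by preimages of Borel sets under the
    coordinates, and the Borel sets of the line by the open rays. *)
Lemma tuple_measurable_rays (A : set (n.-tuple X1)) : measurable A -> <<s rays_tuple >> A.
Proof.
apply: smallest_sub; first exact: smallest_sigma_algebra.
apply: (big_ind (fun S : set (set (n.-tuple X1)) => S `<=` <<s rays_tuple >>)).
- by move=> ?.
- by move=> S S' h h' B [/h|/h'].
move=> i _ _ [B mB <-]; move: B mB.
rewrite -[forall B, _]/(@measurable _ X1 `<=`
  image_set_system setT (fun x : n.-tuple X1 => tnth x i) <<s rays_tuple >>).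
rewrite -[@measurable _ X1]/((@ocitv R).-sigma.-measurable) RGenOInfty.measurableE.
apply: smallest_sub.
  by apply: sigma_algebra_image; exact: smallest_sigma_algebra.
move=> _ [a ->]; apply: sub_sigma_algebra; exists i, a.
by apply/seteqP; split=> x /=; rewrite in_itv/= andbT => // -[].
Qed.

Lemma Rn_measurable_tuple (A : set (n.-tuple X1)) : measurable A ->
  measurable (A : set (Rn R n)).
Proof. by move=> mA; apply: sub_caratheodory; apply: sub_sigma_algebra; exact: mA. Qed.

Lemma leb_tuple (A : set (n.-tuple X1)) : measurable A ->
  leb R n (A : set (Rn R n)) = lebesgue_tuple n A.
Proof. by move=> mA; apply: measurable_mu_extE; exact: mA. Qed.

(** By definition of the outer measure E has a countable cover by product-measurable
    sets with almost the same measure. *)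
Lemma Rn_regular (E : set (Rn R n)) (e : R) : measurable E -> (leb R n E < +oo)%E -> 0 < e ->
  exists G, [/\ <<s [set A | exists i a, A = [set x : Rn R n | a < Defs.coord x i]] >> G,
    E `<=` G & (leb R n (G `\` E) <= e%:E)%E].
Proof.
move=> mE Eoo e0.
have Ef : leb R n E \is a fin_num by rewrite ge0_fin_numE ?measure_ge0.
have [_ [F [mF EF] <-] Fe] := lb_ereal_inf_adherent e0 (Ef : mu_ext (lebesgue_tuple n) E \is a fin_num).
pose G := \bigcup_k F k.
have mG : measurable G by exact: bigcupT_measurable.
have mG' := Rn_measurable_tuple mG.
exists G; split; [exact: (tuple_measurable_rays mG)|exact: EF|].
have GE : (leb R n G <= leb R n E + e%:E)%E.
  apply: le_trans (ltW Fe); apply: ereal_inf_lbound; exists F; [|reflexivity].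
  by split; [exact: mF|exact: subset_refl].
have := measureDI (leb R n) mG' mE.
rewrite (setIidr EF) => GDE; rewrite GDE in GE.
by rewrite -(leeD2rE _ _ Ef) [leRHS]addeC.
Qed.

Lemma Rn_euclidean : euclidean (leb R n) (@Defs.coord R n).
Proof.
split.
- move=> A mA; exact: (Rn_measurable_tuple (@measurable_tbox R n A mA)).
- move=> A mA; rewrite (leb_tuple (@measurable_tbox R n A mA)).
  exact: (@lebesgue_tuple_box R n A mA).
- move=> u; exists ([tuple u i | i < n] : n.-tuple R) => i.
  by rewrite /Defs.coord tnth_mktuple.
- exact: Rn_regular.
Qed.

End Rn_euclidean.

(** * Weights and blocks on R^n *)

Section transfer.
Context {R : realType} {n : nat}.
Local Notation mu := (leb R n).
Local Notation euc := (@Rn_euclidean R n).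
Local Notation wcube := (@wcube R n _ _ mu (@Defs.coord R n)).

Lemma loc_integrable_measurable (f : Rn R n -> R) : loc_integrable f -> measurable_fun setT f.
Proof.
move=> fl; apply: (measurable_on_cubes euc) => c l l0.
exact: (measurable_int mu (fl c l l0)).
Qed.

Lemma loc_integrable_lty (f : Rn R n -> R) c l : loc_integrable f -> 0 < l ->
  (\int[mu]_(x in Defs.cube c l) `|f x|%:E < +oo)%E.
Proof. by move=> fl l0; have /integrableP[_ h] := fl c l l0; exact: h. Qed.

Lemma weight_lty (w : Rn R n -> R) c l : weight w -> 0 < l ->
  (\int[mu]_(x in Defs.cube c l) (w x)%:E < +oo)%E.
Proof.
move=> [w0 wl] l0; rewrite (eq_integral (fun x => `|w x|%:E)); last first.
  by move=> x _; rewrite ger0_norm.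
exact: loc_integrable_lty.
Qed.

Lemma weight_measurable (w : Rn R n -> R) : weight w -> measurable_fun setT w.
Proof. by move=> [_ /loc_integrable_measurable]. Qed.

Section positive_weight.
Context (w : Rn R n -> R) (ww : weight w)
  (wpos : forall c l, 0 < l -> 0 < wcube w c l) (wp : {ae mu, forall x, 0 < w x}).
Context (p s : R) (p0 : 0 < p) (s0 : 0 < s).
Local Notation is_block := (@is_block R n _ _ mu (@Defs.coord R n) w p s).
Local Notation block_dec := (@block_dec R n _ _ mu (@Defs.coord R n) w p s).
Local Notation in_block_space := (@in_block_space R n _ _ mu (@Defs.coord R n) w p s).
Local Notation block_norm := (@block_norm R n _ _ mu (@Defs.coord R n) w p s).

Lemma block_is_block h : block p s w h <-> is_block h.
Proof.
have wfin c l := @weight_lty w c l ww; have w0 := ww.1.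
have bsE := block_size_integral euc w0 wfin wpos p s0 h.
split=> [[mh [c [l [l0 sh ih]]]]|[c [l [mh l0 sh ih]]]].
  by exists c, l; split; [exact: mh|exact: l0|exact: sh|rewrite -(bsE c l l0); exact: ih].
split; first exact: mh.
by exists c, l; split; [exact: l0|exact: sh|rewrite (bsE c l l0); exact: ih].
Qed.

Lemma wae_ae (P : Rn R n -> Prop) : wae w P <-> {ae mu, forall x, P x}.
Proof. exact: (null_weight_ae P (weight_measurable ww) ww.1 wp). Qed.

Lemma block_decomp_dec f lam a : block_decomp p s w f lam a <-> block_dec f lam a.
Proof.
split=> -[h1 h2 h3].
  by split; [move=> j; apply/block_is_block; exact: h1|exact: h2|apply/wae_ae; exact: h3].
by split; [move=> j; apply/block_is_block; exact: h1|exact: h2|apply/wae_ae; exact: h3].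
Qed.

Lemma BH_in_block_space f : BH p s w f <-> in_block_space f.
Proof. by split=> -[lam [a /block_decomp_dec h]]; exists lam, a; exact: h. Qed.

Lemma BHnorm_block_norm f : BHnorm p s w f = block_norm f.
Proof.
congr ereal_inf; apply/seteqP; split=> _ [lam [a [/block_decomp_dec h ->]]];
  by exists lam, a; split; [exact: h|reflexivity].
Qed.
End positive_weight.

Section null_weight.
Context (w : Rn R n -> R) (ww : weight w) (w_null : forall c l, 0 < l -> wmeas w (Defs.cube c l) = 0%E).
Context (p s : R) (p0 : 0 < p) (s0 : 0 < s).

Lemma wae_null (P : Rn R n -> Prop) : wae w P.
Proof.
exists setT; split; [exact: measurableT| |by move=> x /(_ I)].
have mw := weight_measurable ww; have [w0 _] := ww.
have [c0 _] := euclidean_surj euc (fun=> 0).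
have mwE A : measurable_fun A (EFin \o w) by apply: measurable_funTS; exact/measurable_EFinP.
have h k : {ae mu, forall x, Defs.cube c0 k.+1%:R x -> (EFin \o w) x = 0%E}.
  apply/(ae_eq_integral_abs mu (Defs.measurable_cube c0 k.+1%:R) (mwE _)).
  rewrite -[RHS](w_null c0 (ltr0Sn _ k)); apply: eq_integral => x _ /=.
  by rewrite ger0_norm.
have wz : {ae mu, forall x, setT x -> (EFin \o w) x = 0%E}.
  apply: filterS (ae_foralln h) => x hx _.
  by have [k kx] := @ccube_cover R n _ _ (@Defs.coord R n) c0 x; exact: hx k kx.
have /(ae_eq_integral_abs mu measurableT (mwE _)) := wz.
rewrite /wmeas => iw; rewrite -[RHS]iw; apply: eq_integral => x _ /=.
by rewrite ger0_norm.
Qed.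

Lemma zero_block : block p s w (fun=> 0).
Proof.
split; first exact: measurable_cst.
have [c0 _] := euclidean_surj euc (fun=> 0).
exists c0, 1; split; [exact: ltr01|by move=> x; rewrite eqxx|].
rewrite Lnorm_powR (eq_integral (fun=> 0%E)); last first.
  by move=> x _; rewrite normr0 powR0// gt_eqF.
rewrite integral0 poweR0r ?invr_eq0 ?gt_eqF//; apply: mule_ge0; first exact: poweR_ge0.
by rewrite inve_ge0 poweR_ge0.
Qed.

Lemma block_decomp_null f : block_decomp p s w f (fun=> 0) (fun=> fun=> 0).
Proof.
split; [by move=> k; exact: zero_block| |exact: wae_null].
rewrite /coef_sum eseries0 ?ltry// => i _ _.
by rewrite normr0 powR0// gt_eqF// pbar_gt0.
Qed.

Lemma BH_null f : BH p s w f.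
Proof. by exists (fun=> 0), (fun=> fun=> 0); exact: block_decomp_null. Qed.

Lemma BHnorm_null f : BHnorm p s w f = 0%E.
Proof.
apply/eqP; rewrite eq_le; apply/andP; split; last first.
  by apply: le_ereal_inf_tmp => _ [lam [a [_ ->]]]; exact: poweR_ge0.
apply: ereal_inf_lbound; exists (fun=> 0), (fun=> fun=> 0); split; first exact: block_decomp_null.
rewrite /coef_sum eseries0.
  by rewrite poweR0r// invr_eq0 gt_eqF// pbar_gt0.
by move=> i _ _; rewrite normr0 powR0// gt_eqF// pbar_gt0.
Qed.
End null_weight.

Lemma BMOnorm_ge0 (b : Rn R n -> R) : (0 <= BMOnorm b)%E.
Proof.
have [c0 _] := euclidean_surj euc (fun=> 0).
apply: le_trans (ereal_sup_ubound _); last by exists c0, 1; split; [exact: ltr01|reflexivity].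
rewrite (inv_leb_cube euc c0 ltr01); apply: mule_ge0; first by rewrite lee_fin expr1n invr1.
by apply: integral_ge0 => x _; rewrite lee_fin.
Qed.

(** Every cube lies in a dilate of the given one, whose weight D_q controls. *)
Lemma wmeas_null_dilate (w : Rn R n -> R) q c0 l0 : weight w -> class_D q w -> 0 < l0 ->
  wmeas w (Defs.cube c0 l0) = 0%E -> forall c l, 0 < l -> wmeas w (Defs.cube c l) = 0%E.
Proof.
move=> ww [Cd HD] l00 h0 c l l1; have [w0 _] := ww; have mw := weight_measurable ww.
pose M := \sum_i `|Defs.coord c i - Defs.coord c0 i|.
have M0 : 0 <= M by rewrite sumr_ge0.
pose lam := (l + 2 * M) / l0 + 1.
have lam1 : 1 < lam by rewrite ltrDr divr_gt0// ltr_wpDr// mulr_ge0.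
have sub : Defs.cube c l `<=` Defs.cube c0 (lam * l0).
  move=> x cx i; have h1 : `|Defs.coord c i - Defs.coord c0 i| <= M.
    by rewrite /M (bigD1 i)//= lerDl sumr_ge0.
  have := ler_distD (Defs.coord c i) (Defs.coord x i) (Defs.coord c0 i); have := cx i.
  have -> : lam * l0 = l + 2 * M + l0 by rewrite /lam; field; exact: lt0r_neq0.
  by move: h1; lra.
apply/eqP; rewrite eq_le; apply/andP; split; last first.
  by apply: integral_ge0 => x _; rewrite lee_fin.
have := HD c0 l0 lam l00 lam1; rewrite h0 mule0; apply: le_trans.
apply: ge0_subset_integral; [exact: Defs.measurable_cube|exact: Defs.measurable_cube| | |exact: sub].
- by apply: measurable_funTS; exact/measurable_EFinP.
- by move=> x _; rewrite lee_fin.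
Qed.

End transfer.

Theorem theorem2p3 (R : realType) (n : nat) (p q r s : R) (w : Rn R n -> R)
    (D : set (Rn R n -> R))
    (T : (Rn R n -> R) -> (Rn R n -> R)) (C1 C2 : R) :
  (0 < n)%N -> 0 < p -> weight w -> 0 < q -> q < p -> 1 < r -> class_A q r w ->
  Num.max (p / q) (r * p / (r - 1)) < s ->
  (forall h, block p s w h -> D h) -> size_condition p s w T C1 ->
  exists C : R, 0 < C /\ forall b : Rn R n -> R,
    BMO b ->
    (forall h x, block p s w h -> D (fun y => (b x - b y) * h y)) ->
    commutator_bound p s w T b C2 ->
    (linear_op D T ->
      exists S : (Rn R n -> R) -> (Rn R n -> R),
      [/\ series_extension p s w (commutator T b) S,
          forall f, BH p s w f ->
            (BHnorm p s w (S f) <= C%:E * BMOnorm b * BHnorm p s w f)%E &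
          forall S', series_extension p s w (commutator T b) S' ->
            forall f, BH p s w f -> wae w (fun x => S' f x = S f x)]) /\
    (sublinear_op D T ->
      (forall f, BH p s w f -> measurable_fun setT (commutator T b f)) ->
      series_domination p s w (commutator T b) -> class_P w ->
      exists S : (Rn R n -> R) -> (Rn R n -> R),
      [/\ forall f, BH p s w f -> wae w (fun x => S f x = commutator T b f x),
          bounded_on_BH p s w S &
          forall f, BH p s w f ->
            (BHnorm p s w (S f) <= C%:E * BMOnorm b * BHnorm p s w f)%E]).
Proof.
move=> n0 p0 ww q0 qp r1 [HD HRH]; rewrite gt_max => /andP[pqs rps] Dblock size.
have s1 : 1 < s by apply: lt_trans pqs; rewrite ltr_pdivlMr// mul1r.
have s0 : 0 < s by apply: lt_trans s1.
have euc := @Rn_euclidean R n.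
have mw := weight_measurable ww; have w0 := ww.1.
have wfin c l := @weight_lty R n w c l ww.
have [wpos|/existsNP[c0 /existsNP[l0 /not_implyP[l00 /negP]]]] :=
  pselect (forall c l, 0 < l -> 0 < @wcube R n _ _ (leb R n) (@Defs.coord R n) w c l); last first.
  (* Some cube has weight zero, hence every cube has; then every function is
     w-a.e. the sum of the zero series, and any operator will do. *)
  rewrite -leNgt => wc0.
  have w00 : wmeas w (Defs.cube c0 l0) = 0%E.
    rewrite /wmeas (wcubeE w0 wfin c0 l00); congr EFin; apply/eqP.
    rewrite eq_le wc0; apply: fine_ge0; apply: integral_ge0 => x _; by rewrite lee_fin.
  have wn := wmeas_null_dilate ww HD l00 w00.
  have wz := wae_null ww wn.
  have BH0 := BH_null ww wn p0 s0; have N0 := BHnorm_null ww wn p0 s0.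
  have bd S : bounded_on_BH p s w S.
    split; first by move=> f _; exact: BH0.
    by exists 0 => f _; rewrite !N0 mule0.
  have bd' S f b : (BHnorm p s w (S f) <= 1%:E * BMOnorm b * BHnorm p s w f)%E.
    by rewrite !N0 mule0.
  exists 1; split; first exact: ltr01.
  move=> b _ _ _; split=> [_|_ _ _ _]; exists (commutator T b); split.
  - split; [by move=> h _; exact: wz|exact: bd|].
    move=> f lam a _; split; last exact: wz.
    rewrite (_ : (fun N => _) = (fun=> 0%E)); first exact: cvg_cst.
    by apply/funext => N; rewrite N0.
  - by move=> f _; exact: bd'.
  - by move=> S' _ f _; exact: wz.
  - by move=> f _; exact: wz.
  - exact: bd.
  - by move=> f _; exact: bd'.
have [Cr HRH'] := HRH; pose K := `|Cr| `^ r; have K0 : 0 <= K by exact: powR_ge0.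
have RH c l (l0 : 0 < l) := reverse_holder_integral euc l0 r1 mw w0 (wfin c l l0) (HRH' c l l0).
have wp := weight_gt0_ae euc mw w0 wfin wpos r1 K0 RH.
have [Cd HD'] := HD; pose KD := `|Cd| + 1.
have KD0 : 0 < KD by rewrite /KD ltr_wpDl.
have Dq c l lam : 0 < l -> 1 < lam ->
    @wcube R n _ _ (leb R n) (@Defs.coord R n) w c (lam * l) <=
    KD * lam `^ (n%:R * q) * @wcube R n _ _ (leb R n) (@Defs.coord R n) w c l.
  move=> l0 lam1; have lamp : 0 < lam * l by rewrite mulr_gt0// (lt_trans _ lam1).
  have := HD' c l lam l0 lam1.
  rewrite /wmeas (wcubeE w0 wfin c l0) (wcubeE w0 wfin c lamp) -EFinM lee_fin => /le_trans; apply.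
  apply: (ler_wpM2r (ltW (wpos c l l0))); apply: (ler_wpM2r (powR_ge0 _ _)).
  by apply: (le_trans (ler_norm Cd)); rewrite lerDl.
have bs := block_is_block ww wpos p s0.
have wa := wae_ae ww wp.
have da := block_decomp_dec ww wpos wp p s0.
have ba := BH_in_block_space ww wpos wp p s0.
have na := BHnorm_block_norm ww wpos wp p s0.
have Dblock' h hb := Dblock h ((bs h).2 hb).
have size' h c l : @is_block R n _ _ (leb R n) (@Defs.coord R n) w p s h -> 0 < l ->
    (forall x, h x != 0 -> Defs.cube c l x) ->
    {ae leb R n, forall x, ~ Defs.cube c (2 * Num.sqrt n%:R * l) x ->
    (`|T h x|%:E <= `|C1|%:E * \int[leb R n]_y `|h y|%:E * (@dist R n _ _ (@Defs.coord R n) x c ^- n)%:E)%E}.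
  move=> hb l0 sh; apply: filterS (size h c l ((bs h).2 hb) l0 sh) => x hx cx.
  apply: (le_trans (hx cx)); rewrite Lnorm1.
  apply: lee_wpmul2r; first by rewrite lee_fin invr_ge0 exprn_ge0// sqrtr_ge0.
  apply: lee_wpmul2r; last by rewrite lee_fin ler_norm.
  by apply: integral_ge0 => y _; rewrite lee_fin.
exists (@comm_const R n p s `|C1| `|C2| q KD `^ (pbar p)^-1); split.
  rewrite powR_gt0//; exact: comm_const_gt0.
move=> b [bl bfin] Db Hcb.
have b0 := BMOnorm_ge0 b; pose beta := fine (BMOnorm b).
have bE : BMOnorm b = beta%:E by rewrite fineK// ge0_fin_numE.
have beta0 : 0 <= beta by exact: fine_ge0.
have mb := loc_integrable_measurable bl.
have ib c l := @loc_integrable_lty R n b c l bl.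
have bmo c l : 0 < l -> exists a, (\int[leb R n]_(x in Defs.cube c l) `|b x - a|%:E <= (beta * l ^+ n)%:E)%E.
  move=> l0; exists (mean b c l); apply: (mean_osc_integral euc l0).
  by rewrite -bE; apply: ereal_sup_ubound; exists c, l; split; [exact: l0|reflexivity].
have cb h : @is_block R n _ _ (leb R n) (@Defs.coord R n) w p s h ->
    measurable_fun setT (comm T b h) /\
    (\int[leb R n]_x (`|comm T b h x| `^ s)%:E <= ((`|C2| * beta) `^ s)%:E * \int[leb R n]_x (`|h x| `^ s)%:E)%E.
  move=> hb; have [mC iC] := Hcb h ((bs h).2 hb); split; first exact: mC.
  have [c [l [_ _ _ ih]]] := hb.
  apply: (Lnorm_bound_integral s0 beta0 b0 _ (le_lt_trans ih (ltry _)) iC).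
  by rewrite bE lexx.
split.
  move=> [Dlin Tlin].
  have Db' h x hb := Db h x ((bs h).2 hb).
  have [e1 e2 e3] := linear_extension euc mw w0 wfin wpos r1 K0 RH p0 rps s1 n0 qp KD0 Dq
    (normr_ge0 C1) (normr_ge0 C2) Dlin Dblock' size' mb beta0 ib bmo cb Tlin Db'.
  set S := extend _ _ _ _ in e1 e2 e3.
  have bound f : BH p s w f -> (BHnorm p s w (S f) <=
      (@comm_const R n p s `|C1| `|C2| q KD `^ (pbar p)^-1)%:E * BMOnorm b * BHnorm p s w f)%E.
    by rewrite !na bE => /ba /e2[].
  have sf : series_formula p s w (commutator T b) S.
    move=> f lam a /da /e3[h1 h2]; split; last by apply/wa; exact: h2.
    rewrite (_ : (fun N => _) = (fun N => @block_norm R n _ _ (leb R n) (@Defs.coord R n) w p s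
      (fun x => S f x - \sum_(0 <= j < N) lam j * comm T b (a j) x))); first exact: h1.
    by apply/funext => N; rewrite na.
  exists S; split; [split; [|split; [|]|exact: sf]|exact: bound|].
  - by move=> h /bs /e1 h1; apply/wa; exact: h1.
  - by move=> f /ba /e2[h1 _]; apply/ba; exact: h1.
  - exists (@comm_const R n p s `|C1| `|C2| q KD `^ (pbar p)^-1 * beta) => f bf.
    by rewrite EFinM -bE; exact: bound.
  - move=> S' [_ _ sf'] f [lam [a dfa]].
    have [_ /wa h1] := sf' f lam a dfa; have [_ /wa h2] := sf f lam a dfa.
    apply/wa; apply: filterS2 h1 h2 => x h1 h2.
    exact: (cvg_unique _ h1 h2).
move=> [Dlin Tsub] mT dT _.
have dT' f lam a : @block_dec R n _ _ (leb R n) (@Defs.coord R n) w p s f lam a -> {ae leb R n, forall x,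
    (`|comm T b f x|%:E <= \sum_(0 <= j <oo) (`|lam j| * `|comm T b (a j) x|)%:E)%E}.
  by move=> /da /dT /wa.
have csub f g : @is_block R n _ _ (leb R n) (@Defs.coord R n) w p s f ->
    @is_block R n _ _ (leb R n) (@Defs.coord R n) w p s g ->
    {ae leb R n, forall x, `|comm T b (fun y => f y + g y) x| <= `|comm T b f x| + `|comm T b g x|}.
  move=> fb gb; apply: filterS (dT' _ _ _ (block_dec_pair p0 fb gb)) => x.
  rewrite (@nneseries_trunc _ _ 2).
  - by rewrite big_nat_recr//= big_nat1 !normr1 !mul1r -EFinD lee_fin.
  - by move=> i; rewrite lee_fin mulr_ge0.
  - by case=> [|[|i]]// _; rewrite normr0 mul0r.
have mT' f (bf : @in_block_space R n _ _ (leb R n) (@Defs.coord R n) w p s f) := mT f ((ba f).2 bf).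
have e2 := sublinear_bound euc mw w0 wfin wpos r1 K0 RH p0 rps s1 n0 qp KD0 Dq
    (normr_ge0 C1) (normr_ge0 C2) Dlin Dblock' size' mb beta0 ib bmo cb Tsub csub mT' dT'.
have bound f : BH p s w f -> (BHnorm p s w (commutator T b f) <=
    (@comm_const R n p s `|C1| `|C2| q KD `^ (pbar p)^-1)%:E * BMOnorm b * BHnorm p s w f)%E.
  by rewrite !na bE => /ba /e2[].
exists (commutator T b); split; [|split; [|]|exact: bound].
- by move=> f _; apply/wa; exact: aeW.
- by move=> f /ba /e2[h1 _]; apply/ba; exact: h1.
- exists (@comm_const R n p s `|C1| `|C2| q KD `^ (pbar p)^-1 * beta) => f bf.
  by rewrite EFinM -bE; exact: bound.
Qed.
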